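(* If $\lambda\in C_6$, then $t^1_{\mathrm{conj}}(\lambda)=t^1_{\mathrm{MAX}}(\lambda)$, i.e. $t^1_{\mathrm{conj}}(\lambda)=\frac4{|c|}p_1^V(0)$.
   Context: Let $G=\mathbb R^5$ with coordinates $(x,y,z,v,w)$ (the Cartan group, identity $0$), vector fields $X_1=\partial_x-\frac y2\partial_z-\frac{x^2+y^2}{2}\partial_w$, $X_2=\partial_y+\frac x2\partial_z+\frac{x^2+y^2}{2}\partial_v$; sub-Riemannian problem $\dot g=u_1X_1+u_2X_2$, fixed endpoints, minimize $\int\sqrt{u_1^2+u_2^2}\,dt$. For $\lambda=(\theta,c,\alpha,\beta)$, $\theta,\beta\in S^1$, $c\in\mathbb R$, $\alpha\ge0$: $\mathrm{Exp}(\lambda,t)=g(t)$ with $g(0)=0$, $\dot g=\cos\theta(t)X_1+\sin\theta(t)X_2$, $\dot\theta=c$, $\dot c=-\alpha\sin(\theta-\beta)$, $(\theta(0),c(0))=(\theta,c)$. $C_6=\{\alpha=0,\ c\ne0\}$. $t^1_{\mathrm{conj}}(\lambda)=\sup\{t>0:\mathrm{Exp}(\lambda,\cdot)|_{[0,t]}\text{ is locally optimal}\}$ (minimizing length among admissible curves with same endpoints in a $C([0,t],G)$-neighborhood). $p_1^V(0)\in(\pi/2,\pi)$ is the first positive root of $f_V^0(p)=[(32p^2-1)\cos2p-8p\sin2p+\cos6p]/512$, and $t^1_{\mathrm{MAX}}(\lambda)=\frac4{|c|}p_1^V(0)$ for $\lambda\in C_6$. *)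

(* Defs.v *)
From HB Require Import structures.
From mathcomp Require Import all_boot all_order all_algebra.
From mathcomp Require Import all_classical all_reals all_analysis.
Set Implicit Arguments. Unset Strict Implicit. Unset Printing Implicit Defensive.
Import Order.TTheory GRing.Theory Num.Theory.
Import numFieldNormedType.Exports.
Local Open Scope classical_set_scope.
Local Open Scope ring_scope.

Section Cartan.
Variable R : realType.

Record curve := Curve { cx : R -> R; cy : R -> R; cz : R -> R;
                        cv : R -> R; cw : R -> R }.

Definition seg (a b : R) : set R := [set r | a <= r <= b].

Definition leb := @lebesgue_measure R.

(* (g, u1, u2) is an admissible pair on [0,t]: u = (u1,u2) is an L^infty
   control (measurable, bounded) and g is the (absolutely continuous)
   Caratheodory solution of  g' = u1 X1(g) + u2 X2(g)  on [0,t], where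
   X1 = d_x - y/2 d_z - (x^2+y^2)/2 d_w,  X2 = d_y + x/2 d_z + (x^2+y^2)/2 d_v. *)
Definition admissible (t : R) (g : curve) (u1 u2 : R -> R) : Prop :=
  measurable_fun (seg 0 t) u1 /\ measurable_fun (seg 0 t) u2 /\
  (exists M : R, forall s, 0 <= s <= t -> `|u1 s| <= M /\ `|u2 s| <= M) /\
  forall s, 0 <= s <= t ->
    [/\ cx g s = cx g 0 + Rintegral leb (seg 0 s) u1,
        cy g s = cy g 0 + Rintegral leb (seg 0 s) u2,
        cz g s = cz g 0 + Rintegral leb (seg 0 s)
                   (fun r => - (cy g r / 2) * u1 r + cx g r / 2 * u2 r),
        cv g s = cv g 0 + Rintegral leb (seg 0 s)
                   (fun r => (cx g r ^+ 2 + cy g r ^+ 2) / 2 * u2 r) &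
        cw g s = cw g 0 + Rintegral leb (seg 0 s)
                   (fun r => - ((cx g r ^+ 2 + cy g r ^+ 2) / 2) * u1 r)].

Definition sr_length (t : R) (u1 u2 : R -> R) : R :=
  Rintegral leb (seg 0 t) (fun r => Num.sqrt (u1 r ^+ 2 + u2 r ^+ 2)).

Definition same_point (g g' : curve) (s s' : R) : Prop :=
  [/\ cx g s = cx g' s', cy g s = cy g' s', cz g s = cz g' s',
      cv g s = cv g' s' & cw g s = cw g' s'].

Definition unif_close (t eps : R) (g g' : curve) : Prop :=
  forall s, 0 <= s <= t ->
    [/\ `|cx g s - cx g' s| < eps, `|cy g s - cy g' s| < eps,
        `|cz g s - cz g' s| < eps, `|cv g s - cv g' s| < eps &
        `|cw g s - cw g' s| < eps].

Definition locally_optimal (t : R) (g : curve) (u1 u2 : R -> R) : Prop :=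
  admissible t g u1 u2 /\
  exists eps : R, 0 < eps /\
    forall (g' : curve) (w1 w2 : R -> R),
      admissible t g' w1 w2 ->
      same_point g' g 0 0 -> same_point g' g t t ->
      unif_close t eps g g' ->
      sr_length t u1 u2 <= sr_length t w1 w2.

(* (thf, cf, g) is the extremal Exp(lambda, .), lambda = (th0, c, alpha, beta):
   thf' = cf, cf' = -alpha sin(thf - beta), (thf,cf)(0) = (th0,c), g(0) = 0,
   g' = cos thf X1(g) + sin thf X2(g). *)
Definition extremal (th0 c alpha beta : R) (thf cf : R -> R) (g : curve) : Prop :=
  [/\ thf 0 = th0, cf 0 = c, same_point g (Curve (fun=> 0) (fun=> 0)
        (fun=> 0) (fun=> 0) (fun=> 0)) 0 0 &
   forall s : R,
   [/\ is_derive s 1 thf (cf s),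
       is_derive s 1 cf (- alpha * sin (thf s - beta)),
       is_derive s 1 (cx g) (cos (thf s)),
       is_derive s 1 (cy g) (sin (thf s)) &
       [/\ is_derive s 1 (cz g)
             (- (cy g s / 2) * cos (thf s) + cx g s / 2 * sin (thf s)),
           is_derive s 1 (cv g)
             ((cx g s ^+ 2 + cy g s ^+ 2) / 2 * sin (thf s)) &
           is_derive s 1 (cw g)
             (- ((cx g s ^+ 2 + cy g s ^+ 2) / 2) * cos (thf s))]]].

Definition t1conj (thf : R -> R) (g : curve) : \bar R :=
  ereal_sup ((fun t : R => t%:E) @`
    [set t : R | 0 < t /\ locally_optimal t g (fun r => cos (thf r))
                                                (fun r => sin (thf r))]).

Definition fV0 (p : R) : R :=
  ((32 * p ^+ 2 - 1) * cos (2 * p) - 8 * p * sin (2 * p) + cos (6 * p)) / 512.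

Definition p1V0 : R := inf [set p : R | 0 < p /\ fV0 p = 0].

End Cartan.

(* Main.v *)
Require Import Defs.
From HB Require Import structures.
From mathcomp Require Import all_boot all_order all_algebra.
From mathcomp Require Import all_classical all_reals all_analysis.
From mathcomp Require Import ring lra.
Set Implicit Arguments. Unset Strict Implicit. Unset Printing Implicit Defensive.
Import Order.TTheory GRing.Theory Num.Theory.
Import numFieldNormedType.Exports.
Local Open Scope classical_set_scope.
Local Open Scope ring_scope.

(** Write k = |c|; the projection of the extremal to the (x, y) plane is an arc
    of a circle of radius 1/k.  After a similarity the problem becomes: a plane
    curve q with clock d sigma = q1 dq2 - q2 dq1 and moments
    dW = (|q|^2 - 1)/2 dq is to be compared with the unit circle
    q = e^{i sigma}, on which W = 0.

    Below the critical time, put a + i b = q e^{-i sigma} - 1 and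
    Y = (a, b, W1, W2).  The function S = sigma + b/2 - ab/2 + Y^T K(sigma) Y / 2
    calibrates the circle: dS <= |dq| near it, as soon as K satisfies a strict
    Riccati inequality.  Such a K is P X^{-1} - e s X^{-T} X^{-1}, where the
    columns of X and P are the Jacobi fields vanishing at s = 0; X is invertible
    up to the first conjugate time because det X(2t) = 2 oddD(t) evenD(t),
    where evenD < 0 on (0, 3 pi/2] and oddD vanishes first at t = 2 p1V0,
    since f_V^0(p) = - oddD(2p)/128.

    Beyond the critical time, oddD < 0 and the second variation is negative on
    an explicit field eta.  A competitor is the circle with radius multiplied by
    rho, rho^3 = 1 + e eta + O(e^2) theta: the conditions on v and w are linear
    in rho^3 and hold exactly, the remaining area condition is met by adjusting
    the coefficient of theta, and the length drops by a multiple of e^2. *)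

(** * Derivatives and trigonometric inequalities *)

(** Competitors are close in position only and their velocities are arbitrary, so positivity of the
    second variation alone would not give local optimality. A calibration settles this: its gradient
    depends on position, and one bound on the gradient covers every velocity. Controls are merely
    bounded and measurable, so this bound is integrated through increments of the curve, not through
    derivatives almost everywhere. The clock of a competitor is the area it has swept itself, and b
    measures the gap between this clock and the polar angle. The density of W vanishes on the
    circle, so to first order b, W1 and W2 are all driven by a; this gives the linear system whose
    Jacobi fields appear below. The cube of the radius enters because, in polar coordinates about
    the centre, the moments of |q|^2 dq are integrals of rho^3 e^{i theta} up to end terms and a
    multiple of the area. Past the critical time a competitor is built only while the half-angle t
    is below 3 pi / 2, where sin t and cos t are negative. Later times reduce to these, since local
    optimality passes to shorter intervals. *)

Section Der.
Variable R : realType.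
Implicit Types (f g : R -> R) (x : R).

Lemma der_cst (c x : R) : is_derive x 1 (fun=> c) 0.
Proof. exact: is_derive_cst. Qed.
Lemma der_id x : is_derive x 1 (fun y : R => y) 1.
Proof. exact: is_derive_id. Qed.
Lemma derD f g x a b : is_derive x 1 f a -> is_derive x 1 g b ->
  is_derive x 1 (fun y => f y + g y) (a + b).
Proof. by move=> *; exact: is_deriveD. Qed.
Lemma derN f x a : is_derive x 1 f a -> is_derive x 1 (fun y => - f y) (- a).
Proof. by move=> *; exact: is_deriveN. Qed.
Lemma derM f g x a b : is_derive x 1 f a -> is_derive x 1 g b ->
  is_derive x 1 (fun y => f y * g y) (a * g x + f x * b).
Proof.
move=> fa gb; have := is_deriveM fa gb.
move=> h; apply: (is_derive_eq h); rewrite /GRing.scale /=; ring.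
Qed.
Lemma derX f n x a : is_derive x 1 f a ->
  is_derive x 1 (fun y => f y ^+ n) (n%:R * f x ^+ n.-1 * a).
Proof.
move=> fa; have := is_deriveX n fa; rewrite exprfctE => h.
by apply: (is_derive_eq h); rewrite /GRing.scale.
Qed.
Lemma derV f x a : f x != 0 -> is_derive x 1 f a ->
  is_derive x 1 (fun y => (f y)^-1) (- (a / f x ^+ 2)).
Proof.
move=> f0 fa; apply: (is_derive_eq (is_deriveV f0 fa)).
by rewrite /GRing.scale /= mulNr mulrC.
Qed.
Lemma der_comp g f x a b : is_derive (f x) 1 g a -> is_derive x 1 f b ->
  is_derive x 1 (fun y => g (f y)) (a * b).
Proof. exact: is_derive1_comp. Qed.
Lemma der_sin f x a : is_derive x 1 f a ->
  is_derive x 1 (fun y => sin (f y)) (cos (f x) * a).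
Proof. by move=> h; apply: (der_comp (is_derive_sin _)). Qed.
Lemma der_cos f x a : is_derive x 1 f a ->
  is_derive x 1 (fun y => cos (f y)) (- sin (f x) * a).
Proof. by move=> h; apply: (der_comp (is_derive_cos _)). Qed.
Lemma der_cont f x a : is_derive x 1 f a -> {for x, continuous f}.
Proof.
by move=> h; apply: differentiable_continuous; apply/derivable1_diffP; case: h.
Qed.
End Der.

Lemma der_eq (R : realType) (f : R -> R) (x a b : R) :
  is_derive x 1 f a -> a = b -> is_derive x 1 f b.
Proof. by move=> fa <-. Qed.

(** The derivative is an existential variable filled by following the shape of the function, so
    [der] leaves only an equation between the computed and the stated derivative.
    [notypeclasses refine] keeps instance search from choosing the derivative itself. *)
Ltac der_step := first [ eassumption
  | notypeclasses refine (der_cst _ _) | notypeclasses refine (der_id _)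
  | notypeclasses refine (derD _ _)
  | notypeclasses refine (derN _)
  | notypeclasses refine (derM _ _)
  | notypeclasses refine (derX _ _)
  | notypeclasses refine (der_sin _)
  | notypeclasses refine (der_cos _) ].
Ltac der := notypeclasses refine (der_eq _ _); [repeat der_step|].

Section Mvt.
Variable R : realType.
Implicit Types (f df : R -> R) (a b x t : R).

Lemma mvt f df a b : a < b ->
  (forall x, a <= x <= b -> is_derive x 1 f (df x)) ->
  exists c, [/\ a < c, c < b & f b - f a = df c * (b - a)].
Proof.
move=> ab fdf.
have [c|x|c] := @MVT R f df a b ab.
- by rewrite in_itv /= => /andP[ac cb]; apply: fdf; rewrite !ltW.
- apply: continuous_in_subspaceT => y; rewrite inE /= in_itv /= => aby.
  exact: der_cont (fdf _ aby).
- by rewrite in_itv /= => /andP[ac cb] e; exists c.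
Qed.

Lemma der_gt0_lt f df a b : a < b ->
  (forall x, a <= x <= b -> is_derive x 1 f (df x)) ->
  (forall x, a < x < b -> 0 < df x) -> f a < f b.
Proof.
move=> ab /(mvt ab)[c [ac cb e]] pos; rewrite -subr_gt0 e mulr_gt0 //.
  by apply: pos; rewrite ac.
by rewrite subr_gt0.
Qed.

Lemma der_ge0_le f df a b : a <= b ->
  (forall x, a <= x <= b -> is_derive x 1 f (df x)) ->
  (forall x, a < x < b -> 0 <= df x) -> f a <= f b.
Proof.
rewrite le_eqVlt => /orP[/eqP-> //|ab].
move=> /(mvt ab)[c [ac cb e]] pos; rewrite -subr_ge0 e mulr_ge0 //.
  by apply: pos; rewrite ac.
by rewrite subr_ge0 ltW.
Qed.

Lemma sin_le_id x : 0 <= x -> sin x <= x.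
Proof.
move=> x0.
have D t : 0 <= t <= x -> is_derive t 1 (fun t : R => t - sin t) (1 - cos t).
  by move=> _; der; rewrite /=; ring.
have /= := @der_ge0_le _ _ 0 x x0 D.
rewrite sin0 subrr subr_ge0; apply => t _.
by rewrite subr_ge0 cos_le1.
Qed.

Lemma norm_sin_le x : `|sin x| <= `|x|.
Proof.
wlog x0 : x / 0 <= x.
  move=> h; have [/h //|/ltW x0] := leP 0 x.
  by rewrite -normrN -sinN -[`|x|]normrN; apply: h; rewrite oppr_ge0.
rewrite [`|x|]ger0_norm // ler_norml sin_le_id // andbT.
have D t : 0 <= t <= x -> is_derive t 1 (fun t : R => sin t + t) (cos t + 1).
  by move=> _; der; rewrite /=; ring.
have /= := @der_ge0_le _ _ 0 x x0 D.
rewrite sin0 addr0 => h; have : 0 <= sin x + x; last by lra.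
by apply: h => t _; have := cos_geN1 t; lra.
Qed.

Lemma cos_ge_quad x : 1 - x ^+ 2 / 2 <= cos x.
Proof.
wlog x0 : x / 0 <= x.
  move=> h; have [/h //|/ltW x0] := leP 0 x.
  by rewrite -cosN -sqrrN; apply: h; rewrite oppr_ge0.
have -> : cos x = 1 - 2 * sin (x / 2) ^+ 2.
  have {1}-> : x = (x / 2) *+ 2 by rewrite -mulr_natr divfK // pnatr_eq0.
  by rewrite cos_mulr2n cos2sin2; ring.
have [s0|s0] := leP 0 (sin (x / 2)).
  have := @sin_le_id (x / 2) (divr_ge0 x0 (ler0n _ _)); nra.
have := sin_geN1 (x/2).
have [h|h] := leP x 2; last by nra.
have : 0 <= sin (x / 2); last by lra.
by apply: sin_ge0_pi; have := @pi_ge2 R; lra.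
Qed.

Lemma sin_ge_half x : 0 <= x <= 1 -> x / 2 <= sin x.
Proof.
move=> /andP[x0 x1].
have D t : 0 <= t <= x -> is_derive t 1 (fun t : R => sin t - t / 2) (cos t - 1 / 2).
  by move=> _; der; rewrite /=; ring.
have /= := @der_ge0_le _ _ 0 x x0 D.
rewrite sin0 mul0r subrr subr_ge0; apply => t ?.
by have := cos_ge_quad t; nra.
Qed.

(** At pi / 2 the quadratic bound on cos reads 0 >= 1 - pi^2 / 8, hence pi >= 2 sqrt 2. The
    numerical estimates in [variation] rest on this margin. *)
Lemma pi_ge : 14 / 5 <= pi :> R.
Proof.
rewrite leNgt; apply/negP => h.
have := cos_ge_quad (pi / 2); rewrite cos_pihalf; have := @pi_ge2 R; nra.
Qed.

Lemma sin_lt0_pi x : pi < x < 2 * pi -> sin x < 0.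
Proof.
move=> h; rewrite -[x](subrK pi) sinDpi oppr_lt0; apply: sin_gt0_pi; lra.
Qed.

Lemma cos_sin_le0 x : pi <= x <= 3 / 2 * pi -> cos x <= 0 /\ sin x <= 0.
Proof.
move=> h; rewrite -[x](subrK pi) sinDpi cosDpi !oppr_le0.
have p2 : 2 <= pi :> R := @pi_ge2 R.
by split; [apply: cos_ge0_pihalf|apply: sin_ge0_pi]; lra.
Qed.

Lemma cos_sin_lt0 x : pi < x < 3 / 2 * pi -> cos x < 0 /\ sin x < 0.
Proof.
move=> h; rewrite -[x](subrK pi) sinDpi cosDpi !oppr_lt0.
have p2 : 2 <= pi :> R := @pi_ge2 R.
by split; [apply: cos_gt0_pihalf|apply: sin_gt0_pi]; lra.
Qed.

(* Up to positive constants, [oddD (s / 2)] and [evenD (s / 2)] are the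
   determinants of the odd and of the even Jacobi fields of the constrained
   second variation on an interval of length [s]. *)
Definition oddD (t : R) : R := t * sin t + sin t ^+ 2 * cos t - 2 * t ^+ 2 * cos t.
Definition evenD (t : R) : R := 2 * t ^+ 3 * sin t + 3 * t ^+ 2 * cos t
  - t * sin t * (6 - sin t ^+ 2) + 3 * sin t ^+ 2 * cos t.

Lemma cs1 (t : R) : cos t ^+ 2 = 1 - sin t ^+ 2.
Proof. by rewrite cos2sin2. Qed.

Lemma sin_cos_lt t : 0 < t -> sin t * cos t < t.
Proof.
move=> t0; have [t1|t1] := ltP t pi; last first.
  have := cs1 t; have := @pi_ge2 R; nra.
have D x : 0 <= x <= t ->
    is_derive x 1 (fun t => t - sin t * cos t) (2 * sin x ^+ 2).
  by move=> _; der; rewrite /=; have := cs1 x; nra.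
have /= := @der_gt0_lt _ _ 0 t t0 D.
rewrite sin0 mul0r subrr subr_gt0; apply => x hx.
have /sin_gt0_pi : 0 < x < pi by lra.
by nra.
Qed.

(** Division by sin turns the derivative into a square, so [oddD / sin] increases on each interval
    of positive numbers without zeros of sin. All sign information on [oddD] comes from this. *)
Lemma oddD_ratio_der t : sin t != 0 ->
  is_derive t 1 (fun t => oddD t * (sin t)^-1)
    (2 * (t - sin t * cos t) ^+ 2 / sin t ^+ 2).
Proof.
move=> st; rewrite /oddD; der.
  by apply: derV => //; apply: is_derive_sin.
have := cs1 t; move: (sin t) (cos t) st => s c st /= cs.
have c3 : c ^+ 3 = c * (1 - s ^+ 2) by rewrite -cs; ring.
have c4 : c ^+ 4 = (1 - s ^+ 2) ^+ 2 by rewrite -cs; ring.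
field : cs => //.
Qed.
End Mvt.

(** * Signs of the two determinants *)

Section Roots.
Variable R : realType.
Implicit Types (t x : R).

Lemma oddD_ratio_lt t1 t2 : t1 < t2 ->
  (0 < t1 /\ t2 < pi) \/ (pi < t1 /\ t2 < 2 * pi) ->
  oddD t1 / sin t1 < oddD t2 / sin t2.
Proof.
move=> t12 h.
have s0 x : t1 <= x <= t2 -> sin x != 0.
  move=> hx; have [[? ?]|[? ?]] := h.
    have /sin_gt0_pi /gt_eqF -> // : 0 < x < pi by lra.
  have /sin_lt0_pi /lt_eqF -> // : pi < x < 2 * pi by lra.
apply: (@der_gt0_lt R (fun t => oddD t * (sin t)^-1)
   (fun t => 2 * (t - sin t * cos t) ^+ 2 / sin t ^+ 2) t1 t2 t12).
  by move=> x /s0; exact: oddD_ratio_der.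
move=> x hx.
have x0 : 0 < x by have := @pi_gt0 R; case: h => -[? ?]; lra.
have := @sin_cos_lt R x x0; rewrite -subr_gt0 => h1.
apply: divr_gt0; first by rewrite mulr_gt0 // exprn_gt0.
rewrite lt_neqAle sqr_ge0 andbT eq_sym sqrf_eq0; apply: s0; lra.
Qed.

(** The increasing ratio [oddD / sin] tends to 0 at 0. A nonpositive value at t would make it at
    most some - k < 0 on (0, t / 2], and this fails near 0. *)
Lemma oddD_gt0 t : 0 < t < pi -> 0 < oddD t.
Proof.
move=> t1p; rewrite ltNge; apply/negP => W1.
have st := @sin_gt0_pi _ _ t1p.
have st2 : 0 < sin (t / 2) by apply: sin_gt0_pi; lra.
have h : oddD (t / 2) / sin (t / 2) < 0.
  apply: (@lt_le_trans _ _ (oddD t / sin t)).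
    by apply: oddD_ratio_lt; [lra|left; split; lra].
  by rewrite pmulr_lle0 // invr_gt0.
set k := - (oddD (t / 2) / sin (t / 2)) in h *.
have k0 : 0 < k by rewrite oppr_gt0.
(* With 4 e <= k and sin e >= e / 2, one gets 2 e^2 cos e <= 4 e (e / 2) <= k sin e, while the other
   two terms of [oddD e] are nonnegative. *)
have [e [e0 e1 e2 e3]] : exists e : R, [/\ 0 < e, e <= 1, e < t / 2 & 4 * e <= k].
  exists (Num.min 1 (Num.min (t / 4) (k / 4))).
  rewrite !lt_min !ge_min !gt_min; split; rewrite ?lexx //; try lra.
  rewrite -ler_pdivlMl //.
  by rewrite !ge_min; apply/orP; right; apply/orP; right; lra.
have : oddD e / sin e < - k.
  by rewrite opprK; apply: oddD_ratio_lt => //; left; split; lra.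
have se0 : 0 < sin e by apply: sin_gt0_pi; lra.
rewrite ltr_pdivrMr // /oddD.
have c0 : 0 <= cos e by apply: cos_ge0_pihalf; have := @pi_ge2 R; lra.
have := cos_le1 e; have := @sin_ge_half R e; have : 0 <= e <= 1 by lra.
move=> -> /(_ isT) h1 h2 h3.
have : 2 * e ^+ 2 * cos e <= k * sin e.
  apply: (@le_trans _ _ (2 * e ^+ 2)); first by nra.
  apply: (@le_trans _ _ (4 * e * (e / 2))); first by nra.
  by nra.
have : 0 < e * sin e by rewrite mulr_gt0.
have : 0 <= sin e ^+ 2 * cos e by rewrite mulr_ge0 // sqr_ge0.
lra.
Qed.

Lemma der_gt0_pos (f df : R -> R) (b : R) : 0 < b -> f 0 = 0 ->
  (forall x : R, is_derive x 1 f (df x)) -> (forall x : R, 0 < x < b -> 0 < df x) ->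
  0 < f b.
Proof. by move=> b0 f0 D pos; have := @der_gt0_lt R f df 0 b b0 (fun x _ => D x) pos; rewrite f0. Qed.

(** [A] is to [evenD] what sin is to [oddD]: the derivative of [evenD / A] is - 2 B^2 / A^2, with
    [B] as below. *)
Let A t := sin t - t * cos t.
Let dA x : is_derive x 1 A (x * sin x).
Proof. by rewrite /A; der; rewrite /=; ring. Qed.

Let A_gt0 t : 0 < t < pi -> 0 < A t.
Proof.
move=> tp; apply: (@der_gt0_pos A (fun x => x * sin x)) => //.
- by lra.
- by rewrite /A sin0 mul0r subr0.
- by move=> x xt; rewrite mulr_gt0 ?sin_gt0_pi //; lra.
Qed.

Let B t := t ^+ 2 + t * sin t * cos t - 2 * sin t ^+ 2.
(** [B] and its derivative vanish at 0, and the second derivative is 4 sin t A t. *)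
Let B_gt0 t : 0 < t < pi -> 0 < B t.
Proof.
move=> tp; apply: (@der_gt0_pos B
  (fun x => 3 * (x - sin x * cos x) - 2 * x * sin x ^+ 2)); first by lra.
- by rewrite /B sin0; ring.
- by move=> x; rewrite /B; der; rewrite /=; have e := cs1 x; ring: e.
move=> x xt; apply: (@der_gt0_pos
  (fun x => 3 * (x - sin x * cos x) - 2 * x * sin x ^+ 2)
  (fun x => 4 * sin x * A x)).
- by lra.
- by rewrite sin0; ring.
- by move=> y; rewrite /A; der; rewrite /=; have e := cs1 y; ring: e.
- move=> y yx; have yp : 0 < y < pi by lra.
  by rewrite !mulr_gt0 ?A_gt0 ?sin_gt0_pi.
Qed.

Let dE x : is_derive x 1 (@evenD R) (2 * x ^+ 3 * cos x + 3 * x ^+ 2 * sin x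
  + 3 * x * sin x ^+ 2 * cos x - 8 * sin x ^+ 3).
Proof.
rewrite /evenD; der; rewrite /=; have e := cs1 x.
ring: e.
Qed.

Let E_ratio_lt t1 t2 : t1 < t2 -> 0 < t1 -> t2 < pi ->
  evenD t2 / A t2 < evenD t1 / A t1.
Proof.
move=> t12 h1 h2.
rewrite -ltrN2.
apply: (@der_gt0_lt R (fun t => - (evenD t * (A t)^-1))
   (fun t => 2 * (B t) ^+ 2 / A t ^+ 2) t1 t2 t12).
  move=> x hx; have A0 : A x != 0 by apply: lt0r_neq0; apply: A_gt0; lra.
  have dEx := dE x; have dAx := derV A0 (dA x).
  der; rewrite /=.
  have := cs1 x; move: A0; rewrite /evenD /A /B.
  move: (sin x) (cos x) => s c /= A0 cs.
  have c3 : c ^+ 3 = c * (1 - s ^+ 2) by rewrite -cs; ring.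
  by field: cs.
move=> x hx; have xp : 0 < x < pi by lra.
by rewrite divr_gt0 ?mulr_gt0 ?exprn_gt0 ?A_gt0 ?B_gt0.
Qed.

(** From pi on, sin and cos are nonpositive and their coefficients are positive. Below pi the
    argument is that of [oddD_gt0]: the decreasing ratio [evenD / A] tends to 0 at 0. *)
Lemma evenD_lt0 t : 0 < t <= 3 / 2 * pi -> evenD t < 0.
Proof.
move=> tp; have := @pi_ge2 R => pi2.
have [t1|t1] := leP pi t.
  have [c0 s0] : cos t <= 0 /\ sin t <= 0 by apply: cos_sin_le0; lra.
  have cs := cs1 t.
  have -> : evenD t = sin t * (t * (2 * t ^+ 2 - 6 + sin t ^+ 2))
    + cos t * (3 * t ^+ 2 + 3 * sin t ^+ 2) by rewrite /evenD; ring.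
  have p1 : 0 < t * (2 * t ^+ 2 - 6 + sin t ^+ 2) by nra.
  have p2 : 0 < 3 * t ^+ 2 + 3 * sin t ^+ 2 by nra.
  have [s00|s00] := eqVneq (sin t) 0.
    move: p2 cs; rewrite s00 mul0r add0r => p2 cs.
    have c1 : cos t < 0 by nra.
    by rewrite nmulr_rlt0.
  have s1 : sin t < 0 by rewrite lt_neqAle s00.
  have : sin t * (t * (2 * t ^+ 2 - 6 + sin t ^+ 2)) < 0 by rewrite nmulr_rlt0.
  have : cos t * (3 * t ^+ 2 + 3 * sin t ^+ 2) <= 0 by rewrite mulr_le0_ge0 // ltW.
  lra.
rewrite ltNge; apply/negP => E0.
have At : 0 < A t by apply: A_gt0; lra.
have h : 0 < evenD (t / 2) / A (t / 2).
  apply: (@le_lt_trans _ _ (evenD t / A t)); first by rewrite divr_ge0 // ltW.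
  by apply: E_ratio_lt; lra.
set k := evenD (t / 2) / A (t / 2) in h *.
(* 10 = 4 + 3 + 3: each of the three positive terms in the derivative of [evenD] is at most such a
   multiple of x^2 sin x ([i1], the middle term itself, [i2]), to be absorbed by the derivative k x
   sin x of k A. *)
have [e [e0 e1 e2 e3]] : exists e : R, [/\ 0 < e, e <= 1, e < t / 2 & 10 * e <= k].
  exists (Num.min 1 (Num.min (t / 4) (k / 10))).
  rewrite !lt_min !ge_min !gt_min; split; rewrite ?lexx //; try lra.
  rewrite -ler_pdivlMl //.
  by rewrite !ge_min; apply/orP; right; apply/orP; right; lra.
have : k < evenD e / A e by apply: E_ratio_lt; lra.
rewrite ltr_pdivlMr; last by apply: A_gt0; lra.
apply/negP; rewrite -leNgt -subr_ge0.
have D x : 0 <= x <= e -> is_derive x 1 (fun t => k * A t - evenD t)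
  (k * (x * sin x) - (2 * x ^+ 3 * cos x + 3 * x ^+ 2 * sin x
  + 3 * x * sin x ^+ 2 * cos x - 8 * sin x ^+ 3)).
  by move=> _; have dEx := dE x; have dAx := dA x; der; rewrite /=; ring.
have := @der_ge0_le R _ _ 0 e (ltW e0) D.
rewrite /A /evenD sin0 !(mul0r, mulr0, expr0n, subrr, addr0, subr0, oppr0) /=; apply.
move=> x hx.
have s1 : sin x <= x by apply: sin_le_id; lra.
have s2 : x / 2 <= sin x by apply: sin_ge_half; lra.
have s0 : 0 <= sin x by lra.
have c1 := cos_le1 x.
have x0 : 0 < x by lra.
have i1 : 2 * x ^+ 3 * cos x <= 4 * x ^+ 2 * sin x.
  apply: (@le_trans _ _ (2 * x ^+ 3)).
    by rewrite ler_piMr // mulr_ge0 // exprn_ge0 // ltW.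
  have -> : 2 * x ^+ 3 = 4 * x ^+ 2 * (x / 2) by field.
  by rewrite ler_wpM2l // mulr_ge0 // sqr_ge0.
have i2 : 3 * x * sin x ^+ 2 * cos x <= 3 * x ^+ 2 * sin x.
  apply: (@le_trans _ _ (3 * x * sin x ^+ 2)).
    by rewrite ler_piMr // !mulr_ge0 // ?sqr_ge0 // ltW.
  have -> : 3 * x ^+ 2 * sin x = 3 * x * sin x * x by ring.
  by rewrite expr2 !mulrA ler_wpM2l // !mulr_ge0 // ltW.
have i3 : 0 <= 8 * sin x ^+ 3 by rewrite mulr_ge0 // exprn_ge0.
have i4 : 10 * x ^+ 2 * sin x <= k * (x * sin x).
  have -> : 10 * x ^+ 2 * sin x = 10 * x * (x * sin x) by ring.
  by rewrite ler_wpM2r // ?mulr_ge0 // ?ltW //; lra.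
lra.
Qed.
End Roots.

(** * The first root of [fV0] *)

Section P1.
Variable R : realType.
Implicit Types (t x p : R).

Lemma fV0_oddD p : fV0 p = - oddD (2 * p) / 128.
Proof.
have -> : fV0 p = ((8 * (2 * p) ^+ 2 - 1) * cos (2 * p)
   - 4 * (2 * p) * sin (2 * p) + cos (2 * p + (2 * p) *+ 2)) / 512.
  by rewrite /fV0; congr ((_ + cos _) / _); ring.
move: (2 * p) => t; rewrite cosD cos_mulr2n sin_mulr2n /oddD.
by have e := cs1 t; field: e.
Qed.

(** On (pi, 2 pi) sin is negative, so the increasing ratio lets [oddD] change sign only once, from
    positive to negative. *)
Lemma oddD_ratio_cross t1 t2 : pi < t1 -> t1 < t2 -> t2 < 2 * pi ->
  oddD t1 <= 0 -> oddD t2 < 0.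
Proof.
move=> h1 h12 h2 W1.
have s1 : sin t1 < 0 by apply: sin_lt0_pi; lra.
have s2 : sin t2 < 0 by apply: sin_lt0_pi; lra.
have := @oddD_ratio_lt R t1 t2 h12 (or_intror (conj h1 h2)).
move=> h; have : 0 < oddD t2 / sin t2.
  by apply: le_lt_trans h; rewrite nmulr_lge0 // invr_lt0.
by rewrite nmulr_lgt0 // invr_lt0.
Qed.

Lemma oddD_root : exists2 t : R, pi < t < 3 / 2 * pi & oddD t = 0.
Proof.
have p2 : 2 <= pi :> R := @pi_ge2 R.
have e1 : @oddD R pi = 2 * pi ^+ 2 by rewrite /oddD sinpi cospi; ring.
have e2 : @oddD R (3 / 2 * pi) = - (3 / 2 * pi).
  have -> : 3 / 2 * pi = pi / 2 + pi :> R by field.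
  by rewrite /oddD sinDpi cosDpi sin_pihalf cos_pihalf; field.
have le : pi <= 3 / 2 * pi :> R by lra.
have ct : {within `[pi, 3 / 2 * pi], continuous (@oddD R)}.
  apply: continuous_subspaceT => x.
  have [b D] : exists b, is_derive x 1 (@oddD R) b.
    by rewrite /oddD; eexists; repeat der_step.
  exact: der_cont D.
have [|t] := IVT le ct (v := 0).
  rewrite e1 e2 ge_min le_max; apply/andP; split; apply/orP; [right|left]; nra.
rewrite in_itv /= => /andP[h1 h2] t0; exists t => //.
rewrite !lt_neqAle h1 h2 !andbT; apply/andP; split; apply/eqP => e.
  by move: t0; rewrite -e e1; nra.
by move: t0; rewrite e e2; nra.
Qed.

(** The infimum defining [p1V0] is attained at half the root t0 of [oddD_root]. No root is smaller:
    [oddD] is positive on (0, pi), equals 2 pi^2 at pi, and a zero in (pi, t0) would make it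
    negative at t0. *)
Lemma p1V0_spec : [/\ pi < 2 * p1V0 R < 3 / 2 * pi, oddD (2 * p1V0 R) = 0,
  forall t, 0 < t < 2 * p1V0 R -> oddD t != 0 &
  forall t, 2 * p1V0 R < t < 2 * pi -> oddD t < 0].
Proof.
have [t0 t0p t00] := oddD_root.
have p2 : 2 <= pi :> R := @pi_ge2 R.
have nz t : 0 < t < t0 -> oddD t != 0.
  move=> tt; have [h|h|->] := ltgtP t pi.
  - by rewrite gt_eqF // oddD_gt0 //; lra.
  - apply/eqP => e; have : oddD t0 < 0.
      by apply: (@oddD_ratio_cross t t0 h); rewrite ?e; lra.
    by rewrite t00 ltxx.
  - by rewrite /oddD sinpi cospi; apply/eqP; nra.
have t02 : 2 * (t0 / 2) = t0 by field.
suff -> : p1V0 R = t0 / 2.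
  rewrite t02; split => // t tt.
  by apply: (@oddD_ratio_cross t0 t); rewrite ?t00; lra.
set B := [set p : R | 0 < p /\ fV0 p = 0].
have B0 : B (t0 / 2).
  split; first by lra.
  by rewrite fV0_oddD t02 t00 oppr0 mul0r.
have lbB : lbound B (t0 / 2).
  move=> p [p0 fp]; rewrite leNgt; apply/negP => h.
  have := nz (2 * p); have : oddD (2 * p) = 0.
    by move: fp; rewrite fV0_oddD; lra.
  by move=> ->; rewrite eqxx => H; have : false by apply: H; lra.
apply/eqP; rewrite eq_le; apply/andP; split.
  by apply: ge_inf => //; exists (t0 / 2).
by apply: lb_le_inf => //; exists (t0 / 2).
Qed.
End P1.

(** * Jacobi fields and a strict Riccati inequality *)

Section MatrixDerivative.
Variable R : realType.
Implicit Types (s : R).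

Lemma der_sum (n : nat) (h : 'I_n -> R -> R) (dh : 'I_n -> R) s :
  (forall i, is_derive s 1 (h i) (dh i)) ->
  is_derive s 1 (fun y => \sum_(i < n) h i y) (\sum_(i < n) dh i).
Proof. by move=> D; have := is_derive_sum D; rewrite fct_sumE. Qed.

Definition mder m n (M : R -> 'M[R]_(m, n)) s (M' : 'M[R]_(m, n)) :=
  forall i j, is_derive s 1 (fun t => M t i j) (M' i j).

Definition mdiff m n (M : R -> 'M[R]_(m, n)) s := exists M', mder M s M'.

Lemma mder_mul m n p (A : R -> 'M[R]_(m, n)) (B : R -> 'M[R]_(n, p)) s A' B' :
  mder A s A' -> mder B s B' ->
  mder (fun t => A t *m B t) s (A' *m B s + A s *m B').
Proof.
move=> dA dB i j.
have -> : (fun t => (A t *m B t) i j) = (fun t => \sum_k A t i k * B t k j).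
  by apply/funext => t; rewrite mxE.
have -> : (A' *m B s + A s *m B') i j =
    \sum_k (A' i k * B s k j + A s i k * B' k j).
  by rewrite !mxE big_split.
by apply: der_sum => k; apply: derM.
Qed.

Lemma mder_add m n (A B : R -> 'M[R]_(m, n)) s A' B' :
  mder A s A' -> mder B s B' -> mder (fun t => A t + B t) s (A' + B').
Proof.
move=> dA dB i j; rewrite mxE.
have -> : (fun t => (A t + B t) i j) = (fun t => A t i j + B t i j).
  by apply/funext => t; rewrite mxE.
exact: derD.
Qed.

Lemma mder_scale m n (f : R -> R) (A : R -> 'M[R]_(m, n)) s f' A' :
  is_derive s 1 f f' -> mder A s A' ->
  mder (fun t => f t *: A t) s (f' *: A s + f s *: A').
Proof.
move=> df dA i j; rewrite !mxE.
have -> : (fun t => (f t *: A t) i j) = (fun t => f t * A t i j).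
  by apply/funext => t; rewrite mxE.
exact: derM.
Qed.

Lemma mder_tr m n (A : R -> 'M[R]_(m, n)) s A' :
  mder A s A' -> mder (fun t => (A t)^T) s A'^T.
Proof.
move=> dA i j; rewrite mxE.
have -> : (fun t => (A t)^T i j) = (fun t => A t j i).
  by apply/funext => t; rewrite mxE.
exact: dA.
Qed.

Lemma mder_eq m n (M : R -> 'M[R]_(m, n)) s A B : mder M s A -> A = B -> mder M s B.
Proof. by move=> ? <-. Qed.
Lemma mder_cst m n (A : 'M[R]_(m, n)) s : mder (fun=> A) s 0.
Proof. by move=> i j; rewrite mxE; apply: der_cst. Qed.

Lemma mder_inj m n (A : R -> 'M[R]_(m, n)) s A' A'' :
  mder A s A' -> mder A s A'' -> A' = A''.
Proof.
move=> d1 d2; apply/matrixP => i j.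
by have := d1 i j; have := d2 i j; case=> _ <- [_ <-].
Qed.

Lemma derivable_bigsum (I : Type) (r : seq I) (P : pred I) (h : I -> R -> R) s :
  (forall i, derivable (h i) s 1) ->
  derivable (fun t => \sum_(i <- r | P i) h i t) s 1.
Proof.
move=> dh; elim: r => [|i r IH].
  have -> : (fun t => \sum_(i <- [::] | P i) h i t) = (fun=> 0).
    by apply/funext => t; rewrite big_nil.
  exact: derivable_cst.
have [Pi|Pi] := boolP (P i).
  have -> : (fun t => \sum_(i <- i :: r | P i) h i t) =
      h i + (fun t => \sum_(i <- r | P i) h i t).
    by apply/funext => t; rewrite big_cons Pi.
  exact: derivableD.
have -> // : (fun t => \sum_(i <- i :: r | P i) h i t) =
      (fun t => \sum_(i <- r | P i) h i t).
by apply/funext => t; rewrite big_cons (negPf Pi).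
Qed.

Lemma derivable_bigprod (I : Type) (r : seq I) (P : pred I) (h : I -> R -> R) s :
  (forall i, derivable (h i) s 1) ->
  derivable (fun t => \prod_(i <- r | P i) h i t) s 1.
Proof.
move=> dh; elim: r => [|i r IH].
  have -> : (fun t => \prod_(i <- [::] | P i) h i t) = (fun=> 1).
    by apply/funext => t; rewrite big_nil.
  exact: derivable_cst.
have [Pi|Pi] := boolP (P i).
  have -> : (fun t => \prod_(i <- i :: r | P i) h i t) =
      h i * (fun t => \prod_(i <- r | P i) h i t).
    by apply/funext => t; rewrite big_cons Pi.
  exact: derivableM.
have -> // : (fun t => \prod_(i <- i :: r | P i) h i t) =
      (fun t => \prod_(i <- r | P i) h i t).
by apply/funext => t; rewrite big_cons (negPf Pi).
Qed.

Lemma derivable_det n (A : R -> 'M[R]_n) s :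
  (forall i j, derivable (fun t => A t i j) s 1) ->
  derivable (fun t => \det (A t)) s 1.
Proof.
move=> dA; apply: derivable_bigsum => p.
apply: derivableM; first exact: derivable_cst.
by apply: derivable_bigprod.
Qed.

(** With the adjugate formula the entries are polynomials divided by the determinant, hence
    derivable, whereas [invmx] is defined by cases. The derivative [J] of the adjugate is not
    computed by cofactors but solved from A adj A = det A. *)
Lemma mder_inv n (A : R -> 'M[R]_n) s A' : \det (A s) != 0 -> mder A s A' ->
  mder (fun t => (\det (A t))^-1 *: \adj (A t)) s
       (- (invmx (A s) *m A' *m invmx (A s))).
Proof.
move=> d0 dA.
have dd : is_derive s 1 (fun t => \det (A t)) ('D_1 (fun t => \det (A t)) s).
  by apply: derivableP; apply: derivable_det => i j; case: (dA i j).
set d' := 'D_1 _ s in dd.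
have [J dJ] : mdiff (fun t => \adj (A t)) s.
  exists (\matrix_(i, j) 'D_1 (fun t => \adj (A t) i j) s) => i j.
  rewrite mxE; apply: derivableP.
  have -> : (fun t => \adj (A t) i j) =
      (fun=> (-1) ^+ (j + i)) * (fun t => \det (row' j (col' i (A t)))).
    by apply/funext => t; rewrite mxE.
  apply: derivableM; first exact: derivable_cst.
  apply: derivable_det => k l.
  have -> : (fun t => row' j (col' i (A t)) k l) =
     (fun t => A t (lift j k) (lift i l)) by apply/funext => t; rewrite !mxE.
  by case: (dA (lift j k) (lift i l)).
have E : A' *m \adj (A s) + A s *m J = d' *: 1%:M.
  apply: (@mder_inj _ _ (fun t => A t *m \adj (A t)) s); first exact: mder_mul.
  have -> : (fun t => A t *m \adj (A t)) = (fun t => \det (A t) *: 1%:M).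
    by apply/funext => t; rewrite mul_mx_adj scalemx1.
  have := mder_scale dd (mder_cst (1%:M : 'M[R]_n) s).
  by rewrite scaler0 addr0.
have uA : A s \in unitmx by rewrite unitmxE unitfE.
have := mder_scale (derV d0 dd) dJ.
move=> h; apply: (mder_eq h).
have JE : J = invmx (A s) *m (d' *: 1%:M - A' *m \adj (A s)).
  by rewrite -E addrAC subrr add0r mulKmx.
have iE : \adj (A s) = \det (A s) *: invmx (A s).
  by rewrite /invmx uA scalerA mulfV // scale1r.
rewrite JE mulmxBr iE.
have -> : invmx (A s) *m (d' *: 1%:M) = d' *: invmx (A s).
  by rewrite -scalemxAr mulmx1.
have -> : invmx (A s) *m (A' *m (\det (A s) *: invmx (A s))) =
   \det (A s) *: (invmx (A s) *m A' *m invmx (A s)).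
  by rewrite -!scalemxAr mulmxA.
set Z := invmx (A s) *m A' *m invmx (A s).
rewrite scalerA scalerBr scalerA scalerA mulVf // scale1r.
rewrite addrA -[RHS]add0r; congr (_ + _).
rewrite -scalerDl -[RHS](scale0r (invmx (A s))); congr (_ *: _).
by field.
Qed.

End MatrixDerivative.

(** * Jacobi fields and their determinant *)

Section Jacobi.
Variable R : realType.
Implicit Types (s t : R).

Definition mx4 (f : nat -> nat -> R) : 'M[R]_4 := \matrix_(i, j) f i j.

Lemma ord4P (P : 'I_4 -> Prop) :
  P (@Ordinal 4 0 isT) -> P (@Ordinal 4 1 isT) ->
  P (@Ordinal 4 2 isT) -> P (@Ordinal 4 3 isT) -> forall i, P i.
Proof.
move=> p0 p1 p2 p3 [[|[|[|[|//]]]] hi]; rewrite (bool_irrelevance hi isT) //.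
Qed.

Lemma sum4 (V : nmodType) (F : 'I_4 -> V) : \sum_i F i =
  F (@Ordinal 4 0 isT) + F (@Ordinal 4 1 isT) +
  F (@Ordinal 4 2 isT) + F (@Ordinal 4 3 isT).
Proof.
rewrite !big_ord_recl big_ord0 addr0 !addrA.
by do !congr (_ + _); congr F; apply: val_inj.
Qed.

(* [jacX] and [jacP] are the states (eta, -2 int eta, - int eta sin,
   int eta cos) and the costates of the Jacobi fields
   eta = sin, 1 - cos, s sin, s cos, which vanish at s = 0. *)
Definition jacX s : 'M[R]_4 := mx4 (fun i j =>
  nth 0 (nth [::]
  [:: [:: sin s; 1 - cos s; s * sin s; s * cos s];
      [:: -2 * (1 - cos s); -2 * (s - sin s); -2 * (sin s - s * cos s);
          -2 * (s * sin s + cos s - 1)];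
      [:: - ((s - sin s * cos s) / 2); - (1 - cos s) + sin s ^+ 2 / 2;
          - (s ^+ 2 / 4 - s * sin s * cos s / 2 + sin s ^+ 2 / 4);
          - (s * sin s ^+ 2 / 2 - (s - sin s * cos s) / 4)];
      [:: sin s ^+ 2 / 2; sin s - (s + sin s * cos s) / 2;
          s * sin s ^+ 2 / 2 - (s - sin s * cos s) / 4;
          s ^+ 2 / 4 + s * sin s * cos s / 2 - sin s ^+ 2 / 4]] i) j).

Definition jacP s : 'M[R]_4 := mx4 (fun i j =>
  nth 0 (nth [::]
  [:: [:: cos s; sin s; sin s + s * cos s; cos s - s * sin s];
      [:: 0; 1 / 2; 0; 0]; [:: 0; 0; 0; -2]; [:: 0; 0; -2; 0]] i) j).

(** The system Y' = ham0 P + hamB Y, P' = - ham0 Y - hamB^T P is the Hamiltonian form of the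
    integrand (a'^2 - a^2) / 2 under the linearized constraints b' = -2 a, W1' = - a sin s, W2' = a
    cos s. *)
Definition ham0 : 'M[R]_4 :=
  mx4 (fun i j => if (i == 0)%N && (j == 0)%N then 1 else 0).
Definition hamB s : 'M[R]_4 := mx4 (fun i j =>
  if (j == 0)%N then nth 0 [:: 0; -2; - sin s; cos s] i else 0).

Lemma mder4 (f f' : R -> nat -> nat -> R) s :
  (forall i, (i < 4)%N -> forall j, (j < 4)%N -> is_derive s 1 (fun t => f t i j) (f' s i j)) ->
  mder (fun t => mx4 (f t)) s (mx4 (f' s)).
Proof.
move=> D i j; rewrite mxE.
have -> : (fun t => mx4 (f t) i j) = (fun t => f t i j).
  by apply/funext => t; rewrite mxE.
exact: D.
Qed.
Lemma nat4P (P : nat -> Prop) : P 0%N -> P 1%N -> P 2%N -> P 3%N -> forall i, (i < 4)%N -> P i.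
Proof. by move=> ? ? ? ? [|[|[|[|//]]]]. Qed.

Lemma jacX_der s : mder jacX s (ham0 *m jacP s + hamB s *m jacX s).
Proof.
have e := @cs1 R s.
have D : mder jacX s (mx4 (fun i j =>
  nth 0 (nth [::]
  [:: [:: cos s; sin s; sin s + s * cos s; cos s - s * sin s];
      [:: -2 * sin s; -2 * (1 - cos s); -2 * (s * sin s); -2 * (s * cos s)];
      [:: - sin s * sin s; - sin s * (1 - cos s); - sin s * (s * sin s);
          - sin s * (s * cos s)];
      [:: cos s * sin s; cos s * (1 - cos s); cos s * (s * sin s);
          cos s * (s * cos s)]] i) j)).
{ apply: (@mder4 (fun s i j => _) (fun s i j => _)).
  (apply: nat4P; apply: nat4P) => /=.
  all: der.
  all: rewrite /=.
  all: by field: e. }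
apply: (mder_eq D).
apply/matrixP; apply: ord4P; apply: ord4P.
all: rewrite !mxE !sum4 !mxE /=.
all: by ring.
Qed.
(** The fields vanish at s = 0, so they span a Lagrangian plane; this is what makes P X^{-1}
    symmetric. *)
Lemma jac_sym s : (jacX s)^T *m jacP s = (jacP s)^T *m jacX s.
Proof.
have e := @cs1 R s.
apply/matrixP.
(apply: ord4P; apply: ord4P).
all: rewrite !mxE !sum4 !mxE /=.
all: move: (sin s) (cos s) e => S C e.
by field: e.
by field: e.
by field: e.
all: by field: e.
Qed.

Lemma jacP_der s : mder jacP s (- (ham0 *m jacX s) - (hamB s)^T *m jacP s).
Proof.
have D : mder jacP s (mx4 (fun i j =>
  nth 0 (nth [::]
  [:: [:: - sin s; cos s; 2 * cos s - s * sin s; -2 * sin s - s * cos s];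
      [:: 0; 0; 0; 0]; [:: 0; 0; 0; 0]; [:: 0; 0; 0; 0]] i) j)).
{ apply: (@mder4 (fun s i j => _) (fun s i j => _)).
  (apply: nat4P; apply: nat4P) => /=.
  all: der.
  all: rewrite /=.
  all: by ring. }
apply: (mder_eq D).
apply/matrixP; apply: ord4P; apply: ord4P.
all: rewrite !mxE !sum4 !mxE /=.
all: by field.
Qed.

(** Laplace expansion by the 2 x 2 minors of the first two rows and the complementary minors of the
    last two. *)
Lemma det4 (f : nat -> nat -> R) : \det (mx4 f) =
  let m2 a b i j := f a i * f b j - f a j * f b i in
  m2 0 1 0 1 * m2 2 3 2 3 - m2 0 1 0 2 * m2 2 3 1 3 + m2 0 1 0 3 * m2 2 3 1 2
  + m2 0 1 1 2 * m2 2 3 0 3 - m2 0 1 1 3 * m2 2 3 0 2 + m2 0 1 2 3 * m2 2 3 0 1.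
Proof.
rewrite !(expand_det_row _ ord0) !big_ord_recl !big_ord0 /cofactor.
rewrite !(expand_det_row _ ord0) !big_ord_recl !big_ord0 /cofactor.
rewrite !(expand_det_row _ ord0) !big_ord_recl !big_ord0 /cofactor !det_mx11.
rewrite !mxE /= /bump /=.
ring.
Qed.

(** An interval of length 2 t is symmetric about its midpoint, so the Jacobi fields split into odd
    and even ones and each class contributes a factor. *)
Lemma jacX_det t : \det (jacX (2 * t)) = 2 * oddD t * evenD t.
Proof.
have e := @cs1 R t.
rewrite det4 /=.
have -> : cos (2 * t) = 1 - 2 * sin t ^+ 2.
  have -> : 2 * t = t *+ 2 by ring.
  rewrite cos_mulr2n; ring: e.
have -> : sin (2 * t) = 2 * sin t * cos t.
  have -> : 2 * t = t *+ 2 by ring.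
  rewrite sin_mulr2n; ring.
rewrite /oddD /evenD.
move: (sin t) (cos t) e => S C e.
by field: e.
Qed.
End Jacobi.

(** * The strict Riccati inequality *)

Section Riccati.
Variable R : realType.
Implicit Types (s t : R).

Lemma der_bounded (f : R -> R) (lo hi : R) : lo <= hi ->
  (forall s, lo <= s <= hi -> exists l, is_derive s 1 f l) ->
  exists B, forall s, lo <= s <= hi -> `|f s| <= B.
Proof.
move=> lohi D.
have ct : {within `[lo, hi], continuous (fun s => `|f s|)}.
  apply: continuous_in_subspaceT => y; rewrite inE /= in_itv /= => hy.
  have [l dl] := D _ hy.
  apply: (@continuous_comp _ _ _ f Num.norm); first exact: der_cont dl.
  exact: norm_continuous.
have [c _ cmax] := EVT_max lohi ct.
by exists `|f c| => s hs; apply: cmax; rewrite in_itv.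
Qed.

Lemma mdiff_bounded m n (M : R -> 'M[R]_(m, n)) (lo hi : R) : lo <= hi ->
  (forall s, lo <= s <= hi -> mdiff M s) ->
  exists B, 1 <= B /\ forall s, lo <= s <= hi -> forall i j, `|M s i j| <= B.
Proof.
move=> lohi D.
have h (p : 'I_m * 'I_n) : exists B, forall s, lo <= s <= hi -> `|M s p.1 p.2| <= B.
  by apply: der_bounded => // s /D[M' dM]; exists (M' p.1 p.2); apply: dM.
have /choice[B hB] := h.
exists (1 + \sum_p `|B p|); split; first by rewrite lerDl sumr_ge0.
move=> s hs i j; apply: (le_trans (hB (i, j) s hs)).
apply: (le_trans (ler_norm _)).
by rewrite (bigD1 (i, j)) //= addrCA lerDl addr_ge0 // sumr_ge0.
Qed.

Lemma mdiff_mul m n p (A : R -> 'M[R]_(m, n)) (B : R -> 'M[R]_(n, p)) s :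
  mdiff A s -> mdiff B s -> mdiff (fun t => A t *m B t) s.
Proof. by move=> [A' dA] [B' dB]; eexists; apply: mder_mul dA dB. Qed.
Lemma mdiff_add m n (A B : R -> 'M[R]_(m, n)) s :
  mdiff A s -> mdiff B s -> mdiff (fun t => A t + B t) s.
Proof. by move=> [A' dA] [B' dB]; eexists; apply: mder_add dA dB. Qed.
Lemma mdiff_scale m n (f : R -> R) (A : R -> 'M[R]_(m, n)) s f' :
  is_derive s 1 f f' -> mdiff A s -> mdiff (fun t => f t *: A t) s.
Proof. by move=> df [A' dA]; eexists; apply: mder_scale df dA. Qed.
Lemma mdiff_tr m n (A : R -> 'M[R]_(m, n)) s :
  mdiff A s -> mdiff (fun t => (A t)^T) s.
Proof. by move=> [A' dA]; eexists; apply: mder_tr dA. Qed.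
Lemma mdiff_cst m n (A : 'M[R]_(m, n)) s : mdiff (fun=> A) s.
Proof. by exists 0; apply: mder_cst. Qed.

Definition sumsq (v : 'cV[R]_4) := \sum_i v i 0 ^+ 2.

Lemma sumsq_row (A : 'M[R]_4) (v : 'cV[R]_4) (B : R) i :
  (forall j, `|A i j| <= B) -> (A *m v) i 0 ^+ 2 <= 4 * B ^+ 2 * sumsq v.
Proof.
move=> hA; rewrite mxE /sumsq !sum4.
have q j : (A i j * v j 0) ^+ 2 <= B ^+ 2 * v j 0 ^+ 2.
  rewrite exprMn ler_wpM2r ?sqr_ge0 // -[A i j ^+ 2]real_normK ?num_real //.
  by rewrite lerXn2r ?nnegrE // ?hA // (le_trans _ (hA j)).
have := q (@Ordinal 4 0 isT); have := q (@Ordinal 4 1 isT).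
have := q (@Ordinal 4 2 isT); have := q (@Ordinal 4 3 isT).
move: (A i _ * _) (A i _ * _) (A i _ * _) (A i _ * _) => a b c d.
move: (B ^+ 2) => B2 h1 h2 h3 h4.
have := sqr_ge0 (a - b); have := sqr_ge0 (a - c); have := sqr_ge0 (a - d).
have := sqr_ge0 (b - c); have := sqr_ge0 (b - d); have := sqr_ge0 (c - d).
lra.
Qed.

(** The Riccati operator of the Hamiltonian system above; it vanishes on P X^{-1}, with K' standing
    for the derivative of K. *)
Definition riccati (K K' : 'M[R]_4) s : 'M[R]_4 :=
  K' + K *m ham0 R *m K + ham0 R + (hamB s)^T *m K + K *m hamB s.

Lemma riccati_strict (lo hi : R) : 0 < lo -> lo <= hi -> hi < 4 * p1V0 R ->
  exists (K K' : R -> 'M[R]_4) (B l : R), [/\ 0 < B, 0 < l &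
   forall s, lo <= s <= hi ->
   [/\ mder K s (K' s), (K s)^T = K s, forall i j, `|K s i j| <= B,
       forall i j, `|K' s i j| <= B &
       forall Y : 'cV[R]_4,
         (Y^T *m riccati (K s) (K' s) s *m Y) 0 0 <= - l * sumsq Y]].
Proof.
move=> lo0 lohi hip.
pose X := @jacX R; pose P := @jacP R.
pose Xi s := (\det (X s))^-1 *: \adj (X s).
have d0 s : lo <= s <= hi -> \det (X s) != 0.
  move=> hs; have -> : s = 2 * (s / 2) by field.
  have [h1 h2 h3 _] := p1V0_spec R.
  rewrite /X jacX_det !mulf_neq0 ?pnatr_eq0 ?h3 //; first by lra.
  by rewrite lt_eqF // evenD_lt0; lra.
have XiE s : lo <= s <= hi -> Xi s = invmx (X s).
  by move=> hs; rewrite /Xi /invmx unitmxE unitfE d0.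
have uX s : lo <= s <= hi -> X s \in unitmx.
  by move=> hs; rewrite unitmxE unitfE d0.
pose E0 := ham0 R; pose Bm s : 'M[R]_4 := hamB s.
(* K0 solves the Riccati equation; subtracting e s X^{-T} X^{-1} makes the
   inequality strict up to the quadratic term L E0 L, small with e. *)
pose K0 s := P s *m Xi s.
have dXi s : lo <= s <= hi -> mder Xi s (- (Xi s *m (E0 *m K0 s + Bm s))).
  move=> hs; apply: (mder_eq (mder_inv (d0 s hs) (jacX_der s))).
  rewrite -/(X s) -/(P s) -XiE // /K0 -!mulmxA; congr (- (_ *m _)).
  rewrite mulmxDl -!mulmxA; congr (_ + _).
  by rewrite XiE // mulmxV ?uX // mulmx1.
have symK0 s : lo <= s <= hi -> (K0 s)^T = K0 s.
  move=> hs; have Xh := uX s hs.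
  have := @jac_sym R s; rewrite -/(X s) -/(P s) /K0 XiE // trmx_mul trmx_inv => e.
  have XT : (X s)^T \in unitmx by rewrite unitmx_tr.
  apply: (can_inj (mulKmx XT)).
  by rewrite mulmxA mulmxV // mul1mx mulmxA e -mulmxA mulmxV // mulmx1.
have dK0 s : lo <= s <= hi ->
   mder K0 s (- (E0 + (Bm s)^T *m K0 s + K0 s *m E0 *m K0 s + K0 s *m Bm s)).
  move=> hs; apply: (mder_eq (mder_mul (jacP_der s) (dXi s hs))).
  rewrite -/(X s) -/(P s) -/E0 -/(Bm s) mulmxN mulmxA -/(K0 s).
  have XX : X s *m Xi s = 1%:M by rewrite XiE // mulmxV ?uX.
  rewrite mulmxDr mulmxBl mulNmx -(mulmxA E0) XX mulmx1 -(mulmxA (Bm s)^T).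
  by rewrite -/(K0 s) !opprD !addrA (mulmxA (K0 s)).
have mXi s : lo <= s <= hi -> mdiff Xi s by move=> hs; eexists; apply: dXi.
have mK0 s : lo <= s <= hi -> mdiff K0 s by move=> hs; eexists; apply: dK0.
have mX s : lo <= s <= hi -> mdiff X s by move=> hs; eexists; apply: jacX_der.
have [BX [BX1 hBX]] := mdiff_bounded lohi mX.
have [Bi [Bi1 hBi]] := mdiff_bounded lohi mXi.
(* This makes (e s)^2 4 Bi^2 <= e / 2, so the quadratic term L E0 L costs at most half of the gain e
   |xi|^2, where xi = X^{-1} Y; see [q4]. *)
pose e := (8 * hi ^+ 2 * Bi ^+ 2)^-1.
have hi0 : 0 < hi by lra.
have e0 : 0 < e by rewrite invr_gt0 !mulr_gt0 ?exprn_gt0 //; lra.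
pose N s := (Xi s)^T *m Xi s.
pose L s := (- e * s) *: N s.
pose A s := E0 *m K0 s + Bm s.
(* [N] solves the Riccati equation linearized at [K0]. Multiplied by - e s it therefore leaves - e N
   at first order, and L E0 L is the only other term. *)
have dN s : lo <= s <= hi -> mder N s (- ((A s)^T *m N s + N s *m A s)).
  move=> hs; apply: (mder_eq (mder_mul (mder_tr (dXi s hs)) (dXi s hs))).
  rewrite -/(A s) /N raddfN /= trmx_mul mulNmx mulmxN opprD.
  by rewrite !mulmxA.
pose L' s := - e *: N s - ((A s)^T *m L s + L s *m A s).
have dL s : lo <= s <= hi -> mder L s (L' s).
  move=> hs.
  have de : is_derive s 1 (fun s => - e * s) (- e) by der; rewrite /=; ring.
  apply: (mder_eq (mder_scale de (dN s hs))).
  rewrite /L' /L -scalemxAr -scalemxAl -scalerDr; congr (_ + _).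
  by rewrite scalerN.
pose K0' s := - (E0 + (Bm s)^T *m K0 s + K0 s *m E0 *m K0 s + K0 s *m Bm s).
pose K s := K0 s + L s; pose K' s := K0' s + L' s.
have symN s : (N s)^T = N s by rewrite /N trmx_mul trmxK.
have symE : E0^T = E0.
  by apply/matrixP => i j; rewrite !mxE andbC.
have mBm s : mdiff Bm s.
  exists (mx4 (fun i j =>
    if (j == 0)%N then nth 0 [:: 0; 0; - cos s; - sin s] i else 0)).
  apply: (@mder4 R (fun s i j => if (j == 0)%N then nth 0 [:: 0; -2; - sin s; cos s] i else 0)
     (fun s i j => if (j == 0)%N then nth 0 [:: 0; 0; - cos s; - sin s] i else 0)).
  by apply: nat4P; apply: nat4P => /=; der; rewrite /=; ring.
have mN s : lo <= s <= hi -> mdiff N s by move=> hs; eexists; apply: dN.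
have mL s : lo <= s <= hi -> mdiff L s by move=> hs; eexists; apply: dL.
have mopp (M : R -> 'M[R]_4) s : mdiff M s -> mdiff (fun s => - M s) s.
  move=> h; have -> : (fun s => - M s) = (fun s => (-1 : R) *: M s).
    by apply/funext => t; rewrite scaleN1r.
  by apply: (mdiff_scale (der_cst _ _)).
have mA s : lo <= s <= hi -> mdiff A s.
  move=> hs; apply: mdiff_add; last exact: mBm.
  by apply: mdiff_mul; [apply: mdiff_cst|apply: mK0].
have mK s : lo <= s <= hi -> mdiff K s.
  by move=> hs; apply: mdiff_add; [apply: mK0|apply: mL].
have mK' s : lo <= s <= hi -> mdiff K' s.
  move=> hs; apply: mdiff_add.
    apply: mopp; apply: mdiff_add; [apply: mdiff_add; [apply: mdiff_add|]|].
    - exact: mdiff_cst.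
    - by apply: mdiff_mul; [apply: mdiff_tr; apply: mBm|apply: mK0].
    - apply: mdiff_mul; last exact: mK0.
      by apply: mdiff_mul; [apply: mK0|apply: mdiff_cst].
    - by apply: mdiff_mul; [apply: mK0|apply: mBm].
  apply: mdiff_add.
    by apply: (mdiff_scale (der_cst _ _)); apply: mN.
  apply: mopp; apply: mdiff_add.
    by apply: mdiff_mul; [apply: mdiff_tr; apply: mA|apply: mL].
  by apply: mdiff_mul; [apply: mL|apply: mA].
have [B1 [B11 hB1]] := mdiff_bounded lohi mK.
have [B2 [B21 hB2]] := mdiff_bounded lohi mK'.
(* The remaining gain e / 2 |xi|^2 is converted to Y by |Y|^2 <= 16 BX^2 |xi|^2, see [q3]. *)
pose l := e / 2 / (16 * BX ^+ 2).
have l0 : 0 < l by rewrite /l !divr_gt0 ?mulr_gt0 ?exprn_gt0 //; lra.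
exists K, K', (B1 + B2), l; split => //; first by lra.
move=> s hs; split.
- by apply: mder_add; [apply: dK0|apply: dL].
- rewrite /K linearD /= symK0 //; congr (_ + _).
  by rewrite /L linearZ /= symN.
- by move=> i j; have := hB1 s hs i j; lra.
- by move=> i j; have := hB2 s hs i j; lra.
move=> Y.
have -> : riccati (K s) (K' s) s = - e *: N s + L s *m E0 *m L s.
  rewrite /riccati /K /K' -/E0 -/(Bm s) /K0' /L'.
  have -> : (A s)^T = K0 s *m E0 + (Bm s)^T.
    by rewrite /A linearD /= trmx_mul symK0 // symE.
  rewrite /A !(mulmxDl, mulmxDr) !mulmxA.
  set a := K0 s *m E0 *m K0 s; set b := (Bm s)^T *m K0 s.
  set c := K0 s *m Bm s; set d := K0 s *m E0 *m L s.
  set f := (Bm s)^T *m L s; set g := L s *m E0 *m K0 s.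
  set h := L s *m Bm s; set i := L s *m E0 *m L s; set n := - e *: N s.
  apply/matrixP => u v; rewrite !mxE; ring.
set xi := Xi s *m Y.
have q1 : (Y^T *m N s *m Y) 0 0 = sumsq xi.
  rewrite /N mulmxA -mulmxA -/xi -trmx_mul -/xi mxE /sumsq.
  by apply: eq_bigr => i _; rewrite mxE expr2.
have symL : (L s)^T = L s by rewrite /L linearZ /= symN.
have q2 : (Y^T *m (L s *m E0 *m L s) *m Y) 0 0 =
    ((L s *m Y) (@Ordinal 4 0 isT) 0) ^+ 2.
  have -> : Y^T *m (L s *m E0 *m L s) *m Y = (L s *m Y)^T *m (E0 *m (L s *m Y)).
    by rewrite trmx_mul symL !mulmxA.
  move: (L s *m Y) => v.
  rewrite mxE sum4 !mxE !sum4 !mxE /=; ring.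
rewrite mulmxDr mulmxDl mxE q2 -scalemxAr -scalemxAl mxE q1.
have q3 : sumsq Y <= 16 * BX ^+ 2 * sumsq xi.
  have YE : Y = X s *m xi by rewrite /xi XiE // mulKVmx // uX.
  have q i : Y i 0 ^+ 2 <= 4 * BX ^+ 2 * sumsq xi.
    by rewrite [Y]YE; apply: sumsq_row => j; apply: hBX.
  rewrite {1}/sumsq sum4.
  have := q (@Ordinal 4 0 isT); have := q (@Ordinal 4 1 isT).
  have := q (@Ordinal 4 2 isT); have := q (@Ordinal 4 3 isT).
  lra.
have q4 : ((L s *m Y) (@Ordinal 4 0 isT) 0) ^+ 2 <= e / 2 * sumsq xi.
  have -> : (L s *m Y) (@Ordinal 4 0 isT) 0 =
      - e * s * ((Xi s)^T *m xi) (@Ordinal 4 0 isT) 0.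
    by rewrite /L -scalemxAl mxE /N -mulmxA.
  have := @sumsq_row (Xi s)^T xi Bi (@Ordinal 4 0 isT).
  have hh j : `|(Xi s)^T (@Ordinal 4 0 isT) j| <= Bi by rewrite mxE; apply: hBi.
  move=> /(_ hh) => h; rewrite exprMn.
  apply: (le_trans (ler_wpM2l (sqr_ge0 _) h)).
  rewrite mulrA ler_wpM2r //; first by rewrite sumr_ge0 // => *; rewrite sqr_ge0.
  have -> : (- e * s) ^+ 2 * (4 * Bi ^+ 2) = e * (e * (4 * s ^+ 2 * Bi ^+ 2)) by ring.
  apply: ler_wpM2l; first exact: ltW.
  have -> : 2^-1 = e * (4 * hi ^+ 2 * Bi ^+ 2) :> R.
    by rewrite /e; clear -hi0 Bi1; field; apply/andP; split; apply: lt0r_neq0; lra.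
  apply: ler_wpM2l; first exact: ltW.
  apply: ler_wpM2r; first exact: sqr_ge0.
  by clear -hs lo0; apply: ler_wpM2l => //; rewrite lerXn2r ?nnegrE; lra.
have n0 : 0 <= sumsq xi by rewrite sumr_ge0 // => *; rewrite sqr_ge0.
have q5 : l * sumsq Y <= e / 2 * sumsq xi.
  rewrite /l -mulrA ler_wpM2l //; first by lra.
  rewrite ler_pdivrMl //; rewrite mulr_gt0 ?exprn_gt0 //; lra.
lra.
Qed.
End Riccati.

(** * Calibration *)

(** Used whenever a tolerance x is divided among factors: 1 + y in the denominator avoids a separate
    case y = 0. *)
Lemma mul_div1p_le (R : realFieldType) (x y : R) : 0 <= x -> 0 <= y ->
  y * (x / (1 + y)) <= x.
Proof.
by move=> x0 y0; rewrite mulrA ler_pdivrMr ?ltr_wpDr // mulrC ler_wpM2l //; lra.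
Qed.

Section HorizontalDifferential.
Variables (R : realType) (T : R) (q1 q2 : R -> R).
Implicit Types (t s : R) (F G : R -> R).

(* [hd t F p1 p2] means dF = p1 dq1 + p2 dq2 at the time t.  For Lipschitz
   [q1], [q2] it satisfies the rules of the differential calculus, although
   none of the functions need be differentiable at t. *)
Definition hd t F (p1 p2 : R) := forall e, 0 < e -> exists2 d, 0 < d &
  forall s, 0 <= s <= T -> `|s - t| < d ->
  `|F s - F t - p1 * (q1 s - q1 t) - p2 * (q2 s - q2 t)| <= e * `|s - t|.

Definition lip t F := exists2 d, 0 < d & exists2 M, 0 <= M &
  forall s, 0 <= s <= T -> `|s - t| < d -> `|F s - F t| <= M * `|s - t|.

Lemma hd_q1 t : hd t q1 1 0.
Proof.
by move=> e e0; exists 1 => // s _ _; rewrite !mul0r subr0 mul1r subrr normr0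
  mulr_ge0 // ltW.
Qed.

Lemma hd_q2 t : hd t q2 0 1.
Proof.
by move=> e e0; exists 1 => // s _ _; rewrite mul0r subr0 mul1r subrr normr0
  mulr_ge0 // ltW.
Qed.

Lemma hd_cst t c : hd t (fun=> c) 0 0.
Proof.
by move=> e e0; exists 1 => // s _ _; rewrite !mul0r !subr0 subrr normr0
  mulr_ge0 // ltW.
Qed.

Lemma hd_add t F G p1 p2 r1 r2 : hd t F p1 p2 -> hd t G r1 r2 ->
  hd t (fun s => F s + G s) (p1 + r1) (p2 + r2).
Proof.
move=> hF hG e e0; have e20 : 0 < e / 2 by rewrite divr_gt0.
have [d1 d10 h1] := hF _ e20; have [d2 d20 h2] := hG _ e20.
exists (Num.min d1 d2); first by rewrite lt_min d10.
move=> s sT; rewrite lt_min => /andP[/(h1 _ sT) k1 /(h2 _ sT) k2].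
have -> : F s + G s - (F t + G t) - (p1 + r1) * (q1 s - q1 t) -
   (p2 + r2) * (q2 s - q2 t) =
  (F s - F t - p1 * (q1 s - q1 t) - p2 * (q2 s - q2 t)) +
  (G s - G t - r1 * (q1 s - q1 t) - r2 * (q2 s - q2 t)) by ring.
apply: (le_trans (ler_normD _ _)); lra.
Qed.

Lemma lip_hd t F p1 p2 : lip t q1 -> lip t q2 -> hd t F p1 p2 -> lip t F.
Proof.
move=> [d1 d10 [M1 M10 l1]] [d2 d20 [M2 M20 l2]] /(_ 1 ltr01)[d d0 h].
exists (Num.min d (Num.min d1 d2)); first by rewrite !lt_min d0 d10.
exists (1 + `|p1| * M1 + `|p2| * M2); first by rewrite !addr_ge0 ?mulr_ge0.
move=> s sT; rewrite !lt_min => /and3P[/(h _ sT) k /(l1 _ sT) k1 /(l2 _ sT) k2].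
have -> : F s - F t =
  (F s - F t - p1 * (q1 s - q1 t) - p2 * (q2 s - q2 t)) +
  p1 * (q1 s - q1 t) + p2 * (q2 s - q2 t) by ring.
rewrite !mulrDl; apply: (le_trans (ler_normD _ _)); apply: lerD.
  apply: (le_trans (ler_normD _ _)); apply: lerD => //.
  by rewrite normrM -mulrA ler_wpM2l.
by rewrite normrM -mulrA ler_wpM2l.
Qed.

Lemma hd_mul t F G p1 p2 r1 r2 : lip t F -> lip t G ->
  hd t F p1 p2 -> hd t G r1 r2 ->
  hd t (fun s => F s * G s) (p1 * G t + F t * r1) (p2 * G t + F t * r2).
Proof.
move=> [dF dF0 [MF MF0 lF]] [dG dG0 [MG MG0 lG]] hF hG e e0.
have eF : 0 < e / 3 / (1 + `|G t|) by rewrite !divr_gt0 // ltr_wpDr.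
have eG : 0 < e / 3 / (1 + `|F t|) by rewrite !divr_gt0 // ltr_wpDr.
have eM : 0 < e / 3 / (1 + MF * MG) by rewrite !divr_gt0 // ltr_wpDr // mulr_ge0.
have [d1 d10 h1] := hF _ eF; have [d2 d20 h2] := hG _ eG.
exists (Num.min (Num.min dF dG) (Num.min (Num.min d1 d2) (e / 3 / (1 + MF * MG)))).
  by rewrite !lt_min dF0 dG0 d10 d20.
move=> s sT; rewrite !lt_min => /and3P[/andP[/(lF _ sT) k1 /(lG _ sT) k2]].
move=> /andP[/(h1 _ sT) k3 /(h2 _ sT) k4] k5.
have -> : F s * G s - F t * G t - (p1 * G t + F t * r1) * (q1 s - q1 t)
    - (p2 * G t + F t * r2) * (q2 s - q2 t) =
  (F s - F t - p1 * (q1 s - q1 t) - p2 * (q2 s - q2 t)) * G t +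
  (G s - G t - r1 * (q1 s - q1 t) - r2 * (q2 s - q2 t)) * F t +
  (F s - F t) * (G s - G t) by ring.
set u := `|s - t| in k1 k2 k3 k4 k5 *.
have u0 : 0 <= u by rewrite normr_ge0.
have part (x y : R) : 0 <= y -> `|x| <= e / 3 / (1 + y) * u -> `|x| * y <= e / 3 * u.
  move=> y0 hx; apply: (le_trans (ler_wpM2r y0 hx)).
  rewrite mulrAC ler_wpM2r // mulrC.
  by apply: mul_div1p_le => //; rewrite divr_ge0 // ltW.
have -> : e * u = e / 3 * u + e / 3 * u + e / 3 * u by field.
apply: (le_trans (ler_normD _ _)); apply: lerD.
  apply: (le_trans (ler_normD _ _)); rewrite !normrM.
  by apply: lerD; apply: part.
rewrite normrM.
apply: (le_trans (ler_pM (normr_ge0 _) (normr_ge0 _) k1 k2)).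
have -> : MF * u * (MG * u) = MF * MG * u * u by ring.
apply: ler_wpM2r => //.
have MM : 0 <= MF * MG by rewrite mulr_ge0.
apply: (@le_trans _ _ (MF * MG * (e / 3 / (1 + MF * MG)))).
  by apply: ler_wpM2l => //; exact: ltW.
by apply: mul_div1p_le => //; rewrite divr_ge0 // ltW.
Qed.

(** In the form of Caratheodory, g y - g (F t) = k y (y - F t) with k continuous at F t, so nothing
    is divided by F s - F t, which may vanish. *)
Lemma hd_comp t F g p1 p2 l : lip t F -> hd t F p1 p2 ->
  is_derive (F t) 1 g l -> hd t (fun s => g (F s)) (l * p1) (l * p2).
Proof.
move=> [dF dF0 [M M0 lF]] hF /is_derive1_caratheodory[k [kE kc kl]] e e0.
have e1 : 0 < e / 2 / (1 + `|l|) by rewrite !divr_gt0 // ltr_wpDr.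
have [d1 d10 h1] := hF _ e1.
have e2 : 0 < e / 2 / (1 + M) by rewrite !divr_gt0 // ltr_wpDr.
have [d2 d20 h2] : exists2 d, 0 < d & forall y, `|y - F t| < d ->
    `|k y - k (F t)| <= e / 2 / (1 + M).
  move/cvgr_dist_le: kc => /(_ _ e2) /nbhs_ballP[d /= d0 hd].
  by exists d => // y yd; rewrite distrC; apply: hd; rewrite /ball /= distrC.
exists (Num.min (Num.min dF d1) (d2 / (1 + M))).
  by rewrite !lt_min dF0 d10 divr_gt0 // ltr_wpDr.
move=> s sT; rewrite !lt_min => /andP[/andP[/(lF _ sT) k1 /(h1 _ sT) k2]].
rewrite ltr_pdivlMr ?ltr_wpDr // => k3.
have -> : g (F s) - g (F t) - l * p1 * (q1 s - q1 t) - l * p2 * (q2 s - q2 t) =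
  l * (F s - F t - p1 * (q1 s - q1 t) - p2 * (q2 s - q2 t)) +
  (k (F s) - k (F t)) * (F s - F t) by rewrite kE -kl; ring.
set u := `|s - t| in k1 k2 k3 *.
have u0 : 0 <= u by rewrite normr_ge0.
have -> : e * u = e / 2 * u + e / 2 * u by field.
have part (x y : R) : 0 <= y -> 0 <= x -> x <= e / 2 / (1 + y) * u -> y * x <= e / 2 * u.
  move=> y0 x0 hx; apply: (le_trans (ler_wpM2l y0 hx)).
  rewrite mulrA ler_wpM2r //.
  by apply: mul_div1p_le => //; rewrite divr_ge0 // ltW.
apply: (le_trans (ler_normD _ _)); rewrite !normrM; apply: lerD.
  exact: part.
have /h2 k4 : `|F s - F t| < d2.
  by apply: (le_lt_trans k1); move: k3; rewrite mulrDr mulr1 mulrC; lra.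
apply: (le_trans (ler_pM (normr_ge0 _) (normr_ge0 _) k4 k1)).
rewrite mulrA ler_wpM2r // mulrC.
by apply: mul_div1p_le => //; rewrite divr_ge0 // ltW.
Qed.

Lemma hd_sum t n (F : 'I_n -> R -> R) (p1 p2 : 'I_n -> R) :
  (forall i, hd t (F i) (p1 i) (p2 i)) ->
  hd t (fun s => \sum_i F i s) (\sum_i p1 i) (\sum_i p2 i).
Proof.
elim: n F p1 p2 => [|n IH] F p1 p2 h.
  rewrite !big_ord0; have -> : (fun s => \sum_(i < 0) F i s) = (fun=> 0).
    by apply/funext => s; rewrite big_ord0.
  exact: hd_cst.
rewrite !big_ord_recl; have -> : (fun s => \sum_i F i s) =
    (fun s => F ord0 s + \sum_i F (lift ord0 i) s).
  by apply/funext => s; rewrite big_ord_recl.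
by apply: hd_add => //; apply: IH.
Qed.

Lemma hd_eq t F p1 p2 r1 r2 : hd t F p1 p2 -> p1 = r1 -> p2 = r2 -> hd t F r1 r2.
Proof. by move=> h <- <-. Qed.

End HorizontalDifferential.

(** The supremum m of the points t with f 0 <= f t is itself such a point by the left comparison at
    m, and the right comparison at m excludes m < T. Only comparisons with the centre of each
    neighbourhood are assumed, and no continuity. *)
Lemma locally_nondecreasing (R : realType) (T : R) (f : R -> R) : 0 <= T ->
  (forall t, 0 <= t <= T -> exists2 d, 0 < d & forall s, 0 <= s <= T ->
     `|s - t| < d -> (t <= s -> f t <= f s) /\ (s <= t -> f s <= f t)) ->
  f 0 <= f T.
Proof.
move=> T0 h.
pose A : set R := [set t | 0 <= t <= T /\ f 0 <= f t].
have A0 : A 0 by split; rewrite ?lexx.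
have ubA : ubound A T by move=> x [/andP[]].
have supA : has_sup A := conj (ex_intro _ 0 A0) (ex_intro _ T ubA).
have m0 : 0 <= sup A by apply: ub_le_sup => //; exists T.
have mT : sup A <= T by apply: ge_sup => //; exists 0.
have mm : 0 <= sup A <= T by rewrite m0.
have [d d0 hd] := h _ mm.
have Am : f 0 <= f (sup A).
  have [a Aa am] := sup_adherent d0 supA.
  have am' : a <= sup A by apply: ub_le_sup => //; exists T.
  have [aT fa] := Aa.
  have ad : `|a - sup A| < d by rewrite ler0_norm; lra.
  have [_ ha] := hd a aT ad.
  exact: (le_trans fa (ha am')).
have [mT'|mT'] := ltP (sup A) T; last first.
  by have -> : T = sup A by apply/eqP; rewrite eq_le mT' mT.
have [s [s1 s2 s3]] : exists s, [/\ sup A < s, s <= T & s < sup A + d].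
  exists (Num.min T (sup A + d / 2)).
  rewrite lt_min mT' ge_min lexx gt_min; split => //; first by lra.
  by apply/orP; right; lra.
have sT : 0 <= s <= T by lra.
have sd : `|s - sup A| < d by rewrite ger0_norm; lra.
have [hs _] := hd s sT sd.
have : A s by split => //; apply: (le_trans Am); apply: hs; exact: ltW.
by move=> /(ub_le_sup (ex_intro _ T ubA)); rewrite leNgt s1.
Qed.

(** Here l stands for arc length: its increments dominate every linear functional of norm at most 1
    on the increments of q. The first-order error in dS is absorbed by an additional e t, after
    which l - S + e t satisfies [locally_nondecreasing]. *)
Lemma hd_contraction (R : realType) (T : R) (q1 q2 l S : R -> R) : 0 <= T ->
  (forall s t p1 p2, 0 <= s -> s <= t -> t <= T -> p1 ^+ 2 + p2 ^+ 2 <= 1 ->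
     p1 * (q1 t - q1 s) + p2 * (q2 t - q2 s) <= l t - l s) ->
  (forall t, 0 <= t <= T -> exists p1 p2, hd T q1 q2 t S p1 p2 /\
      p1 ^+ 2 + p2 ^+ 2 <= 1) ->
  S T - S 0 <= l T - l 0.
Proof.
move=> T0 ql hS.
apply/ler_addgt0Pr => e0 e00.
pose e := e0 / (1 + T).
have e_gt0 : 0 < e by rewrite divr_gt0 // ltr_wpDr.
have : l 0 - S 0 + e * 0 <= l T - S T + e * T.
  apply: (@locally_nondecreasing R T (fun t => l t - S t + e * t)) => // t tT.
  have [p1 [p2 [h p12]]] := hS t tT.
  have [d d0 hd] := h _ e_gt0; exists d => // s sT sd.
  have := hd s sT sd; rewrite ler_norml => /andP[h1 h2].
  split=> ts.
    have := ql t s p1 p2; rewrite ger0_norm in h1 h2; last by lra.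
    move=> /(_ _ ts _ p12) H; have := H _ _; lra.
  have := ql s t p1 p2; rewrite ler0_norm in h1 h2; last by lra.
  move=> /(_ _ ts _ p12) H; have := H _ _; lra.
have : e * T <= e0.
  by rewrite /e mulrAC ler_pdivrMr; nra.
lra.
Qed.

(** * Explicit orders of smallness and the pointwise gradient bound *)

Section Order.
Variables (R : realType) (n : R).
Hypotheses (n0 : 0 <= n) (n1 : n <= 1).

(** The constant is an explicit argument, so that chains of [bigOD] and [bigOM] build it and
    unification can fill an existential chosen before the variables. *)
Definition bigO (k : nat) (C x : R) := 0 <= C /\ `|x| <= C * n ^+ k.

Lemma bigOD k C C' x y : bigO k C x -> bigO k C' y -> bigO k (C + C') (x + y).
Proof.
move=> [? hx] [? hy]; split; first exact: addr_ge0.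
by rewrite mulrDl (le_trans (ler_normD _ _)) // lerD.
Qed.

Lemma bigON k C x : bigO k C x -> bigO k C (- x).
Proof. by rewrite /bigO normrN. Qed.

Lemma bigOM k j C C' x y : bigO k C x -> bigO j C' y ->
  bigO (k + j) (C * C') (x * y).
Proof.
move=> [C0 hx] [C0' hy]; split; first exact: mulr_ge0.
by rewrite normrM exprD mulrACA; exact: ler_pM.
Qed.

Lemma bigO_up k j C x : (j <= k)%N -> bigO k C x -> bigO j C x.
Proof.
move=> jk [C0 hx]; split=> //; apply: (le_trans hx); apply: ler_wpM2l => //.
by apply: ler_wiXn2l.
Qed.
End Order.

(* The squared norm of the horizontal gradient (A, B) of the calibration is
   1 + (Riccati form) + cubic remainder. *)
Lemma calibration_pointwise (R : realType) (D l : R) : 0 <= D -> 0 < l ->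
  exists2 m, 0 < m & forall a b w1 w2 r0 r1 r2 r3 rho c s : R,
  let n := `|a| + `|b| + `|w1| + `|w2| in
  let h := a + (a ^+ 2 + b ^+ 2) / 2 in
  n <= m -> `|c| <= 1 -> `|s| <= 1 ->
  `|r0| <= D * n -> `|r1| <= D * n -> `|r2| <= D * n -> `|r3| <= D * n ->
  `|rho| <= D * n ^+ 2 ->
  r0 ^+ 2 + a ^+ 2 + 2 * rho + 2 * a * (- 2 * r1 - s * r2 + c * r3)
    <= - l * n ^+ 2 ->
  (- b + (1 + a) * b / 2 - (b * (1 - b ^+ 2) + a * (b * (1 + a))) / 2
    - b * rho + r0 * (1 - b ^+ 2) + r1 * (b * (1 + a))
    + r2 * (h * c) + r3 * (h * s)) ^+ 2 +
  ((1 + a) + (1 - (1 + a) ^+ 2) / 2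
    - (b * (b * (1 + a)) + a * (1 - (1 + a) ^+ 2)) / 2
    + (1 + a) * rho + r0 * (b * (1 + a)) + r1 * (1 - (1 + a) ^+ 2)
    - r2 * (h * s) + r3 * (h * c)) ^+ 2 <= 1.
Proof.
move=> D0 l0.
suff [C hC] : exists C, forall a b w1 w2 r0 r1 r2 r3 rho c s : R,
  let n := `|a| + `|b| + `|w1| + `|w2| in
  let h := a + (a ^+ 2 + b ^+ 2) / 2 in
  n <= 1 -> `|c| <= 1 -> `|s| <= 1 ->
  `|r0| <= D * n -> `|r1| <= D * n -> `|r2| <= D * n -> `|r3| <= D * n ->
  `|rho| <= D * n ^+ 2 ->
  `|(- b + (1 + a) * b / 2 - (b * (1 - b ^+ 2) + a * (b * (1 + a))) / 2
    - b * rho + r0 * (1 - b ^+ 2) + r1 * (b * (1 + a))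
    + r2 * (h * c) + r3 * (h * s)) ^+ 2 +
  ((1 + a) + (1 - (1 + a) ^+ 2) / 2
    - (b * (b * (1 + a)) + a * (1 - (1 + a) ^+ 2)) / 2
    + (1 + a) * rho + r0 * (b * (1 + a)) + r1 * (1 - (1 + a) ^+ 2)
    - r2 * (h * s) + r3 * (h * c)) ^+ 2 - 1 -
   (r0 ^+ 2 + a ^+ 2 + 2 * rho + 2 * a * (- 2 * r1 - s * r2 + c * r3))|
   <= C * n ^+ 3.
  exists (Num.min 1 (l / (1 + `|C|))).
    by rewrite lt_min ltr01 divr_gt0 // ltr_wpDr.
  move=> a b w1 w2 r0 r1 r2 r3 rho c s n h.
  rewrite le_min => /andP[n1 nl] c1 s1 h0 h1 h2 h3 h4 hR.
  have := hC a b w1 w2 r0 r1 r2 r3 rho c s n1 c1 s1 h0 h1 h2 h3 h4.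
  rewrite -/n -/h => /(le_trans (ler_norm _)) hh.
  have n0 : 0 <= n by rewrite /n !addr_ge0.
  have : C * n ^+ 3 <= l * n ^+ 2.
    apply: (@le_trans _ _ (`|C| * n ^+ 3)).
      by rewrite ler_wpM2r ?exprn_ge0 // ler_norm.
    rewrite exprS mulrA ler_wpM2r ?sqr_ge0 //.
    apply: (le_trans (ler_wpM2l (normr_ge0 _) nl)).
    by apply: mul_div1p_le => //; exact: ltW.
  lra.
eexists => a b w1 w2 r0 r1 r2 r3 rho c s n h n1 c1 s1 h0 h1 h2 h3 h4.
have n0 : 0 <= n by rewrite /n !addr_ge0.
have Oa : bigO n 1 1 a.
  by split=> //; rewrite mul1r expr1 /n -!addrA lerDl !addr_ge0.
have Ob : bigO n 1 1 b.
  by split=> //; rewrite mul1r expr1 /n -!addrA addrCA lerDl !addr_ge0.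
have Oc : bigO n 0 1 c by split=> //; rewrite mul1r expr0.
have Os : bigO n 0 1 s by split=> //; rewrite mul1r expr0.
have O0 : bigO n 1 D r0 by [].
have O1 : bigO n 1 D r1 by [].
have O2 : bigO n 1 D r2 by [].
have O3 : bigO n 1 D r3 by [].
have O4 : bigO n 2 D rho by [].
have ha2 := bigOM Oa Oa. have hb2 := bigOM Ob Ob.
have half : bigO n 0 2^-1 (2^-1 : R).
  by split; rewrite ?expr0 ?mulr1 ?ger0_norm //; lra.
have Oq := bigOM half (bigOD ha2 hb2).
(* The two components are (r0 - b) + e1 and 1 + q + e2, with e1 and q of order 2 and e2 of order 3.
   The Riccati expression is (r0 - b)^2 + 2 q, and what is left, 2 (r0 - b) e1 + e1^2 + 2 e2 + (q +
   e2)^2, has order 3. *)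
have e1O := bigOD
  (bigOD (bigOM O1 Ob) (bigOM (bigOD Oa (bigO_up n0 n1 (isT : (1 <= 2)%N) Oq))
     (bigOD (bigOM O2 Oc) (bigOM O3 Os))))
  (bigO_up n0 n1 (isT : (2 <= 3)%N)
    (bigOD (bigOD (bigOD (bigOM half (bigOM Ob hb2))
      (bigON (bigOM half (bigOM ha2 Ob)))) (bigON (bigOM Ob O4)))
      (bigOD (bigON (bigOM O0 hb2)) (bigOM O1 (bigOM Oa Ob))))).
have qO := bigOD (bigOD (bigOM half ha2) (bigON (bigOM half hb2)))
  (bigOD O4 (bigOD (bigOM O0 Ob) (bigOD (bigON (bigOM (bigOD Oa Oa) O1))
    (bigOM Oa (bigOD (bigOM O3 Oc) (bigON (bigOM O2 Os))))))).
have e2O := bigOD (bigOD (bigON (bigOM half (bigOM Oa hb2))) (bigOM half (bigOM Oa ha2)))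
  (bigOD (bigOD (bigOM Oa O4) (bigOM O0 (bigOM Oa Ob)))
   (bigOD (bigON (bigOM ha2 O1)) (bigOM Oq (bigOD (bigOM O3 Oc) (bigON (bigOM O2 Os)))))).
have m1O := bigOM (bigOD O0 (bigON Ob)) e1O.
have e12O := bigO_up n0 n1 (isT : (3 <= 4)%N) (bigOM e1O e1O).
have qe := bigOD qO (bigO_up n0 n1 (isT : (2 <= 3)%N) e2O).
have qe2 := bigO_up n0 n1 (isT : (3 <= 4)%N) (bigOM qe qe).
have [_ fin] := bigOD (bigOD (bigOD m1O m1O) e12O) (bigOD (bigOD e2O e2O) qe2).
move: fin; set E := (X in `|X| <= _).
set A := (X in X ^+ 2 + _ - 1 - _); set B := (X in _ + X ^+ 2 - 1 - _).
suff -> : A ^+ 2 + B ^+ 2 - 1 -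
   (r0 ^+ 2 + a ^+ 2 + 2 * rho + 2 * a * (-2 * r1 - s * r2 + c * r3)) = E.
  exact.
by rewrite /A /B /E /h; field.
Qed.

Section Calibration.
Variable R : realType.

Definition vec4 (a b c d : R) (i : 'I_4) : R := nth 0 [:: a; b; c; d] i.

(** Identifies the Riccati form with the second-order part in [calibration_pointwise], where r is K
    Y and rho is half the form of K'. *)
Lemma quad_riccati (K K' : 'M[R]_4) (s a b w1 w2 : R) :
  let Y := vec4 a b w1 w2 in
  let r i := \sum_j K i j * Y j in K^T = K ->
  ((\col_i Y i)^T *m riccati K K' s *m \col_i Y i) 0 0 =
  r (@Ordinal 4 0 isT) ^+ 2 + a ^+ 2 + 2 * (2^-1 * \sum_i \sum_j K' i j * Y i * Y j)
  + 2 * a * (- 2 * r (@Ordinal 4 1 isT) - sin s * r (@Ordinal 4 2 isT)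
             + cos s * r (@Ordinal 4 3 isT)).
Proof.
move=> Y r symK.
set y := \col_i Y i.
have KY i : (K *m y) i 0 = r i by rewrite mxE; apply: eq_bigr => j _; rewrite mxE.
have YK i : (y^T *m K) 0 i = r i.
  by rewrite -KY -[K in LHS]symK -trmx_mul mxE.
have mxD (A B : 'M[R]_1) : (A + B) 0 0 = A 0 0 + B 0 0 by rewrite mxE.
rewrite /riccati !(mulmxDl, mulmxDr) -!mulmxA !mxD.
have e1 : (y^T *m (K' *m y)) 0 0 = \sum_i \sum_j K' i j * Y i * Y j.
  rewrite mxE; apply: eq_bigr => i _; rewrite !mxE mulr_sumr.
  by apply: eq_bigr => j _; rewrite !mxE; ring.
have e2 : (y^T *m (K *m (ham0 R *m (K *m y)))) 0 0 = r (@Ordinal 4 0 isT) ^+ 2.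
  rewrite mulmxA; move: YK KY; move: (y^T *m K) (K *m y) => v w YK KY.
  rewrite mxE sum4 !mxE !sum4 !mxE /= !YK !KY; ring.
have e3 : (y^T *m (ham0 R *m y)) 0 0 = a ^+ 2.
  by rewrite mxE sum4 !mxE !sum4 !mxE /Y /vec4 /=; ring.
have e4 : (y^T *m ((hamB s)^T *m (K *m y))) 0 0 = a * (- 2 * r (@Ordinal 4 1 isT)
  - sin s * r (@Ordinal 4 2 isT) + cos s * r (@Ordinal 4 3 isT)).
  move: KY; move: (K *m y) => w KY.
  by rewrite mxE sum4 !mxE !sum4 !mxE /= !KY /Y /vec4 /=; ring.
have e5 : (y^T *m (K *m (hamB s *m y))) 0 0 = a * (- 2 * r (@Ordinal 4 1 isT)
  - sin s * r (@Ordinal 4 2 isT) + cos s * r (@Ordinal 4 3 isT)).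
  rewrite mulmxA; move: YK; move: (y^T *m K) => w YK.
  by rewrite mxE sum4 !mxE !sum4 !mxE /= !YK /Y /vec4 /=; ring.
by rewrite e1 e2 e3 e4 e5; field.
Qed.

Lemma norm_sum4_le (B n : R) (k y : 'I_4 -> R) : 0 <= B ->
  (forall j, `|k j| <= B) -> \sum_j `|y j| <= n -> `|\sum_j k j * y j| <= B * n.
Proof.
move=> B0 hk hn; apply: (le_trans (ler_norm_sum _ _ _)).
apply: (@le_trans _ _ (\sum_j B * `|y j|)).
  by apply: ler_sum => j _; rewrite normrM ler_wpM2r.
by rewrite -mulr_sumr ler_wpM2l.
Qed.

(** The competitor enters only through horizontal differentials and the length function l. Its clock
    has to stay in [lo, hi], away from 0, where the Jacobi matrix is singular, and below the
    conjugate angle. *)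
Lemma calibration (lo hi : R) : 0 < lo -> lo <= hi -> hi < 4 * p1V0 R ->
  exists2 m, 0 < m & forall (T : R) (q1 q2 sg w1 w2 l : R -> R),
  let a t := q1 t * cos (sg t) + q2 t * sin (sg t) - 1 in
  let b t := q2 t * cos (sg t) - q1 t * sin (sg t) in
  let h t := (q1 t ^+ 2 + q2 t ^+ 2 - 1) / 2 in
  0 <= T ->
  (forall s t p1 p2, 0 <= s -> s <= t -> t <= T -> p1 ^+ 2 + p2 ^+ 2 <= 1 ->
     p1 * (q1 t - q1 s) + p2 * (q2 t - q2 s) <= l t - l s) ->
  (forall t, 0 <= t <= T -> [/\ lip T t q1, lip T t q2,
     hd T q1 q2 t sg (- q2 t) (q1 t), hd T q1 q2 t w1 (h t) 0 &
     hd T q1 q2 t w2 0 (h t)]) ->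
  (forall t, 0 <= t <= T -> lo <= sg t <= hi /\
     `|a t| + `|b t| + `|w1 t| + `|w2 t| <= m) ->
  [/\ a 0 = 0, b 0 = 0, w1 0 = 0 & w2 0 = 0] ->
  [/\ a T = 0, b T = 0, w1 T = 0 & w2 T = 0] ->
  sg T - sg 0 <= l T - l 0.
Proof.
move=> lo0 lohi hip.
have [K [K' [B [la [B0 la0 hK]]]]] := riccati_strict lo0 lohi hip.
(* The factor 4 passes from the sum of squares of Y to the square of its l1 norm n. *)
have l40 : 0 < la / 4 by rewrite divr_gt0.
have [m m0 hm] := calibration_pointwise (ltW B0) l40.
exists m => // T q1 q2 sg w1 w2 l a b h T0 ql hh hcl end0 endT.
pose Y t := vec4 (a t) (b t) (w1 t) (w2 t).
(* The squared gradient of sg alone is 1 + 2 a to first order; b / 2 cancels the linear term. The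
   term - ab / 2 then cancels b^2 and the products b r0, so that exactly the Riccati form of K
   remains at second order. *)
pose S t := sg t + 2^-1 * b t + (- 2^-1) * (a t * b t) +
  2^-1 * \sum_i \sum_j K (sg t) i j * Y t i * Y t j.
have SE t : [/\ a t = 0, b t = 0, w1 t = 0 & w2 t = 0] -> S t = sg t.
  move=> [a0 b0 w10 w20]; rewrite /S /Y a0 b0 w10 w20.
  rewrite big1 ?mulr0 ?addr0 // => i _; rewrite big1 // => j _.
  have -> : vec4 0 0 0 0 j = 0 by move: j; apply: ord4P.
  by rewrite mulr0.
rewrite -(SE T endT) -(SE 0 end0).
apply: (hd_contraction T0 ql) => t tT.
have [lq1 lq2 hsg hw1 hw2] := hh t tT.
have [sgt clt] := hcl t tT.
have [dK symK bK bK' ric] := hK _ sgt.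
have lsg := lip_hd lq1 lq2 hsg.
have lh F p1 p2 : hd T q1 q2 t F p1 p2 -> lip T t F by apply: lip_hd.
have hq1 := hd_q1 T q1 q2 t. have hq2 := hd_q2 T q1 q2 t.
have hcos := hd_comp lsg hsg (is_derive_cos (sg t)).
have hsin := hd_comp lsg hsg (is_derive_sin (sg t)).
have lcos := lh _ _ _ hcos. have lsin := lh _ _ _ hsin.
set s := sin (sg t) in hcos hsin *; set c := cos (sg t) in hcos hsin *.
have cs : c ^+ 2 = 1 - s ^+ 2 by apply: cs1.
pose a1 := c - b t * q2 t; pose a2 := s + b t * q1 t.
pose b1 := - s + (1 + a t) * q2 t; pose b2 := c - (1 + a t) * q1 t.
have ha : hd T q1 q2 t a a1 a2.
  apply: (hd_eq (hd_add (hd_add (hd_mul lq1 lcos hq1 hcos)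
    (hd_mul lq2 lsin hq2 hsin)) (hd_cst T q1 q2 t (-1)))); rewrite /a1 /a2 /b -/s -/c; ring.
have hb : hd T q1 q2 t b b1 b2.
  have hN := hd_mul (lh _ _ _ (hd_cst T q1 q2 t (-1))) (lh _ _ _ (hd_mul lq1 lsin hq1 hsin))
    (hd_cst T q1 q2 t (-1)) (hd_mul lq1 lsin hq1 hsin).
  have := hd_add (hd_mul lq2 lcos hq2 hcos) hN.
  have -> : (fun s0 => q2 s0 * cos (sg s0) + -1 * (q1 s0 * sin (sg s0))) = b.
    by apply/funext => u; rewrite /b mulN1r.
  by move/hd_eq; apply; rewrite /b1 /b2 /a -/s -/c; ring.
pose y1 := vec4 a1 b1 (h t) 0; pose y2 := vec4 a2 b2 0 (h t).
have hY i : hd T q1 q2 t (fun u => Y u i) (y1 i) (y2 i).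
  by move: i; apply: ord4P.
have hKij i j := hd_comp lsg hsg (dK i j).
have hQ i j := hd_mul (lh _ _ _ (hd_mul (lh _ _ _ (hKij i j)) (lh _ _ _ (hY i)) (hKij i j) (hY i)))
  (lh _ _ _ (hY j)) (hd_mul (lh _ _ _ (hKij i j)) (lh _ _ _ (hY i)) (hKij i j) (hY i)) (hY j).
have hQQ := hd_sum (fun i => hd_sum (hQ i)).
have hZ (k : R) F p1 p2 : hd T q1 q2 t F p1 p2 ->
    hd T q1 q2 t (fun u => k * F u) (k * p1) (k * p2).
  move=> hF; have := hd_mul (lh _ _ _ (hd_cst T q1 q2 t k)) (lh _ _ _ hF) (hd_cst T q1 q2 t k) hF.
  by move/hd_eq; apply; ring.
pose r i := \sum_j K (sg t) i j * Y t j.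
pose rho := 2^-1 * \sum_i \sum_j K' (sg t) i j * Y t i * Y t j.
(* One component of the gradient of Y^T K(sg) Y: d is the component of the clock and y that of Y.
   The symmetry of K merges the two terms in y. It is applied once for dq1 and once for dq2. *)
have sumE (d : R) (y : 'I_4 -> R) :
  \sum_i \sum_j ((K' (sg t) i j * d * Y t i + K (sg t) i j * y i) * Y t j
     + K (sg t) i j * Y t i * y j) = 2 * (rho * d + \sum_i r i * y i).
  have -> : 2 * (rho * d + \sum_i r i * y i) =
     \sum_i \sum_j K' (sg t) i j * Y t i * Y t j * d + \sum_i r i * y i + \sum_i r i * y i.
    under [X in _ = X + _ + _]eq_bigr do rewrite -mulr_suml.
    by rewrite -mulr_suml /rho; field.
  have e2 : \sum_i r i * y i = \sum_i \sum_j K (sg t) i j * Y t i * y j.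
    rewrite exchange_big; apply: eq_bigr => j _; rewrite /r mulr_suml.
    apply: eq_bigr => i _; congr (_ * _ * _).
    by rewrite -[in RHS]symK mxE.
  rewrite [X in _ = _ + X]e2 -!big_split; apply: eq_bigr => i _.
  rewrite /r mulr_suml -!big_split; apply: eq_bigr => j _ /=; ring.
have hS := hd_add (hd_add (hd_add hsg (hZ (2^-1) _ _ _ hb))
   (hZ (- 2^-1) _ _ _ (hd_mul (lh _ _ _ ha) (lh _ _ _ hb) ha hb))) (hZ (2^-1) _ _ _ hQQ).
rewrite /= !sumE in hS.
eexists; eexists; split; first exact: hS.
set n := `|a t| + `|b t| + `|w1 t| + `|w2 t| in clt.
have nE : \sum_j `|Y t j| = n by rewrite sum4.
have n0 : 0 <= n by rewrite /n !addr_ge0.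
have rb i : `|r i| <= B * n.
  by apply: norm_sum4_le; rewrite ?nE //; exact: ltW.
have rhob : `|rho| <= B * n ^+ 2.
  rewrite /rho normrM ger0_norm; last by lra.
  have : `|\sum_i \sum_j K' (sg t) i j * Y t i * Y t j| <= B * n ^+ 2.
    have -> : \sum_i \sum_j K' (sg t) i j * Y t i * Y t j =
       \sum_i (\sum_j K' (sg t) i j * Y t j) * Y t i.
      by apply: eq_bigr => i _; rewrite mulr_suml; apply: eq_bigr => j _; ring.
    rewrite expr2 mulrA; apply: norm_sum4_le; rewrite ?nE //.
      by rewrite mulr_ge0 // ltW.
    by move=> i; apply: norm_sum4_le; rewrite ?nE //; exact: ltW.
  move=> h1; have h2 : 0 <= B * n ^+ 2 by rewrite mulr_ge0 ?sqr_ge0 // ltW.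
  by lra.
have ricb : r (@Ordinal 4 0 isT) ^+ 2 + a t ^+ 2 + 2 * rho + 2 * a t *
   (- 2 * r (@Ordinal 4 1 isT) - s * r (@Ordinal 4 2 isT) + c * r (@Ordinal 4 3 isT))
   <= - (la / 4) * n ^+ 2.
  have := ric (\col_i Y t i); rewrite quad_riccati // => /le_trans; apply.
  rewrite !mulNr lerN2 -mulrA; apply: ler_wpM2l; first exact: ltW.
  rewrite /sumsq sum4 !mxE /Y /vec4 /= /n.
  rewrite -(real_normK (num_real (a t))) -(real_normK (num_real (b t))).
  rewrite -(real_normK (num_real (w1 t))) -(real_normK (num_real (w2 t))).
  move: (`|a t|) (`|b t|) (`|w1 t|) (`|w2 t|) => x y z w.
  have := sqr_ge0 (x - y); have := sqr_ge0 (x - z); have := sqr_ge0 (x - w).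
  have := sqr_ge0 (y - z); have := sqr_ge0 (y - w); have := sqr_ge0 (z - w).
  lra.
have := hm (a t) (b t) (w1 t) (w2 t) _ _ _ _ rho c s clt (cos_max _) (sin_max _)
  (rb (@Ordinal 4 0 isT)) (rb (@Ordinal 4 1 isT)) (rb (@Ordinal 4 2 isT))
  (rb (@Ordinal 4 3 isT)) rhob ricb.
apply: le_trans; rewrite le_eqVlt; apply/orP; left; apply/eqP.
(* In the frame rotated by sg t the gradient has the components of [calibration_pointwise], and the
   rotation preserves the norm. *)
have q1E : q1 t = (1 + a t) * c - b t * s.
  by rewrite /a /b -/c -/s; ring: cs.
have q2E : q2 t = (1 + a t) * s + b t * c.
  by rewrite /a /b -/c -/s; ring: cs.
rewrite !sum4 /y1 /y2 /vec4 /= /a1 /a2 /b1 /b2 /h q1E q2E.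
move: (r _) (r _) (r _) (r _) (a t) (b t) => r0 r1 r2 r3 x y.
clear -cs.
by field: cs.
Qed.
End Calibration.

(** * Admissible curves *)

Section SegmentIntegral.
Variable R : realType.
Implicit Types (a b c : R) (f g : R -> R).

Lemma segE a b : seg a b = `[a, b]%classic.
Proof. by apply/seteqP; split=> x; rewrite /seg /= in_itv. Qed.

Lemma leb_itv a b : @leb R `[a, b]%classic = (if a < b then (b - a)%:E else 0%E).
Proof.
have := @lebesgue_measure_itv R `[a, b]; rewrite /leb /= lte_fin => ->.
by rewrite EFinB.
Qed.

Definition bmeas a b f := measurable_fun (seg a b) f /\
  exists M, forall s, a <= s <= b -> `|f s| <= M.

Definition Int a b f := Rintegral (@leb R) (seg a b) f.

Lemma bmeasS a b a' b' f : a <= a' -> b' <= b -> bmeas a b f -> bmeas a' b' f.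
Proof.
move=> aa bb [mf [M hM]]; split; last by exists M => s hs; apply: hM; lra.
rewrite segE; apply: measurable_funS mf; first by rewrite segE.
rewrite segE; apply: subset_itv; by rewrite bnd_simp.
Qed.

Lemma bmeas_int a b f : bmeas a b f ->
  (@leb R).-integrable `[a, b]%classic (EFin \o f).
Proof.
rewrite /bmeas segE => -[mf [M hM]]; apply: measurable_bounded_integrable => //.
  exact: (compact_finite_measure (@segment_compact _ a b)).
exists M; split; first exact: num_real.
move=> x Mx y /=; rewrite in_itv /= => hy.
by apply: (le_trans (hM _ hy)); exact: ltW.
Qed.

Lemma bmeas_cst a b c : bmeas a b (fun=> c).
Proof. by split; [exact: measurable_cst|exists `|c|]. Qed.

Lemma bmeasD a b f g : bmeas a b f -> bmeas a b g ->
  bmeas a b (fun s => f s + g s).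
Proof.
move=> [mf [M hM]] [mg [N hN]]; split; first exact: measurable_realfun.measurable_funD.
exists (M + N) => s hs; apply: (le_trans (ler_normD _ _)).
by apply: lerD; [apply: hM|apply: hN].
Qed.

Lemma bmeasM a b f g : bmeas a b f -> bmeas a b g ->
  bmeas a b (fun s => f s * g s).
Proof.
move=> [mf [M hM]] [mg [N hN]]; split; first exact: measurable_realfun.measurable_funM.
exists (M * N) => s hs; rewrite normrM.
by apply: ler_pM; rewrite ?normr_ge0 //; [apply: hM|apply: hN].
Qed.

Lemma bmeasN a b f : bmeas a b f -> bmeas a b (fun s => - f s).
Proof.
move=> h; have := bmeasM (bmeas_cst a b (-1)) h.
by congr bmeas; apply/funext => s; rewrite mulN1r.
Qed.

Lemma bmeas_cont a b f : {within seg a b, continuous f} -> bmeas a b f.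
Proof.
rewrite /bmeas segE => cf; split.
  by apply: measurable_realfun.subspace_continuous_measurable_fun.
have /compact_bounded[M [_ mrt]] := continuous_compact cf (@segment_compact _ a b).
exists (M + 1) => s hs; apply: (mrt (M + 1)); first by rewrite ltrDl.
by exists s => //=; rewrite in_itv.
Qed.

Lemma bmeas_der a b f : (forall s, a <= s <= b -> exists l, is_derive s 1 f l) ->
  bmeas a b f.
Proof.
move=> D; apply: bmeas_cont; apply: continuous_in_subspaceT => s.
by rewrite inE /seg /= => /D[l]; exact: der_cont.
Qed.

Lemma bmeas_sqrt a b f : bmeas a b f -> (forall s, a <= s <= b -> 0 <= f s) ->
  bmeas a b (fun s => Num.sqrt (f s)).
Proof.
move=> [mf [M hM]] f0; split.
  apply: measurableT_comp => //; apply: measurable_realfun.continuous_measurable_fun.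
  exact: sqrt_continuous.
exists (Num.sqrt M) => s hs; rewrite ger0_norm ?sqrtr_ge0 //.
by apply: ler_wsqrtr; apply: (le_trans (ler_norm _)); apply: hM.
Qed.

Lemma IntD a b f g : bmeas a b f -> bmeas a b g ->
  Int a b (fun s => f s + g s) = Int a b f + Int a b g.
Proof.
by move=> /bmeas_int hf /bmeas_int hg; rewrite /Int segE RintegralD.
Qed.

Lemma IntZ a b k f : bmeas a b f -> Int a b (fun s => k * f s) = k * Int a b f.
Proof. by move=> /bmeas_int hf; rewrite /Int segE RintegralZl. Qed.

Lemma Int_eq a b f g : (forall s, a <= s <= b -> f s = g s) -> Int a b f = Int a b g.
Proof.
by move=> fg; apply: eq_Rintegral => s; rewrite inE /seg /= => /fg.
Qed.

Lemma Int_le a b f g : bmeas a b f -> bmeas a b g ->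
  (forall s, a <= s <= b -> f s <= g s) -> Int a b f <= Int a b g.
Proof.
move=> /bmeas_int hf /bmeas_int hg fg; rewrite /Int segE.
by apply: le_Rintegral => // s /=; rewrite in_itv /= => /fg.
Qed.

Lemma Int_cst a b k : a <= b -> Int a b (fun=> k) = k * (b - a).
Proof.
move=> ab; rewrite /Int segE Rintegral_cst //; congr (_ * _).
transitivity (fine (@leb R `[a, b]%classic)); first by [].
rewrite leb_itv; move: ab; rewrite le_eqVlt.
by move=> /predU1P[->|->]; rewrite ?ltxx /= ?subrr.
Qed.

Lemma Int_norm a b f M : a <= b -> bmeas a b f ->
  (forall s, a <= s <= b -> `|f s| <= M) -> `|Int a b f| <= M * (b - a).
Proof.
move=> ab hf hM; rewrite ler_norml; apply/andP; split.
  rewrite -mulNr -Int_cst //; apply: Int_le => //; first exact: bmeas_cst.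
  by move=> s /hM; rewrite ler_norml => /andP[].
rewrite -Int_cst //; apply: Int_le => //; first exact: bmeas_cst.
by move=> s /hM; rewrite ler_norml => /andP[].
Qed.

Lemma Int_split a b c f : a <= c -> c <= b -> bmeas a b f ->
  Int a b f = Int a c f + Int c b f.
Proof.
move=> ac cb hf; have hi := bmeas_int hf.
have hcb := bmeas_int (bmeasS ac (lexx b) hf).
have := @Rintegral_itvB R f (BLeft a) (BRight b) c hi.
rewrite !bnd_simp => /(_ ac cb) e.
rewrite /Int !segE -[X in _ + X]Rintegral_itv_obnd_cbnd; first by rewrite -e addrC subrK.
apply: integrableS hcb => //; exact: subset_itv_oc_cc.
Qed.

Lemma Int0 a f : Int a a f = 0.
Proof. by rewrite /Int segE set_itv1 Rintegral_set1. Qed.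

Lemma Int_FTC a b f F : a <= b -> (forall s, a <= s <= b -> is_derive s 1 F (f s)) ->
  {within seg a b, continuous f} -> Int a b f = F b - F a.
Proof.
rewrite le_eqVlt => /predU1P[->|ab] dF cf; first by rewrite Int0 subrr.
rewrite segE in cf; rewrite /Int segE /Rintegral.
rewrite (@continuous_FTC2 _ f F) //.
- have ct s : a <= s <= b -> {for s, continuous F} by move=> /dF; exact: der_cont.
  split; first by move=> s; rewrite in_itv /= => hs; case: (dF s _) => //; lra.
    by apply: cvg_at_right_filter; apply: ct; rewrite lexx ltW.
  by apply: cvg_at_left_filter; apply: ct; rewrite lexx ltW.
- move=> s; rewrite in_itv /= => hs; rewrite derive1E; case: (dF s _) => //; lra.
Qed.

(* If [U] and [Z] are primitives of [u] and [g u], then dZ = g dU. *)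
Lemma Int_frozen T u g (U Z : R -> R) t : 0 <= t <= T ->
  bmeas 0 T u -> {within seg 0 T, continuous g} ->
  (forall s, 0 <= s <= T -> U s = U 0 + Int 0 s u) ->
  (forall s, 0 <= s <= T -> Z s = Z 0 + Int 0 s (fun r => g r * u r)) ->
  forall e, 0 < e -> exists2 d, 0 < d & forall s, 0 <= s <= T -> `|s - t| < d ->
  `|Z s - Z t - g t * (U s - U t)| <= e * `|s - t|.
Proof.
move=> tT bu cg hU hZ e e0.
have bg := bmeas_cont cg; have bgu := bmeasM bg bu.
have [M hM] := bu.2.
have M0 : 0 <= M by have := hM t tT; apply: le_trans.
have e1 : 0 < e / (1 + M) by rewrite divr_gt0 // ltr_wpDr.
have [d d0 hd] : exists2 d, 0 < d & forall r, 0 <= r <= T -> `|r - t| < d ->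
    `|g r - g t| <= e / (1 + M).
  have /continuous_within_itvP := cg.
  move: cg; rewrite segE => /subspace_continuousP/(_ t).
  rewrite /= in_itv /= => /(_ tT) /cvgr_dist_le /(_ _ e1).
  rewrite /within /= => /nbhs_ballP[d /= d0 hd] _.
  exists d => // r rT rd; rewrite distrC; apply: hd => //=.
    by rewrite /ball /= distrC.
exists d => // s sT sd.
have key p q : 0 <= p -> p <= q -> q <= T -> (forall r, p <= r <= q -> `|r - t| < d) ->
    `|Z q - Z p - g t * (U q - U p)| <= e * (q - p).
  move=> p0 pq qT hr.
  have pT : 0 <= p <= T by lra. have qT' : 0 <= q <= T by lra.
  have diff w : bmeas 0 T w -> Int 0 q w - Int 0 p w = Int p q w.
    move=> bw; rewrite (@Int_split 0 q p) //; first by ring.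
    by apply: bmeasS bw.
  have -> : Z q - Z p = Int p q (fun r => g r * u r).
    by rewrite (hZ q) // (hZ p) // -diff //; ring.
  have -> : U q - U p = Int p q u by rewrite (hU q) // (hU p) // -diff //; ring.
  have bS w : bmeas 0 T w -> bmeas p q w by apply: bmeasS.
  rewrite -mulNr -IntZ; last exact: bS.
  rewrite -IntD; [|exact: bS|apply: bmeasM; [exact: bmeas_cst|exact: bS]].
  apply: Int_norm => //.
    apply: bmeasD; first exact: bS.
    by apply: bmeasM; [exact: bmeas_cst|exact: bS].
  move=> r hr'; rewrite mulNr -mulrBl normrM.
  have r1 := hd r _ (hr r hr'); have r2 := hM r.
  apply: (@le_trans _ _ (e / (1 + M) * M)).
    by apply: ler_pM; rewrite ?normr_ge0 //; [apply: r1|apply: r2]; lra.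
  by rewrite mulrC; apply: mul_div1p_le => //; exact: ltW.
have [ts|st] := leP t s.
  rewrite ger0_norm in sd *; [|lra..].
  by apply: key; [lra|lra|lra|]; move=> r hr; rewrite ger0_norm; lra.
rewrite ltr0_norm in sd *; [|lra..].
have -> : `|Z s - Z t - g t * (U s - U t)| = `|Z t - Z s - g t * (U t - U s)|.
  by rewrite -normrN; congr `|_|; ring.
rewrite opprB; apply: key; [lra|lra|lra|] => r hr; rewrite ler0_norm; lra.
Qed.
End SegmentIntegral.

(** * Automation for horizontal differentials *)

Section HdTactic.
Variables (R : realType) (T : R) (x y : R -> R) (t : R).
Hypotheses (lx : lip T t x) (ly : lip T t y).
Notation hdt := (hd T x y t).

Lemma hdM F G p1 p2 r1 r2 : hdt F p1 p2 -> hdt G r1 r2 ->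
  hdt (fun s => F s * G s) (p1 * G t + F t * r1) (p2 * G t + F t * r2).
Proof.
by move=> hF hG; apply: hd_mul => //; [apply: lip_hd hF|apply: lip_hd hG].
Qed.

Lemma hdN F p1 p2 : hdt F p1 p2 -> hdt (fun s => - F s) (- p1) (- p2).
Proof.
move=> hF; have := hdM (hd_cst T x y t (-1)) hF.
have -> : (fun s => -1 * F s) = (fun s => - F s) by apply/funext => s; rewrite mulN1r.
by move/hd_eq; apply; ring.
Qed.

Lemma hd_rebase (q1 q2 : R -> R) a11 a12 a21 a22 F p1 p2 :
  (forall s, x s - x t = a11 * (q1 s - q1 t) + a12 * (q2 s - q2 t)) ->
  (forall s, y s - y t = a21 * (q1 s - q1 t) + a22 * (q2 s - q2 t)) ->
  hdt F p1 p2 -> hd T q1 q2 t F (p1 * a11 + p2 * a21) (p1 * a12 + p2 * a22).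
Proof.
move=> ex ey hF e e0; have [d d0 h] := hF e e0; exists d => // s sT sd.
have := h s sT sd; rewrite ex ey; congr (`|_| <= _); ring.
Qed.

Lemma hd_ext F G p1 p2 : 0 <= t <= T -> (forall s, 0 <= s <= T -> F s = G s) ->
  hdt F p1 p2 -> hdt G p1 p2.
Proof.
move=> tT e hF e1 e10; have [d d0 h] := hF e1 e10; exists d => // s sT sd.
by rewrite -!e //; apply: h.
Qed.
End HdTactic.

Ltac hd_step lx ly := lazymatch goal with
  | |- hd _ _ _ _ (fun _ => ?c) _ _ => notypeclasses refine (hd_cst _ _ _ _ _)
  | |- hd _ _ _ _ (fun s => @?F s + @?G s) _ _ => notypeclasses refine (hd_add _ _)
  | |- hd _ _ _ _ (fun s => - @?F s) _ _ => notypeclasses refine (hdN lx ly _)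
  | |- hd _ _ _ _ (fun s => @?F s * @?G s) _ _ =>
      notypeclasses refine (hdM lx ly _ _)
  | |- hd _ _ _ _ _ _ _ => eassumption end.
Ltac hd_auto lx ly := notypeclasses refine (hd_eq _ _ _); [repeat hd_step lx ly| |].

Lemma lip_within (R : realType) (T : R) (F : R -> R) :
  (forall t, 0 <= t <= T -> lip T t F) -> {within seg 0 T, continuous F}.
Proof.
move=> h; rewrite segE; apply/subspace_continuousP => t /=; rewrite in_itv /= => tT.
have [d d0 [M M0 hM]] := h t tT.
apply/cvgrPdist_le => e e0; rewrite /within /=; apply/nbhs_ballP.
have e1 : 0 < e / (1 + M) by rewrite divr_gt0 // ltr_wpDr.
exists (Num.min d (e / (1 + M))); first by rewrite /= lt_min d0.
move=> s; rewrite /ball /= lt_min => /andP[h1 h2]; rewrite in_itv /= => sT.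
rewrite distrC in h1 h2; rewrite distrC; apply: (le_trans (hM _ sT h1)).
apply: (le_trans (ler_wpM2l M0 (ltW h2))).
by apply: mul_div1p_le => //; exact: ltW.
Qed.

(** * Horizontal differentials and length along an admissible curve *)

Section Admissible.
Variables (R : realType) (T : R) (g : curve R) (u1 u2 : R -> R).
Hypotheses (T0 : 0 <= T) (adm : admissible T g u1 u2).
Let x := cx g. Let y := cy g.

Lemma adm_bmeas : bmeas 0 T u1 /\ bmeas 0 T u2.
Proof.
have [m1 [m2 [[M hM] _]]] := adm.
by split; split => //; exists M => s /hM[].
Qed.

Lemma primitive_lip (u U : R -> R) t : bmeas 0 T u ->
  (forall s, 0 <= s <= T -> U s = U 0 + Int 0 s u) -> 0 <= t <= T -> lip T t U.
Proof.
move=> bu hU tT.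
exists 1 => //; have [M hM] := bu.2; exists M; first exact: le_trans (hM t tT).
move=> s sT sd.
have key p q : 0 <= p -> p <= q -> q <= T -> `|U q - U p| <= M * (q - p).
  move=> p0 pq qT; rewrite hU ?[U p]hU; [|lra..].
  rewrite (@Int_split R 0 q p) //; last by apply: bmeasS bu.
  have -> : forall X Y Z : R, X + (Y + Z) - (X + Y) = Z by move=> *; ring.
  apply: Int_norm => //; first by apply: bmeasS bu.
  by move=> r hr; apply: hM; lra.
have [ts|st] := leP t s.
  by rewrite [`|s - t|]ger0_norm; [apply: key|]; lra.
by rewrite distrC [`|s - t|]distrC [`|t - s|]ger0_norm; [apply: key|]; lra.
Qed.

Let hx s : 0 <= s <= T -> x s = x 0 + Int 0 s u1.
Proof. by have [_ [_ [_ h]]] := adm; move=> /h[]. Qed.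
Let hy s : 0 <= s <= T -> y s = y 0 + Int 0 s u2.
Proof. by have [_ [_ [_ h]]] := adm; move=> /h[]. Qed.

Lemma adm_lip t : 0 <= t <= T -> lip T t (cx g) /\ lip T t (cy g).
Proof.
move=> tT; have [b1 b2] := adm_bmeas.
by split; [apply: (primitive_lip b1)|apply: (primitive_lip b2)].
Qed.

Lemma hd_primitive (f1 f2 F : R -> R) t : 0 <= t <= T ->
  (forall t, 0 <= t <= T -> lip T t f1) -> (forall t, 0 <= t <= T -> lip T t f2) ->
  (forall s, 0 <= s <= T -> F s = F 0 + Int 0 s (fun r => f1 r * u1 r + f2 r * u2 r)) ->
  hd T (cx g) (cy g) t F (f1 t) (f2 t).
Proof.
move=> tT /lip_within c1 /lip_within c2 hF; have [b1 b2] := adm_bmeas.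
have bf1 := bmeasM (bmeas_cont c1) b1; have bf2 := bmeasM (bmeas_cont c2) b2.
pose F1 s := Int 0 s (fun r => f1 r * u1 r); pose F2 s := Int 0 s (fun r => f2 r * u2 r).
have i1 s : 0 <= s <= T -> F1 s = F1 0 + Int 0 s (fun r => f1 r * u1 r).
  by move=> _; rewrite /F1 Int0 add0r.
have i2 s : 0 <= s <= T -> F2 s = F2 0 + Int 0 s (fun r => f2 r * u2 r).
  by move=> _; rewrite /F2 Int0 add0r.
have k1 : hd T (cx g) (cy g) t F1 (f1 t) 0.
  move=> e e0; have [d d0 h] := Int_frozen tT b1 c1 hx i1 e0.
  by exists d => // s sT sd; rewrite mul0r subr0; apply: h.
have k2 : hd T (cx g) (cy g) t F2 0 (f2 t).
  move=> e e0; have [d d0 h] := Int_frozen tT b2 c2 hy i2 e0.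
  by exists d => // s sT sd; rewrite mul0r subr0; apply: h.
apply: (hd_ext (F := fun s => F 0 + (F1 s + F2 s)) tT).
  move=> s sT; rewrite (hF s sT); congr (_ + _); rewrite /F1 /F2 -IntD //.
    by apply: bmeasS bf1; lra.
  by apply: bmeasS bf2; lra.
by apply: (hd_eq (hd_add (hd_cst _ _ _ _ (F 0)) (hd_add k1 k2))); ring.
Qed.

Lemma adm_hd t : 0 <= t <= T ->
  let X := cx g t in let Y := cy g t in
  [/\ hd T (cx g) (cy g) t (cz g) (- (Y / 2)) (X / 2),
      hd T (cx g) (cy g) t (cv g) 0 ((X ^+ 2 + Y ^+ 2) / 2) &
      hd T (cx g) (cy g) t (cw g) (- ((X ^+ 2 + Y ^+ 2) / 2)) 0].
Proof.
move=> tT X Y.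
have lx s : 0 <= s <= T -> lip T s x by move=> /adm_lip[].
have ly s : 0 <= s <= T -> lip T s y by move=> /adm_lip[].
have lF F : (forall s, 0 <= s <= T -> exists p1 p2, hd T x y s F p1 p2) ->
    forall s, 0 <= s <= T -> lip T s F.
  by move=> h s sT; have [p1 [p2 hp]] := h s sT; apply: lip_hd (lx s sT) (ly s sT) hp.
have l0 s : 0 <= s <= T -> lip T s (fun=> 0).
  by apply: lF => r _; do 2 eexists; apply: hd_cst.
have lx2 s : 0 <= s <= T -> lip T s (fun r => x r / 2).
  apply: lF => r rT; have h1 := hd_q1 T x y r; do 2 eexists.
  repeat hd_step (lx r rT) (ly r rT).
have ly2 s : 0 <= s <= T -> lip T s (fun r => - (y r / 2)).
  apply: lF => r rT; have h1 := hd_q2 T x y r; do 2 eexists.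
  repeat hd_step (lx r rT) (ly r rT).
have lr s : 0 <= s <= T -> lip T s (fun r => (x r * x r + y r * y r) / 2).
  apply: lF => r rT; have h1 := hd_q1 T x y r; have h2 := hd_q2 T x y r; do 2 eexists.
  repeat hd_step (lx r rT) (ly r rT).
have lrN s : 0 <= s <= T -> lip T s (fun r => - ((x r * x r + y r * y r) / 2)).
  apply: lF => r rT; have h1 := hd_q1 T x y r; have h2 := hd_q2 T x y r; do 2 eexists.
  repeat hd_step (lx r rT) (ly r rT).
have [_ [_ [_ h]]] := adm; split.
- by apply: (hd_primitive (f1 := fun r => - (y r / 2)) (f2 := fun r => x r / 2)) => // s /h[].
- apply: (hd_primitive (f1 := fun=> 0)
    (f2 := fun r => (x r * x r + y r * y r) / 2)) => // s /h[_ _ _ -> _].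
  by congr (_ + _); apply: Int_eq => r _; rewrite mul0r add0r.
- apply: (hd_primitive (f2 := fun=> 0)
    (f1 := fun r => - ((x r * x r + y r * y r) / 2))) => // s /h[_ _ _ _ ->].
  by congr (_ + _); apply: Int_eq => r _; rewrite mul0r addr0.
Qed.

Let sp r := Num.sqrt (u1 r ^+ 2 + u2 r ^+ 2).

Lemma adm_speed_bmeas : bmeas 0 T sp.
Proof.
have [b1 b2] := adm_bmeas; apply: bmeas_sqrt; last first.
  by move=> s _; rewrite addr_ge0 ?sqr_ge0.
by apply: bmeasD; apply: bmeasM.
Qed.

(** Cauchy-Schwarz on the integrand. With k = |c| it makes the rescaled length an admissible l for
    [hd_contraction]. *)
Lemma adm_length_ge s t (k al be : R) : 0 <= s -> s <= t -> t <= T -> 0 <= k ->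
  al ^+ 2 + be ^+ 2 <= k ^+ 2 ->
  al * (cx g t - cx g s) + be * (cy g t - cy g s) <=
  k * Int 0 t sp - k * Int 0 s sp.
Proof.
move=> s0 st tT k0 abk; have [b1 b2] := adm_bmeas; have bs := adm_speed_bmeas.
have diff w : bmeas 0 T w -> Int 0 t w - Int 0 s w = Int s t w.
  move=> bw; rewrite (@Int_split R 0 t s) //; first by ring.
  by apply: bmeasS bw.
have bS w : bmeas 0 T w -> bmeas s t w by apply: bmeasS.
have -> : cx g t - cx g s = Int s t u1.
  by rewrite -/x (hx (s := t)) ?(hx (s := s)) -?diff //; [ring|lra|lra].
have -> : cy g t - cy g s = Int s t u2.
  by rewrite -/y (hy (s := t)) ?(hy (s := s)) -?diff //; [ring|lra|lra].
rewrite -mulrBr diff // -!IntZ; [|exact: bS..].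
have bZ w q : bmeas 0 T w -> bmeas s t (fun r => q * w r).
  by move=> bw; apply: bmeasM; [exact: bmeas_cst|exact: bS].
rewrite -IntD; [|exact: bZ..].
apply: Int_le; [apply: bmeasD; exact: bZ|exact: bZ|] => r _.
rewrite /sp; apply: le_trans (ler_norm _) _.
rewrite -(@ler_pXn2r _ 2) ?nnegrE ?mulr_ge0 ?sqrtr_ge0 //.
rewrite real_normK ?num_real // exprMn sqr_sqrtr ?addr_ge0 ?sqr_ge0 //.
apply: (@le_trans _ _ ((al ^+ 2 + be ^+ 2) * (u1 r ^+ 2 + u2 r ^+ 2))).
  have := sqr_ge0 (al * u2 r - be * u1 r); lra.
by rewrite ler_wpM2r // addr_ge0 ?sqr_ge0.
Qed.
End Admissible.

(** * Local optimality below the critical time *)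

Section Normalization.
Variables (R : realType) (c th0 psi sg del : R).

(* For e^{i th0} = cos th0 + i sin th0, the map (x, y) |-> (q1, q2) is the
   similarity that sends the reference circle to the unit circle run
   counterclockwise from the angle [del]; [area] is a primitive of
   q1 dq2 - q2 dq1 and (W1, W2) is a primitive of (|q|^2 - 1)/2 (dq1, dq2). *)
Definition nq1 (x y : R) := (c * x + sin th0) * sin psi - (c * y - cos th0) * cos psi.
Definition nq2 (x y : R) :=
  sg * ((c * x + sin th0) * cos psi + (c * y - cos th0) * sin psi).
Definition area (x y z : R) :=
  del + sg * (2 * c ^+ 2 * z + c * (sin th0 * y + cos th0 * x)).
Definition momx (x y z w : R) :=
  - (c ^+ 2 * w) + c * (sin th0 * (x * x / 2) - cos th0 * (x * y / 2 - z)).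
Definition momy (x y z v : R) :=
  c ^+ 2 * v + c * (sin th0 * (x * y / 2 + z) - cos th0 * (y * y / 2)).
Definition W1 (x y z v w : R) :=
  c * (sin psi * momx x y z w - cos psi * momy x y z v).
Definition W2 (x y z v w : R) :=
  sg * (c * (cos psi * momx x y z w + sin psi * momy x y z v)).

Hypotheses (c0 : c != 0) (sg2 : sg ^+ 2 = 1).

Let P2 : cos psi ^+ 2 = 1 - sin psi ^+ 2. Proof. exact: cs1. Qed.
Let H2 : cos th0 ^+ 2 = 1 - sin th0 ^+ 2. Proof. exact: cs1. Qed.

Lemma normal_norm x y : (nq1 x y ^+ 2 + nq2 x y ^+ 2 - 1) / 2 =
  c ^+ 2 * (x * x + y * y) / 2 + c * (sin th0 * x - cos th0 * y).
Proof.
have -> : nq1 x y ^+ 2 + nq2 x y ^+ 2 = (c * x + sin th0) ^+ 2 + (c * y - cos th0) ^+ 2.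
  rewrite /nq1 /nq2; move: (c * x + _) (c * y - _) => X Y.
  by rewrite exprMn sg2; ring: P2.
by field: H2.
Qed.

Section Along.
Variables (T : R) (x y z v w : R -> R) (t : R).
Hypotheses (lx : lip T t x) (ly : lip T t y)
  (hz : hd T x y t z (- (y t / 2)) (x t / 2))
  (hv : hd T x y t v 0 ((x t ^+ 2 + y t ^+ 2) / 2))
  (hw : hd T x y t w (- ((x t ^+ 2 + y t ^+ 2) / 2)) 0).
Let Q1 s := nq1 (x s) (y s).
Let Q2 s := nq2 (x s) (y s).
Let h := (Q1 t ^+ 2 + Q2 t ^+ 2 - 1) / 2.

(** The coefficients invert the similarity, so that dx and dy are expressed by dQ1 and dQ2. *)
Let rebase F p1 p2 : hd T x y t F p1 p2 ->
  hd T Q1 Q2 t F ((p1 * sin psi - p2 * cos psi) / c)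
                 (sg * (p1 * cos psi + p2 * sin psi) / c).
Proof.
move=> hF; apply: (hd_eq (hd_rebase (a11 := sin psi / c) (a12 := sg * cos psi / c)
  (a21 := - cos psi / c) (a22 := sg * sin psi / c) _ _ hF)).
- move=> s; rewrite /Q1 /Q2 /nq1 /nq2; by field: P2 sg2.
- move=> s; rewrite /Q1 /Q2 /nq1 /nq2; by field: P2 sg2.
- by field.
- by field.
Qed.

Lemma hd_normal : [/\ lip T t Q1, lip T t Q2,
  hd T Q1 Q2 t (fun s => area (x s) (y s) (z s)) (- Q2 t) (Q1 t),
  hd T Q1 Q2 t (fun s => W1 (x s) (y s) (z s) (v s) (w s)) h 0 &
  hd T Q1 Q2 t (fun s => W2 (x s) (y s) (z s) (v s) (w s)) 0 h].
Proof.
have hx := hd_q1 T x y t; have hy := hd_q2 T x y t.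
have [p [r hQ1]] : exists p r, hd T x y t Q1 p r.
  by do 2 eexists; rewrite /Q1 /nq1; repeat hd_step lx ly.
have [p' [r' hQ2]] : exists p r, hd T x y t Q2 p r.
  by do 2 eexists; rewrite /Q2 /nq2; repeat hd_step lx ly.
split.
- exact: lip_hd lx ly hQ1.
- exact: lip_hd lx ly hQ2.
- have H : hd T x y t (fun s => area (x s) (y s) (z s))
     (sg * (c * (cos th0 - c * y t))) (sg * (c * (sin th0 + c * x t))).
    rewrite /area; hd_auto lx ly; rewrite /=.
      by field.
    by field.
  apply: (hd_eq (rebase H)); rewrite /Q1 /Q2 /nq1 /nq2; by field: P2 sg2.
- have H : hd T x y t (fun s => W1 (x s) (y s) (z s) (v s) (w s))
     (h * (c * sin psi)) (- (h * (c * cos psi))).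
    rewrite /W1 /momx /momy /h normal_norm; hd_auto lx ly; rewrite /=.
      by field.
    by field.
  apply: (hd_eq (rebase H)); by field: P2 sg2.
- have H : hd T x y t (fun s => W2 (x s) (y s) (z s) (v s) (w s))
     (sg * (h * (c * cos psi))) (sg * (h * (c * sin psi))).
    rewrite /W2 /momx /momy /h normal_norm; hd_auto lx ly; rewrite /=.
      by field.
    by field.
  apply: (hd_eq (rebase H)); by field: P2 sg2.
Qed.
End Along.
End Normalization.

(** * Uniform closeness in the normalized coordinates *)

Section Close.
Variables (R : realType) (c th0 psi sg del : R).
Hypothesis sg1 : `|sg| = 1.

(** Turns the uniform neighbourhood into the smallness required by [calibration]. The constant
    depends on the reference point only through the bound B, so a single radius serves all times.
    The frame of the competitor is rotated by its own clock s', whence the bound on s' - s. *)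
Lemma normal_close (B : R) : 0 <= B -> exists2 K, 0 <= K &
  forall (e x y z v w x' y' z' v' w' s : R), 0 <= e -> e <= 1 ->
  [/\ `|x| <= B, `|y| <= B, `|z| <= B, `|v| <= B & `|w| <= B] ->
  [/\ `|x' - x| <= e, `|y' - y| <= e, `|z' - z| <= e, `|v' - v| <= e
    & `|w' - w| <= e] ->
  [/\ nq1 c th0 psi x y = cos s, nq2 c th0 psi sg x y = sin s,
      area c th0 sg del x y z = s, W1 c th0 psi x y z v w = 0 &
      W2 c th0 psi sg x y z v w = 0] ->
  let s' := area c th0 sg del x' y' z' in
  let q1 := nq1 c th0 psi x' y' in let q2 := nq2 c th0 psi sg x' y' in
  `|s' - s| <= K * e /\
  `|q1 * cos s' + q2 * sin s' - 1| + `|q2 * cos s' - q1 * sin s'| +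
  `|W1 c th0 psi x' y' z' v' w'| + `|W2 c th0 psi sg x' y' z' v' w'| <= K * e.
Proof.
move=> B0.
suff [K1 [K2 [K3 [K4 [K5 hK]]]]] : exists K1 K2 K3 K4 K5,
  forall (e x y z v w x' y' z' v' w' s : R), 0 <= e -> e <= 1 ->
  [/\ `|x| <= B, `|y| <= B, `|z| <= B, `|v| <= B & `|w| <= B] ->
  [/\ `|x' - x| <= e, `|y' - y| <= e, `|z' - z| <= e, `|v' - v| <= e
    & `|w' - w| <= e] ->
  [/\ nq1 c th0 psi x y = cos s, nq2 c th0 psi sg x y = sin s,
      area c th0 sg del x y z = s, W1 c th0 psi x y z v w = 0 &
      W2 c th0 psi sg x y z v w = 0] ->
  let s' := area c th0 sg del x' y' z' in
  let q1 := nq1 c th0 psi x' y' in let q2 := nq2 c th0 psi sg x' y' in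
  [/\ bigO e 1 K1 (s' - s), bigO e 1 K2 (q1 * cos s' + q2 * sin s' - 1),
      bigO e 1 K3 (q2 * cos s' - q1 * sin s'),
      bigO e 1 K4 (W1 c th0 psi x' y' z' v' w') &
      bigO e 1 K5 (W2 c th0 psi sg x' y' z' v' w')].
  exists (`|K1| + (`|K2| + `|K3| + `|K4| + `|K5|)); first by rewrite !addr_ge0.
  move=> e x y z v w x' y' z' v' w' s e0 e1 hB hd hr s' q1 q2.
  have := hK e x y z v w x' y' z' v' w' s e0 e1 hB hd hr.
  rewrite -/s' -/q1 -/q2; case.
  have up (K a : R) : bigO e 1 K a -> `|a| <= `|K| * e.
    by move=> [_ h]; apply: (le_trans h); rewrite expr1 ler_wpM2r // ler_norm.
  move=> /up h1 /up h2 /up h3 /up h4 /up h5.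
  have -> : (`|K1| + (`|K2| + `|K3| + `|K4| + `|K5|)) * e =
    `|K1| * e + (`|K2| * e + `|K3| * e + `|K4| * e + `|K5| * e) by ring.
  split; first by rewrite (le_trans h1) // lerDl !addr_ge0 // mulr_ge0.
  have h6 : 0 <= `|K1| * e by rewrite mulr_ge0.
  apply: (le_trans (lerD (lerD (lerD h2 h3) h4) h5)).
  by rewrite lerDr.
do 5 eexists; move=> e x y z v w x' y' z' v' w' s e0 e1 [bx by' bz bv bw]
  [dx dy dz dv dw] [r1 r2 r3 r4 r5] s' q1 q2.
have O1 d : `|d| <= e -> bigO e 1 1 d by move=> h; split=> //; rewrite mul1r expr1.
have OB d : `|d| <= B -> bigO e 0 B d by move=> h; split=> //; rewrite expr0 mulr1.
have Oc (k : R) : bigO e 0 `|k| k by split=> //; rewrite expr0 mulr1.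
have Ocos k : bigO e 0 1 (cos k) by split=> //; rewrite expr0 mulr1 cos_max.
have Osin k : bigO e 0 1 (sin k) by split=> //; rewrite expr0 mulr1 sin_max.
have Osg : bigO e 0 1 sg by split=> //; rewrite expr0 mulr1 sg1.
have Dx := O1 _ dx. have Dy := O1 _ dy. have Dz := O1 _ dz.
have Dv := O1 _ dv. have Dw := O1 _ dw.
have Bx := OB _ bx. have By := OB _ by'.
have Bx' := bigOD Bx (bigO_up e0 e1 (isT : (0 <= 1)%N) Dx).
have By' := bigOD By (bigO_up e0 e1 (isT : (0 <= 1)%N) Dy).
have hs := bigOM Osg (bigOD (bigOM (Oc (2 * c ^+ 2)) Dz)
   (bigOM (Oc c) (bigOD (bigOM (Osin th0) Dy) (bigOM (Ocos th0) Dx)))).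
have {}hs : bigO e 1 (1 * (`|2 * c ^+ 2| * 1 + `|c| * (1 * 1 + 1 * 1))) (s' - s).
  by move: hs; congr bigO; rewrite /s' -r3 /area; ring.
have hq1 := bigOM (Oc c) (bigOD (bigOM (Osin psi) Dx) (bigON (bigOM (Ocos psi) Dy))).
have hq2 := bigOM Osg (bigOM (Oc c) (bigOD (bigOM (Ocos psi) Dx) (bigOM (Osin psi) Dy))).
have {}hq1 : bigO e 1 (`|c| * (1 * 1 + 1 * 1)) (q1 - cos s).
  by move: hq1; congr bigO; rewrite /q1 -r1 /nq1; ring.
have {}hq2 : bigO e 1 (1 * (`|c| * (1 * 1 + 1 * 1))) (q2 - sin s).
  by move: hq2; congr bigO; rewrite /q2 -r2 /nq2; ring.
have hh := Oc (2^-1).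
have hX2 := bigOM hh (bigOD (bigOM Dx Bx') (bigOM Bx Dx)).
have hY2 := bigOM hh (bigOD (bigOM Dy By') (bigOM By Dy)).
have hXY := bigOM hh (bigOD (bigOM Dx By') (bigOM Bx Dy)).
have hMx := bigOD (bigON (bigOM (Oc (c ^+ 2)) Dw)) (bigOM (Oc c)
  (bigOD (bigOM (Osin th0) hX2) (bigON (bigOM (Ocos th0) (bigOD hXY (bigON Dz)))))).
have hMy := bigOD (bigOM (Oc (c ^+ 2)) Dv) (bigOM (Oc c)
  (bigOD (bigOM (Osin th0) (bigOD hXY Dz)) (bigON (bigOM (Ocos th0) hY2)))).
have hW1 := bigOM (Oc c) (bigOD (bigOM (Osin psi) hMx) (bigON (bigOM (Ocos psi) hMy))).
have hW2 := bigOM Osg (bigOM (Oc c) (bigOD (bigOM (Ocos psi) hMx) (bigOM (Osin psi) hMy))).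
have hcos : bigO e 1 (2^-1 * ((1 * (`|2 * c ^+ 2| * 1 + `|c| * (1 * 1 + 1 * 1))) *
   (1 * (`|2 * c ^+ 2| * 1 + `|c| * (1 * 1 + 1 * 1))))) (cos (s' - s) - 1).
  have h2 := bigO_up e0 e1 (isT : (1 <= 2)%N) (bigOM hs hs).
  have := bigOM hh h2; rewrite ger0_norm; last by lra.
  case=> k0 k; split=> //; apply: le_trans k.
  rewrite ler0_norm; last by rewrite subr_le0 cos_le1.
  have := cos_ge_quad (s' - s) => h3.
  rewrite ger0_norm; first by lra.
  by rewrite mulr_ge0 // -expr2 sqr_ge0.
have hsin : bigO e 1 (1 * (`|2 * c ^+ 2| * 1 + `|c| * (1 * 1 + 1 * 1))) (sin (s' - s)).
  by case: hs => k0 k; split=> //; apply: le_trans k; apply: norm_sin_le.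
split.
- exact: hs.
- have := bigOD (bigOD (bigOM hq1 (Ocos s')) (bigOM hq2 (Osin s'))) hcos.
  set F := (X in bigO _ _ _ X).
  have -> : F = q1 * cos s' + q2 * sin s' - 1 by rewrite /F cosB; ring.
  exact.
- have := bigOD (bigOD (bigOM hq2 (Ocos s')) (bigON (bigOM hq1 (Osin s')))) (bigON hsin).
  set F := (X in bigO _ _ _ X).
  have -> : F = q2 * cos s' - q1 * sin s' by rewrite /F sinB; ring.
  exact.
- move: hW1; set F := (X in bigO _ _ _ X).
  have -> : F = W1 c th0 psi x' y' z' v' w' - W1 c th0 psi x y z v w.
    by rewrite /F /W1 /momx /momy; field.
  by rewrite r4 subr0; exact.
- move: hW2; set F := (X in bigO _ _ _ X).
  have -> : F = W2 c th0 psi sg x' y' z' v' w' - W2 c th0 psi sg x y z v w.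
    by rewrite /F /W2 /momx /momy; field.
  by rewrite r5 subr0; exact.
Qed.
End Close.

(** * The reference extremal and its local optimality *)

Section Reference.
Variables (R : realType) (th0 c beta : R) (thf cf : R -> R) (g : curve R).
Hypotheses (c0 : c != 0) (ext : extremal th0 c 0 beta thf cf g).
Let x := cx g. Let y := cy g. Let z := cz g. Let v := cv g. Let w := cw g.

Lemma der0_const (f : R -> R) (s : R) : (forall s : R, is_derive s 1 f 0) -> f s = f 0.
Proof. by move=> D; apply: is_derive_0_is_cst. Qed.

Lemma ref_theta s : thf s = th0 + c * s.
Proof.
have [t0 c00 _ D] := ext.
have cE r : cf r = c.
  rewrite -c00; apply: der0_const => u; have [_ h _ _ _] := D u.
  by apply: (der_eq h); rewrite oppr0 mul0r.
have : thf s - c * s = thf 0 - c * 0.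
  apply: (@der0_const (fun s => thf s - c * s)) => u; have [h _ _ _ _] := D u.
  by der; rewrite cE; ring.
by rewrite t0; lra.
Qed.

Lemma ref_der s : let th := th0 + c * s in
  [/\ is_derive s 1 x (cos th), is_derive s 1 y (sin th),
      is_derive s 1 z (- (y s / 2) * cos th + x s / 2 * sin th),
      is_derive s 1 v ((x s ^+ 2 + y s ^+ 2) / 2 * sin th) &
      is_derive s 1 w (- ((x s ^+ 2 + y s ^+ 2) / 2) * cos th)].
Proof.
have [_ _ _ D] := ext; have [_ _ hx hy [hz hv hw]] := D s.
by rewrite -ref_theta.
Qed.

Lemma ref_init : [/\ x 0 = 0, y 0 = 0, z 0 = 0, v 0 = 0 & w 0 = 0].
Proof. by have [_ _ [h1 h2 h3 h4 h5] _] := ext. Qed.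

Lemma ref_x s : x s = (sin (th0 + c * s) - sin th0) / c.
Proof.
have [x0 _ _ _ _] := ref_init.
have : c * x s - sin (th0 + c * s) = c * x 0 - sin (th0 + c * 0).
  apply: (@der0_const (fun s => c * x s - sin (th0 + c * s))) => u.
  by have [h _ _ _ _] := ref_der u; der; ring.
rewrite x0 !mulr0 addr0 => e; apply: (mulfI c0).
by rewrite mulrCA mulfV // mulr1; lra.
Qed.

Lemma ref_y s : y s = (cos th0 - cos (th0 + c * s)) / c.
Proof.
have [_ y0 _ _ _] := ref_init.
have : c * y s + cos (th0 + c * s) = c * y 0 + cos (th0 + c * 0).
  apply: (@der0_const (fun s => c * y s + cos (th0 + c * s))) => u.
  by have [_ h _ _ _] := ref_der u; der; ring.
rewrite y0 !mulr0 addr0 => e; apply: (mulfI c0).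
by rewrite mulrCA mulfV // mulr1; lra.
Qed.

(** The choice of psi gives th0 + c s - psi = sg u, and the sign sg reflects the circle when c < 0.
    The moments are constant because their derivatives are multiples of |q|^2 - 1, which vanishes
    along the extremal. *)
Lemma ref_normal (del : R) s :
  let sg := Num.sg c in let psi := th0 - sg * del in let u := del + `|c| * s in
  [/\ nq1 c th0 psi (x s) (y s) = cos u, nq2 c th0 psi sg (x s) (y s) = sin u,
      area c th0 sg del (x s) (y s) (z s) = u,
      W1 c th0 psi (x s) (y s) (z s) (v s) (w s) = 0 &
      W2 c th0 psi sg (x s) (y s) (z s) (v s) (w s) = 0].
Proof.
move=> sg psi u.
have cE : c = sg * `|c| by rewrite -numEsg.
have sg2 : sg ^+ 2 = 1 by rewrite /sg sqr_sg c0.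
have X r : c * x r + sin th0 = sin (th0 + c * r) by rewrite ref_x; field.
have Y r : c * y r - cos th0 = - cos (th0 + c * r) by rewrite ref_y; field.
have thE : th0 + c * s - psi = sg * u by rewrite /psi /u mulrDr mulrA -cE; ring.
(* |q|^2 is unchanged by the rotation through psi, so [normal_norm] is taken at psi = 0, where the
   computation is shortest. *)
have N r : c ^+ 2 * (x r * x r + y r * y r) / 2 + c * (sin th0 * x r - cos th0 * y r) = 0.
  have <- := normal_norm c th0 0 sg2 (x r) (y r).
  rewrite /nq1 /nq2 X Y sin0 cos0 !mulr0 !mulr1 sub0r addr0 opprK.
  by rewrite exprMn sg2 mul1r cos2Dsin2 subrr mul0r.
have Mx r : momx c th0 (x r) (y r) (z r) (w r) = 0.
  transitivity (momx c th0 (x 0) (y 0) (z 0) (w 0)); last first.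
    by have [-> -> -> _ ->] := ref_init; rewrite /momx; ring.
  apply: (@der0_const (fun r => momx c th0 (x r) (y r) (z r) (w r))) => t.
  have [h1 h2 h3 h4 h5] := ref_der t; rewrite /momx; der; rewrite /=.
  transitivity (cos (th0 + c * t) * (c ^+ 2 * (x t * x t + y t * y t) / 2 +
      c * (sin th0 * x t - cos th0 * y t))); last by rewrite N mulr0.
  by field.
have My r : momy c th0 (x r) (y r) (z r) (v r) = 0.
  transitivity (momy c th0 (x 0) (y 0) (z 0) (v 0)); last first.
    by have [-> -> -> -> _] := ref_init; rewrite /momy; ring.
  apply: (@der0_const (fun r => momy c th0 (x r) (y r) (z r) (v r))) => t.
  have [h1 h2 h3 h4 h5] := ref_der t; rewrite /momy; der; rewrite /=.
  transitivity (sin (th0 + c * t) * (c ^+ 2 * (x t * x t + y t * y t) / 2 +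
      c * (sin th0 * x t - cos th0 * y t))); last by rewrite N mulr0.
  by field.
split.
- rewrite /nq1 X Y -(cos_sg u c0) -/sg -thE cosB; ring.
- rewrite /nq2 X Y -[RHS]mul1r -sg2 expr2 -mulrA -(sin_sg c u) -/sg -thE sinB; ring.
- rewrite -[LHS](subrK (`|c| * s)).
  suff -> : area c th0 sg del (x s) (y s) (z s) - `|c| * s =
    area c th0 sg del (x 0) (y 0) (z 0) - `|c| * 0.
    have [-> -> -> _ _] := ref_init; rewrite /area /u; ring.
  apply: (@der0_const (fun r => area c th0 sg del (x r) (y r) (z r) - `|c| * r)) => t.
  have [h1 h2 h3 h4 h5] := ref_der t; rewrite /area; der; rewrite /=.
  have e : cos (th0 + c * t) ^+ 2 = 1 - sin (th0 + c * t) ^+ 2 by apply: cs1.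
  have -> : `|c| = sg * c by rewrite [in RHS]cE mulrA -expr2 sg2 mul1r.
  by rewrite ref_x ref_y; field: e.
- by rewrite /W1 Mx My; ring.
- by rewrite /W2 Mx My; ring.
Qed.

Lemma ref_bounded (T : R) : 0 <= T -> exists2 B, 0 <= B & forall s, 0 <= s <= T ->
  [/\ `|x s| <= B, `|y s| <= B, `|z s| <= B, `|v s| <= B & `|w s| <= B].
Proof.
move=> T0.
have b (F : R -> R) : (forall s : R, exists l, is_derive s 1 F l) -> exists B, forall s, 0 <= s <= T -> `|F s| <= B.
  by move=> D; have [_ //] := bmeas_der (f := F) (fun s (_ : 0 <= s <= T) => D s).
have [B1 h1] := b x (fun s => let: And5 h _ _ _ _ := ref_der s in ex_intro _ _ h).
have [B2 h2] := b y (fun s => let: And5 _ h _ _ _ := ref_der s in ex_intro _ _ h).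
have [B3 h3] := b z (fun s => let: And5 _ _ h _ _ := ref_der s in ex_intro _ _ h).
have [B4 h4] := b v (fun s => let: And5 _ _ _ h _ := ref_der s in ex_intro _ _ h).
have [B5 h5] := b w (fun s => let: And5 _ _ _ _ h := ref_der s in ex_intro _ _ h).
exists (`|B1| + `|B2| + `|B3| + `|B4| + `|B5|); first by rewrite !addr_ge0.
move=> s sT; have q (F : R -> R) (B : R) : `|F s| <= B -> `|F s| <= `|B|.
  by move/le_trans; apply; apply: ler_norm.
have := q _ _ (h1 s sT); have := q _ _ (h2 s sT); have := q _ _ (h3 s sT).
have := q _ _ (h4 s sT); have := q _ _ (h5 s sT).
have := normr_ge0 B1; have := normr_ge0 B2; have := normr_ge0 B3;
  have := normr_ge0 B4; have := normr_ge0 B5.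
by move=> *; split; lra.
Qed.

Let u1 r := cos (thf r). Let u2 r := sin (thf r).

Lemma ref_admissible (T : R) : admissible T g u1 u2.
Proof.
have ct (F : R -> R) a b : (forall s : R, exists l, is_derive s 1 F l) -> {within seg a b, continuous F}.
  move=> D; apply: continuous_in_subspaceT => s _; have [l] := D s; exact: der_cont.
have uE : u1 = (fun r => cos (th0 + c * r)) /\ u2 = (fun r => sin (th0 + c * r)).
  by split; apply/funext => r; rewrite /u1 /u2 ref_theta.
have d1 (s : R) : exists l, is_derive s 1 u1 l by rewrite uE.1; eexists; repeat der_step.
have d2 (s : R) : exists l, is_derive s 1 u2 l by rewrite uE.2; eexists; repeat der_step.
split; first by case: (bmeas_der (f := u1) (fun s (_ : 0 <= s <= T) => d1 s)).
split; first by case: (bmeas_der (f := u2) (fun s (_ : 0 <= s <= T) => d2 s)).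
split; first by exists 1 => s _; rewrite cos_max sin_max.
move=> s /andP[s0 _].
have P (F f : R -> R) : (forall r : R, is_derive r 1 F (f r)) ->
    (forall r : R, exists l, is_derive r 1 f l) -> F s = F 0 + Int 0 s f.
  move=> D Df; rewrite (@Int_FTC R 0 s f F) //; first by ring.
  exact: ct.
have D r := ref_der r.
have hx (r : R) : is_derive r 1 x (u1 r) by have [h _ _ _ _] := D r; rewrite uE.1.
have hy (r : R) : is_derive r 1 y (u2 r) by have [_ h _ _ _] := D r; rewrite uE.2.
have hz (r : R) : is_derive r 1 z (- (y r / 2) * u1 r + x r / 2 * u2 r).
  by have [_ _ h _ _] := D r; rewrite uE.1 uE.2.
have hv (r : R) : is_derive r 1 v ((x r ^+ 2 + y r ^+ 2) / 2 * u2 r).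
  by have [_ _ _ h _] := D r; rewrite uE.2.
have hw (r : R) : is_derive r 1 w (- ((x r ^+ 2 + y r ^+ 2) / 2) * u1 r).
  by have [_ _ _ _ h] := D r; rewrite uE.1.
have e1 r := projT2 (cid (d1 r)). have e2 r := projT2 (cid (d2 r)).
by split; apply: P => // r; have k1 := hx r; have k2 := hy r; have k3 := e1 r;
  have k4 := e2 r; eexists; repeat der_step.
Qed.

Lemma ref_length (T : R) : 0 <= T -> sr_length T u1 u2 = T.
Proof.
move=> T0; rewrite /sr_length -/(Int 0 T _) (@Int_eq _ _ _ _ (fun=> 1)).
  by rewrite Int_cst // subr0 mul1r.
by move=> s _; rewrite /u1 /u2 cos2Dsin2 sqrtr1.
Qed.

Lemma local_min (T : R) : 0 < T -> T < 4 / `|c| * p1V0 R -> locally_optimal T g u1 u2.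
Proof.
have window (d a S b : R) : 0 <= d -> - (d / 2) <= S - (d + a) <= d / 2 ->
  0 <= a -> a <= b -> d / 2 <= S <= b + 2 * d by lra.
move=> T0 Tp; split; first exact: ref_admissible.
have k0 : 0 < `|c| by rewrite normr_gt0.
have kT : `|c| * T < 4 * p1V0 R.
  by move: Tp; rewrite mulrAC ltr_pdivlMr // mulrC.
(* X(0) = 0, so the clock is started at an angle del > 0, chosen with room
   left before the conjugate angle 4 p1V0. *)
pose del := (4 * p1V0 R - `|c| * T) / 3.
have del0 : 0 < del by rewrite /del; lra.
have kT0 : 0 < `|c| * T by rewrite mulr_gt0.
pose lo := del / 2; pose hi := `|c| * T + 2 * del.
have [lo0 lohi hip] : [/\ 0 < lo, lo <= hi & hi < 4 * p1V0 R].
  by split; rewrite /lo /hi; [lra|lra|rewrite /del; lra].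
have [m m0 cal] := calibration lo0 lohi hip.
have [B B0 hB] := ref_bounded (ltW T0).
pose sg := Num.sg c; pose psi := th0 - sg * del.
have sg1 : `|sg| = 1 by rewrite normr_sg c0.
have sg2 : sg ^+ 2 = 1 by rewrite /sg sqr_sg c0.
have [K K0 cls] := normal_close c th0 psi del sg1 B0.
(* K eps <= m is the smallness for [calibration]; K eps <= lo = del / 2 keeps the clock of the
   competitor within del / 2 of del + |c| t, hence in [lo, hi]. *)
pose eps := Num.min 1 (Num.min (m / (1 + K)) (lo / (1 + K))).
have K1 : 0 < 1 + K by lra.
have eps0 : 0 < eps by rewrite !lt_min ltr01 /=; apply/andP; split; apply: divr_gt0.
exists eps; split => // g' w1 w2 adm h0 hT hcl.
have T0' := ltW T0.
rewrite ref_length //.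
pose q1 t := nq1 c th0 psi (cx g' t) (cy g' t).
pose q2 t := nq2 c th0 psi sg (cx g' t) (cy g' t).
pose S t := area c th0 sg del (cx g' t) (cy g' t) (cz g' t).
pose V1 t := W1 c th0 psi (cx g' t) (cy g' t) (cz g' t) (cv g' t) (cw g' t).
pose V2 t := W2 c th0 psi sg (cx g' t) (cy g' t) (cz g' t) (cv g' t) (cw g' t).
pose l t := `|c| * Int 0 t (fun r => Num.sqrt (w1 r ^+ 2 + w2 r ^+ 2)).
have ends t : same_point g' g t t -> [/\ q1 t * cos (S t) + q2 t * sin (S t) - 1 = 0,
   q2 t * cos (S t) - q1 t * sin (S t) = 0, V1 t = 0, V2 t = 0 & S t = del + `|c| * t].
  move=> [ex ey ez ev ew]; have [r1 r2 r3 r4 r5] := ref_normal del t.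
  rewrite /q1 /q2 /V1 /V2 /S ex ey ez ev ew r1 r2 r3 r4 r5; split => //; last by ring.
  by rewrite -!expr2 cos2Dsin2 subrr.
have [a0 b0 c10 c20 S0] := ends 0 h0. have [aT bT c1T c2T ST] := ends T hT.
have := cal T q1 q2 S V1 V2 l T0' _ _ _ (And4 a0 b0 c10 c20) (And4 aT bT c1T c2T).
rewrite S0 ST mulr0 /l Int0 mulr0 subr0.
have -> : del + `|c| * T - (del + 0) = `|c| * T by ring.
rewrite ler_pM2l //; apply.
- move=> s t p1 p2 s0 st tT p12.
  (* The two coefficients are the pull-back of (p1, p2) under the similarity, so their norm is
     multiplied by |c|. *)
  have := @adm_length_ge R T g' w1 w2 adm s t `|c|
    (c * (p1 * sin psi + sg * p2 * cos psi)) (c * (- p1 * cos psi + sg * p2 * sin psi)) s0 st tT (ltW k0).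
  have P2 := cs1 psi.
  have -> : (c * (p1 * sin psi + sg * p2 * cos psi)) ^+ 2 +
    (c * (- p1 * cos psi + sg * p2 * sin psi)) ^+ 2 = `|c| ^+ 2 * (p1 ^+ 2 + p2 ^+ 2).
    by rewrite real_normK ?num_real //; ring: P2 sg2.
  rewrite ler_piMr ?sqr_ge0 // => /(_ isT); apply: le_trans.
  by rewrite /q1 /q2 /nq1 /nq2 le_eqVlt; apply/orP; left; apply/eqP; ring.
- move=> t tT; have [lx ly] := adm_lip adm tT.
  have [hz hv hw] := adm_hd adm tT.
  exact: hd_normal.
- move=> t tT; have tT2 := tT; have [ex ey ez ev ew] := hcl t tT.
  have e1 : eps <= 1 by rewrite /eps ge_min lexx.
  have D (a b : R) : `|a - b| < eps -> `|b - a| <= eps by rewrite distrC => /ltW.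
  have := cls eps (x t) (y t) (z t) (v t) (w t) (cx g' t) (cy g' t) (cz g' t) (cv g' t)
    (cw g' t) (del + `|c| * t) (ltW eps0) e1 (hB t tT)
    (And5 (D _ _ ex) (D _ _ ey) (D _ _ ez) (D _ _ ev) (D _ _ ew)) (ref_normal del t).
  rewrite -/(S t) -/(q1 t) -/(q2 t) -/(V1 t) -/(V2 t) => -[hS hn].
  have Km : K * eps <= m.
    apply: (@le_trans _ _ (K * (m / (1 + K)))); last by apply: mul_div1p_le => //; exact: ltW.
    by apply: ler_wpM2l => //; rewrite /eps !ge_min lexx orbT.
  have Kl : K * eps <= lo.
    apply: (@le_trans _ _ (K * (lo / (1 + K)))); last by apply: mul_div1p_le => //; exact: ltW.
    by apply: ler_wpM2l => //; rewrite /eps !ge_min lexx !orbT.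
  have := le_trans hS Kl; rewrite ler_norml => hS'.
  have /andP[t0 tT1] := tT.
  have kt : `|c| * t <= `|c| * T by apply: ler_wpM2l.
  have kt0 : 0 <= `|c| * t by apply: mulr_ge0.
  split; last exact: le_trans hn Km.
  exact: window (ltW del0) hS' kt0 kt.
Qed.
End Reference.

(** * Competitors beyond the critical time *)

Section Variation.
Variable R : realType.

Definition primitive_gap (t : R) (f : R -> R) (q : R) :=
  exists2 F : R -> R, (forall s : R, is_derive s 1 F (f s)) & F t - F (- t) = q.

(* eta is the odd combination of sin s, s cos s and s with eta t = 0 and
   integral of eta sin equal to 0; its second variation q has the sign of
   oddD t.  The
   even function th leaves the two moments fixed and has positive integral p,
   so that it can restore the area at second order. *)
Lemma variation (t : R) : pi < t < 3 / 2 * pi -> oddD t < 0 ->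
  exists eta deta th dth : R -> R, exists q p : R,
  [/\ forall s : R, is_derive s 1 eta (deta s), forall s : R, is_derive s 1 th (dth s),
      (forall s : R, exists l : R, is_derive s 1 deta l) /\
      (forall s : R, exists l : R, is_derive s 1 dth l),
      [/\ eta t = 0, eta (- t) = 0, th t = 0 & th (- t) = 0] &
  [/\ primitive_gap t eta 0, primitive_gap t (fun s => eta s * sin s) 0 &
      primitive_gap t (fun s => eta s * cos s) 0] /\
  [/\ primitive_gap t (fun s => deta s ^+ 2 - eta s ^+ 2) q, q < 0,
      primitive_gap t th p, 0 < p &
      primitive_gap t (fun s => th s * sin s) 0 /\
      primitive_gap t (fun s => th s * cos s) 0]].
Proof.
move=> tp W0.
have [C0 S0] := cos_sin_lt0 tp.
have p28 := @pi_ge R.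
have t28 : 14 / 5 < t by lra.
have cs := cs1 t.
set S := sin t in S0 cs; set C := cos t in C0 cs.
have sN : sin (- t) = - S by rewrite sinN.
have cN : cos (- t) = C by rewrite cosN.
(* [s2], [sc] and [I3] are the integrals over [0, t] of sin^2, s sin cos and s sin. Then (a1, a2,
   a3) is the cross product of (S, t C, t) and (s2, sc, I3), and orthogonality to these vectors says
   that eta vanishes at t and has zero moment against sin. *)
pose s2 := (t - S * C) / 2; pose sc := (- t * (1 - 2 * S ^+ 2) + S * C) / 4.
pose I3 := S - t * C.
pose a1 := t * C * I3 - t * sc; pose a2 := t * s2 - S * I3.
pose a3 := S * sc - t * C * s2.
pose eta s := a1 * sin s + a2 * (s * cos s) + a3 * s.
pose deta s := a1 * cos s + a2 * (cos s - s * sin s) + a3.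
(* [J1] and [J2] are the integrals over [0, t] of (cos s - C) cos s and (cos^2 s - C^2) cos s, so
   the moment of [th] against cos cancels; its moment against sin vanishes by parity. *)
pose J1 := (t - S * C) / 2; pose J2 := 2 / 3 * S ^+ 3.
pose th s := J1 * (cos s ^+ 2 - C ^+ 2) - J2 * (cos s - C).
pose dth s := - (2 * J1 * cos s * sin s) + J2 * sin s.
pose E1 s := a1 * ((s - sin s * cos s) / 2)
  + a2 * (s * sin s ^+ 2 / 2 - (s - sin s * cos s) / 4) + a3 * (sin s - s * cos s).
pose E2 s := a1 * (sin s - s * cos s) + a2 * (s ^+ 2 * sin s + 2 * s * cos s - 2 * sin s)
  + a3 * s ^+ 3 / 3.
have dE1 (s : R) : is_derive s 1 E1 (eta s * sin s).
  rewrite /E1; der; rewrite /= /eta; have e := @cs1 R s; by field: e.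
have dE2 (s : R) : is_derive s 1 E2 (s * eta s).
  by rewrite /E2; der; rewrite /= /eta; field.
have deta_ (s : R) : is_derive s 1 eta (deta s).
  by rewrite /eta; der; rewrite /= /deta; ring.
have dth_ (s : R) : is_derive s 1 th (dth s).
  by rewrite /th; der; rewrite /= /dth; ring.
have ddeta (s : R) : is_derive s 1 deta (- a1 * sin s + a2 * (- 2 * sin s - s * cos s)).
  by rewrite /deta; der; rewrite /=; ring.
have E1t : E1 t - E1 (- t) = 0.
  rewrite /E1 sN cN -/S -/C /a1 /a2 /a3 /s2 /sc /I3; by field: cs.
(* Since eta'' + eta = - 2 a2 sin s + a3 s and eta has zero moment against sin, integration by parts
   gives q = - a3 times the integral of s eta over [- t, t], that is, - 2 a3 E2 t. With a3 = oddD t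
   / 4 and E2 t < 0, q is negative. *)
exists eta, deta, th, dth, (- 2 * a3 * E2 t), (2 * (J1 * ((t + S * C) / 2 - C ^+ 2 * t) - J2 * (S - C * t))).
have sk : S * C <= 1 / 2 by have := sqr_ge0 (S - C); lra.
have sk0 : 0 < S * C by rewrite nmulr_rgt0.
have S21 : S ^+ 2 <= 1 by have := sqr_ge0 C; lra.
have a3E : a3 = oddD t / 4.
  by rewrite /a3 /sc /s2 /oddD -/S -/C; field: cs.
have a30 : a3 < 0 by rewrite a3E; lra.
(* E2 t is the integral of s eta over [0, t]. The term with a2 dominates: [i2] bounds it above by a
   negative quantity of order t^4 |S|, while the a1 term is at most 3/4 t^2 |S| by [i1]; for t >
   14/5 the former wins ([i4]). *)
have E2neg : E2 t < 0.
  have -> : E2 t = a1 * I3 + a2 * (t ^+ 2 * S + 2 * t * C - 2 * S) + a3 * t ^+ 3 / 3.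
    by rewrite /E2 /I3 -/S -/C; ring.
  have a1E : a1 = t * (3 / 4 * (S * C) - t * (3 / 4 - S ^+ 2 / 2)).
    by rewrite /a1 /I3 /sc; field: cs.
  have a10 : a1 <= 0 by rewrite a1E pmulr_rle0; [nra|lra].
  have a1l : - (3 / 4 * t ^+ 2) <= a1.
    rewrite a1E; have : 0 <= t * (3 / 4 * (S * C) + t * (S ^+ 2 / 2)); last by lra.
    by apply: mulr_ge0; [lra|have := mulr_ge0 (_ : 0 <= t) (sqr_ge0 S); lra].
  have a2E : a2 = t ^+ 2 / 2 + t * (S * C) / 2 - S ^+ 2.
    by rewrite /a2 /s2 /I3; field.
  have tt : (14 / 5) ^+ 2 < t ^+ 2 by rewrite ltrXn2r ?nnegrE //; lra.
  have tsc : 0 < t * (S * C) by rewrite mulr_gt0 //; lra.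
  have a2l : t ^+ 2 / 2 - 1 <= a2 by rewrite a2E; lra.
  have tC : t * C < 0 by rewrite pmulr_rlt0 //; lra.
  have i1 : a1 * I3 <= 3 / 4 * t ^+ 2 * (- S).
    have [h|h] := leP 0 I3.
      have : a1 * I3 <= 0 by rewrite mulr_le0_ge0.
      move/le_trans; apply; clear -S0.
      by rewrite -mulrA mulr_ge0 // mulr_ge0 ?sqr_ge0 //; lra.
    have h' : - I3 <= - S by rewrite /I3; lra.
    by rewrite -mulrNN; apply: ler_pM => //; clear -h h' a10 a1l; lra.
  have i2 : a2 * (t ^+ 2 * S + 2 * t * C - 2 * S) <= - ((t ^+ 2 / 2 - 1) * ((t ^+ 2 - 2) * (- S))).
    rewrite -lerN2 opprK -mulrN; clear -S0 tt tC a2l; apply: ler_pM => //; [lra| |lra].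
    by apply: mulr_ge0; lra.
  have i3 : a3 * t ^+ 3 / 3 < 0.
    by clear -a30 t28; rewrite pmulr_llt0 // nmulr_rlt0 // exprn_gt0 //; lra.
  have i4 : 3 / 4 * t ^+ 2 * (- S) <= (t ^+ 2 / 2 - 1) * ((t ^+ 2 - 2) * (- S)).
    by clear -S0 tt; rewrite mulrA; apply: ler_wpM2r; [lra|nra].
  lra.
split => //.
- split=> s; first by eexists; apply: ddeta.
  by eexists; rewrite /dth; repeat der_step.
- rewrite /eta /th sN cN -/S -/C /a1 /a2 /a3; split; by ring.
split.
  split.
  - exists (fun s => - a1 * cos s + a2 * (s * sin s + cos s) + a3 * s ^+ 2 / 2).
      by move=> s; der; rewrite /= /eta; field.
    by rewrite sN cN -/S -/C; field.
  - by exists E1.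
  - exists (fun s => a1 * sin s ^+ 2 / 2 + a2 * (s ^+ 2 / 4 + s * sin s * cos s / 2 - sin s ^+ 2 / 4)
      + a3 * (s * sin s + cos s)).
      move=> s; der; rewrite /= /eta; have e := @cs1 R s; by field: e.
    by rewrite sN cN -/S -/C; field.
split.
- exists (fun s => eta s * deta s + 2 * a2 * E1 s - a3 * E2 s).
    move=> s; have h1 := deta_ s; have h2 := ddeta s; have h3 := dE1 s; have h4 := dE2 s.
    by der; rewrite /eta /deta; ring.
  have eN : E1 (- t) = E1 t by lra.
  have e2N : E2 (- t) = - E2 t by rewrite /E2 sN cN -/S -/C; ring.
  rewrite eN e2N.
  have -> : eta t = 0 by rewrite /eta -/S -/C /a1 /a2 /a3; ring.
  have -> : eta (- t) = 0 by rewrite /eta sN cN -/S -/C /a1 /a2 /a3; ring.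
  ring.
- by have : 0 < a3 * E2 t; [rewrite nmulr_rgt0|lra].
- exists (fun s => J1 * ((s + sin s * cos s) / 2 - C ^+ 2 * s) - J2 * (sin s - C * s)).
    move=> s; der; rewrite /= /th; have e := @cs1 R s; by field: e.
  by rewrite sN cN -/S -/C; field.
(* oddD t < 0 reads t |S| > (2 t^2 - S^2) |C|, which for t > 14/5 forces |cos t| to be small. The J1
   term of p then exceeds 23/20 times 5/4, against at most 2/3 for the J2 term. *)
- have hk : 26 / 5 * (- C) < - S.
    have : t * (- S) > (2 * t ^+ 2 - S ^+ 2) * (- C).
      by move: W0; rewrite /oddD -/S -/C; lra.
    have h1 : t * (26 / 5) <= 2 * t ^+ 2 - S ^+ 2 by nra.
    have h2 : t * (26 / 5) * (- C) <= (2 * t ^+ 2 - S ^+ 2) * (- C).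
      by apply: ler_wpM2r; lra.
    move=> h3; have : t * (26 / 5 * (- C)) < t * (- S) by lra.
    by rewrite ltr_pM2l //; lra.
  have C2 : C ^+ 2 <= 1 / 26 by nra.
  have J1l : 23 / 20 <= J1 by rewrite /J1; lra.
  have K1 : 5 / 4 <= (t + S * C) / 2 - C ^+ 2 * t by nra.
  have P1 : 23 / 20 * (5 / 4) <= J1 * ((t + S * C) / 2 - C ^+ 2 * t).
    by apply: ler_pM => //; lra.
  have J2u : J2 * (S - C * t) <= 2 / 3.
    rewrite /J2; have -> : 2 / 3 * S ^+ 3 * (S - C * t) =
      2 / 3 * (S ^+ 2 * S ^+ 2) - 2 / 3 * (S ^+ 2 * (S * C)) * t by ring.
    have : S ^+ 2 * S ^+ 2 <= 1 by have := sqr_ge0 S; nra.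
    have : 0 <= S ^+ 2 * (S * C) * t.
      apply: mulr_ge0; last by lra.
      by apply: mulr_ge0; [exact: sqr_ge0|exact: ltW].
    lra.
  lra.
split.
- exists (fun s => J1 * (- cos s ^+ 3 / 3 + C ^+ 2 * cos s) - J2 * (sin s ^+ 2 / 2 + C * cos s)).
    move=> s; der; rewrite /= /th; by field.
  by rewrite sN cN -/S -/C; field.
- exists (fun s => J1 * (sin s - sin s ^+ 3 / 3 - C ^+ 2 * sin s) - J2 * ((s + sin s * cos s) / 2 - C * sin s)).
    move=> s; der; rewrite /= /th; have e := @cs1 R s; by field: e.
  by rewrite sN cN -/S -/C /J1 /J2; field: cs.
Qed.
End Variation.

(** * Restriction of local optimality to shorter intervals *)

Section Restriction.
Variables (R : realType) (t' t : R).
Hypotheses (t'0 : 0 <= t') (t't : t' <= t).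

Definition glue (f f0 : R -> R) (r : R) := if r <= t' then f r else f0 r.

(** The left end is excluded because at t' a glued function takes the value of its first piece,
    which need not agree with the second. *)
Lemma Int_eq_oc a b (f f0 : R -> R) : bmeas a b f -> bmeas a b f0 ->
  (forall s, a < s <= b -> f s = f0 s) -> Int a b f = Int a b f0.
Proof.
move=> /bmeas_int hf /bmeas_int hf0 e; rewrite /Int !segE.
have oc k : (@leb R).-integrable `[a, b]%classic (EFin \o k) ->
    (@leb R).-integrable `]a, b]%classic (EFin \o k).
  by move=> hk; apply: integrableS hk => //; exact: subset_itv_oc_cc.
rewrite -[LHS]Rintegral_itv_obnd_cbnd; last exact: oc.
rewrite -[RHS]Rintegral_itv_obnd_cbnd; last exact: oc.
by apply: eq_Rintegral => s; rewrite inE /= in_itv /= => /e.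
Qed.

Lemma bmeas_glue f f0 : bmeas 0 t' f -> bmeas 0 t f0 -> bmeas 0 t (glue f f0).
Proof.
have p0 := t'0; have pt := t't.
move=> [mf [M hM]] [mf0 [M0 hM0]]; split; last first.
  exists (`|M| + `|M0|) => s hs; rewrite /glue; case: ifPn => [st|].
    apply: (le_trans (hM _ _)); first by lra.
    by apply: (le_trans (ler_norm _)); rewrite lerDl.
  move=> _; apply: (le_trans (hM0 _ hs)).
  by apply: (le_trans (ler_norm _)); rewrite lerDr.
have -> : seg 0 t = `[0, t']%classic `|` `]t', t]%classic.
  rewrite segE; apply/seteqP; split => s /=; rewrite !in_itv /=.
    by move=> h; have [h1|h1] := leP s t'; [left|right]; lra.
  move=> [/andP[a b]|/andP[a b]]; first by rewrite a (le_trans b t't).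
  by rewrite b (le_trans t'0 (ltW a)).
apply/measurable_funU => //; split.
  rewrite segE in mf; apply: eq_measurable_fun mf => s.
  by rewrite inE /= in_itv /= /glue => /andP[_ ->].
have m2 : measurable_fun `]t', t]%classic f0.
  rewrite segE in mf0; apply: measurable_funS mf0 => //.
  move=> s /=; rewrite !in_itv /= => /andP[a ->].
  by rewrite (le_trans t'0 (ltW a)).
apply: eq_measurable_fun m2 => s.
by rewrite inE /= in_itv /= /glue => /andP[h _]; rewrite leNgt h.
Qed.

Lemma glue_primitive (f f0 F F0 : R -> R) : bmeas 0 t' f -> bmeas 0 t f0 ->
  (forall s, 0 <= s <= t' -> F s = F 0 + Int 0 s f) ->
  (forall s, 0 <= s <= t -> F0 s = F0 0 + Int 0 s f0) -> F t' = F0 t' ->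
  forall s, 0 <= s <= t -> glue F F0 s = glue F F0 0 + Int 0 s (glue f f0).
Proof.
have p0 := t'0; have pt := t't; move=> bf bf0 hF hF0 e s sT; have bg := bmeas_glue bf bf0.
rewrite {2}/glue t'0 {1}/glue; case: ifPn => [st|].
  rewrite hF; last by lra.
  by congr (_ + _); apply: Int_eq => r /andP[_ rs]; rewrite /glue (le_trans rs st).
rewrite -ltNge => st.
have b0s : bmeas 0 s f0 by apply: bmeasS bf0; lra.
rewrite (@Int_split R 0 s t') //; [|exact: ltW|by apply: bmeasS bg; lra].
have -> : Int 0 t' (glue f f0) = Int 0 t' f.
  by apply: Int_eq => r /andP[_ rt]; rewrite /glue rt.
have -> : Int t' s (glue f f0) = Int t' s f0.
  apply: Int_eq_oc; [apply: bmeasS bg; lra|apply: bmeasS bf0; lra|].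
  by move=> r /andP[tr _]; rewrite /glue leNgt tr.
rewrite addrA -(hF t'); last by lra.
rewrite e (hF0 s sT) (hF0 t'); last by lra.
by rewrite (@Int_split R 0 s t') //; [ring|exact: ltW].
Qed.

Lemma adm_integrands (T : R) g (u1 u2 : R -> R) : 0 <= T -> admissible T g u1 u2 ->
  [/\ bmeas 0 T (fun r => - (cy g r / 2) * u1 r + cx g r / 2 * u2 r),
      bmeas 0 T (fun r => (cx g r ^+ 2 + cy g r ^+ 2) / 2 * u2 r) &
      bmeas 0 T (fun r => - ((cx g r ^+ 2 + cy g r ^+ 2) / 2) * u1 r)].
Proof.
move=> T0 adm; have [b1 b2] := adm_bmeas adm.
have bx : bmeas 0 T (cx g).
  by apply: bmeas_cont; apply: lip_within => s /(adm_lip adm)[].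
have by' : bmeas 0 T (cy g).
  by apply: bmeas_cont; apply: lip_within => s /(adm_lip adm)[].
have bh f : bmeas 0 T f -> bmeas 0 T (fun r => f r / 2).
  by move=> bf; apply: bmeasM bf (bmeas_cst _ _ _).
have br : bmeas 0 T (fun r => (cx g r ^+ 2 + cy g r ^+ 2) / 2).
  by apply: bh; apply: bmeasD; apply: bmeasM.
split.
- apply: bmeasD; apply: bmeasM => //; last exact: bh.
  by apply: bmeasN; apply: bh.
- exact: bmeasM.
- by apply: bmeasM => //; apply: bmeasN.
Qed.

(** A competitor on [0, t'] continued by the original curve competes on [0, t]; the common tail
    cancels from the two lengths. *)
Lemma locally_optimal_restrict g (u1 u2 : R -> R) :
  locally_optimal t g u1 u2 -> locally_optimal t' g u1 u2.
Proof.
have p0 := t'0; have pt := t't; have t0 : 0 <= t by lra.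
have T0 : 0 <= t' <= t' by rewrite t'0 lexx.
move=> [adm [eps [eps0 opt]]].
have adm' : admissible t' g u1 u2.
  have [m1 [m2 [[M hM] h]]] := adm; have [b1 b2] := adm_bmeas adm.
  split; first by case: (bmeasS (lexx 0) t't b1).
  split; first by case: (bmeasS (lexx 0) t't b2).
  split; first by exists M => s hs; apply: hM; lra.
  by move=> s hs; apply: h; lra.
split => //; exists eps; split => // g' w1 w2 admg' e0 et close.
have [b1 b2] := adm_bmeas adm; have [b1' b2'] := adm_bmeas admg'.
pose g2 := Curve (glue (cx g') (cx g)) (glue (cy g') (cy g)) (glue (cz g') (cz g))
  (glue (cv g') (cv g)) (glue (cw g') (cw g)).
pose v1 := glue w1 u1; pose v2 := glue w2 u2.
have [ex ey ez ev ew] := et.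
have [_ [_ [[M hM] h]]] := adm; have [_ [_ [[M' hM'] h']]] := admg'.
have [bz bv bw] := adm_integrands t0 adm.
have [bz' bv' bw'] := adm_integrands t'0 admg'.
have bv1 := bmeas_glue b1' b1; have bv2 := bmeas_glue b2' b2.
have adm2 : admissible t g2 v1 v2.
  split; first by case: bv1.
  split; first by case: bv2.
  split.
    have [K1 k1] := bv1.2; have [K2 k2] := bv2.2; exists (`|K1| + `|K2|) => s hs.
    split.
      by apply: (le_trans (k1 s hs)); apply: (le_trans (ler_norm _)); rewrite lerDl.
    by apply: (le_trans (k2 s hs)); apply: (le_trans (ler_norm _)); rewrite lerDr.
  move=> s hs; split => /=.
  - by apply: (glue_primitive b1' b1) => // r; [case/h'|case/h].
  - by apply: (glue_primitive b2' b2) => // r; [case/h'|case/h].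
  - rewrite (glue_primitive bz' bz _ _ ez hs); [|by move=> r; case/h'|by move=> r; case/h].
    by congr (_ + _); apply: Int_eq => r _; rewrite /v1 /v2 /glue; case: ifP.
  - rewrite (glue_primitive bv' bv _ _ ev hs); [|by move=> r; case/h'|by move=> r; case/h].
    by congr (_ + _); apply: Int_eq => r _; rewrite /v2 /glue; case: ifP.
  - rewrite (glue_primitive bw' bw _ _ ew hs); [|by move=> r; case/h'|by move=> r; case/h].
    by congr (_ + _); apply: Int_eq => r _; rewrite /v1 /glue; case: ifP.
have := opt g2 v1 v2 adm2.
have glue0 (f f0 : R -> R) : glue f f0 0 = f 0 by rewrite /glue t'0.
have [h1 h2 h3 h4 h5] := e0.
rewrite /same_point /= !glue0 => /(_ (And5 h1 h2 h3 h4 h5)).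
have glueT (f f0 : R -> R) : f t' = f0 t' -> glue f f0 t = f0 t.
  rewrite /glue; case: ifPn => // tt' e; have -> // : t = t' by apply/eqP; rewrite eq_le tt' t't.
rewrite !glueT // => /(_ (And5 erefl erefl erefl erefl erefl)).
have cl : unif_close t eps g g2.
  move=> s hs; rewrite /= /glue; case: ifPn => [st|_]; first by apply: close; lra.
  by rewrite !subrr !normr0.
move=> /(_ cl).
have bs := adm_speed_bmeas adm; have bs' := adm_speed_bmeas admg'.
have E (a b : R -> R) : sr_length t a b = Int 0 t (fun r => Num.sqrt (a r ^+ 2 + b r ^+ 2)) by [].
have E' (a b : R -> R) : sr_length t' a b = Int 0 t' (fun r => Num.sqrt (a r ^+ 2 + b r ^+ 2)) by [].
rewrite !E !E' (@Int_split R 0 t t') // [X in _ <= X](@Int_split R 0 t t') //; last first.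
  exact: adm_speed_bmeas adm2.
have -> : Int 0 t' (fun r => Num.sqrt (v1 r ^+ 2 + v2 r ^+ 2)) =
    Int 0 t' (fun r => Num.sqrt (w1 r ^+ 2 + w2 r ^+ 2)).
  by apply: Int_eq => r /andP[_ rt]; rewrite /v1 /v2 /glue rt.
have -> : Int t' t (fun r => Num.sqrt (v1 r ^+ 2 + v2 r ^+ 2)) =
    Int t' t (fun r => Num.sqrt (u1 r ^+ 2 + u2 r ^+ 2)).
  apply: Int_eq_oc; [apply: bmeasS (adm_speed_bmeas adm2); lra|apply: bmeasS bs; lra|].
  by move=> r /andP[rt _]; rewrite /v1 /v2 /glue leNgt rt.
by rewrite lerD2r.
Qed.
End Restriction.

(** * Circles with variable radius *)

Section Radial.
Variables (R : realType) (c th0 T : R) (rho drho : R -> R).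
Hypotheses (c0 : c != 0) (T0 : 0 <= T)
  (drhoE : forall s : R, 0 <= s <= T -> is_derive s 1 rho (drho s))
  (ddrho : forall s : R, 0 <= s <= T -> exists l : R, is_derive s 1 drho l).

Let th s := th0 + c * s.
Let xc := - sin th0 / c.
Let yc := cos th0 / c.
Let X s := rho s * sin (th s) / c.
Let Y s := - (rho s * cos (th s) / c).

(** Polar form about the centre (xc, yc) of the reference circle, at the same angle and with the
    radius multiplied by rho; rho = 1 gives the reference extremal. *)
Definition rad_x s := xc + rho s * sin (th s) / c.
Definition rad_y s := yc - rho s * cos (th s) / c.
Definition rad_u1 s := drho s * sin (th s) / c + rho s * cos (th s).
Definition rad_u2 s := - (drho s * cos (th s) / c) + rho s * sin (th s).

Lemma rad_x_der s : 0 <= s <= T -> is_derive s 1 rad_x (rad_u1 s).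
Proof.
move=> /drhoE h; rewrite /rad_x /th /rad_u1; der; rewrite /=; by field.
Qed.

Lemma rad_y_der s : 0 <= s <= T -> is_derive s 1 rad_y (rad_u2 s).
Proof.
move=> /drhoE h; rewrite /rad_y /th /rad_u2; der; rewrite /=; by field.
Qed.

Lemma rad_u_der s : 0 <= s <= T -> (exists l : R, is_derive s 1 rad_u1 l) /\
  (exists l : R, is_derive s 1 rad_u2 l).
Proof.
move=> hs; have h := drhoE hs; have [l h2] := ddrho hs.
by split; eexists; rewrite /rad_u1 /rad_u2 /th; repeat der_step.
Qed.

Lemma bmeas_derT (f : R -> R) :
  (forall s : R, 0 <= s <= T -> exists l : R, is_derive s 1 f l) ->
  {within seg 0 T, continuous f} /\ bmeas 0 T f.
Proof.
move=> D; have ct : {within seg 0 T, continuous f}.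
  apply: continuous_in_subspaceT => s; rewrite inE /seg /= => /D[l].
  exact: der_cont.
by split => //; apply: bmeas_cont.
Qed.

Lemma Int_exact (E f g : R -> R) :
  (forall s : R, 0 <= s <= T -> is_derive s 1 E (f s - g s)) ->
  (forall s : R, 0 <= s <= T -> exists l : R, is_derive s 1 f l) ->
  (forall s : R, 0 <= s <= T -> exists l : R, is_derive s 1 g l) ->
  Int 0 T f = E T - E 0 + Int 0 T g.
Proof.
move=> dE df dg.
have [cf bf] := bmeas_derT df; have [cg bg] := bmeas_derT dg.
have [cfg bfg] : {within seg 0 T, continuous (fun s => f s - g s)} /\
    bmeas 0 T (fun s => f s - g s).
  apply: bmeas_derT => s hs; have [l h] := df s hs; have [l' h'] := dg s hs.
  by eexists; repeat der_step.
rewrite -(Int_FTC T0 dE cfg) -IntD //; apply: Int_eq => s _; ring.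
Qed.

Let dth (s : R) : is_derive s 1 th c.
Proof. by rewrite /th; der; rewrite /=; ring. Qed.

Let P s : 0 <= s <= T -> cos (th s) ^+ 2 = 1 - sin (th s) ^+ 2.
Proof. by move=> _; apply: cs1. Qed.

(** Green's formula in polar coordinates. The primitive [Ez] involves no derivative of rho, so two
    radii with the same end values have equal end terms and only the integral of rho^2 distinguishes
    them. *)
Lemma rad_z : let Ez s := 2^-1 * (xc * Y s - yc * X s) in
  Int 0 T (fun s => - (rad_y s / 2) * rad_u1 s + rad_x s / 2 * rad_u2 s) =
  Ez T - Ez 0 + (2 * c)^-1 * Int 0 T (fun s => rho s ^+ 2).
Proof.
move=> Ez.
have d2 s : 0 <= s <= T -> exists l : R, is_derive s 1 (fun s => rho s ^+ 2) l.
  by move=> /drhoE h; eexists; repeat der_step.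
rewrite -IntZ; last by case: (bmeas_derT d2).
apply: Int_exact.
- move=> s hs; have h := drhoE hs; have e := P hs.
  rewrite /Ez /X /Y /rad_x /rad_y /rad_u1 /rad_u2.
  have dt := dth s; move: (th) e dt => ph e dt.
  by der; rewrite /=; field: e.
- move=> s hs; have h1 := rad_x_der hs; have h2 := rad_y_der hs.
  have [[l1 k1] [l2 k2]] := rad_u_der hs.
  by eexists; repeat der_step.
- by move=> s hs; have h := drhoE hs; eexists; repeat der_step.
Qed.

(** Modulo an exact differential the quadratic density about the centre yields rho^3 sin; shifting
    the centre to the origin adds a multiple of the area integral. Hence this constraint is linear
    in rho^3 once the area is fixed, and likewise in [rad_w] with cos. *)
Lemma rad_v :
  let Ev s := 2^-1 * ((xc ^+ 2 + yc ^+ 2) * Y s + xc * X s * Y s + yc * Y s ^+ 2)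
    - rho s ^+ 3 * cos (th s) / (6 * c ^+ 3) in
  Int 0 T (fun s => (rad_x s ^+ 2 + rad_y s ^+ 2) / 2 * rad_u2 s) =
  Ev T - Ev 0 + (xc / (2 * c) * Int 0 T (fun s => rho s ^+ 2) +
    (3 * c ^+ 2)^-1 * Int 0 T (fun s => rho s ^+ 3 * sin (th s))).
Proof.
move=> Ev.
have d2 s : 0 <= s <= T -> exists l : R, is_derive s 1 (fun s => rho s ^+ 2) l.
  by move=> /drhoE h; eexists; repeat der_step.
have d3 s : 0 <= s <= T -> exists l : R, is_derive s 1 (fun s => rho s ^+ 3 * sin (th s)) l.
  by move=> /drhoE h; have dt := dth s; eexists; repeat der_step.
have [_ b2] := bmeas_derT d2; have [_ b3] := bmeas_derT d3.
rewrite -!IntZ // -IntD; [|apply: bmeasM => //; exact: bmeas_cst..].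
apply: Int_exact.
- move=> s hs; have h := drhoE hs; have e := P hs.
  rewrite /Ev /X /Y /rad_x /rad_y /rad_u1 /rad_u2.
  have dt := dth s; move: (th) e dt => ph e dt.
  by der; rewrite /=; field: e.
- move=> s hs; have h1 := rad_x_der hs; have h2 := rad_y_der hs.
  have [[l1 k1] [l2 k2]] := rad_u_der hs.
  by eexists; repeat der_step.
- by move=> s hs; have h := drhoE hs; have dt := dth s; eexists; repeat der_step.
Qed.

Lemma rad_w :
  let Ew s := - (2^-1 * ((xc ^+ 2 + yc ^+ 2) * X s + xc * X s ^+ 2 + yc * X s * Y s)
    + rho s ^+ 3 * sin (th s) / (6 * c ^+ 3)) in
  Int 0 T (fun s => - ((rad_x s ^+ 2 + rad_y s ^+ 2) / 2) * rad_u1 s) =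
  Ew T - Ew 0 + (yc / (2 * c) * Int 0 T (fun s => rho s ^+ 2) +
    - (3 * c ^+ 2)^-1 * Int 0 T (fun s => rho s ^+ 3 * cos (th s))).
Proof.
move=> Ew.
have d2 s : 0 <= s <= T -> exists l : R, is_derive s 1 (fun s => rho s ^+ 2) l.
  by move=> /drhoE h; eexists; repeat der_step.
have d3 s : 0 <= s <= T -> exists l : R, is_derive s 1 (fun s => rho s ^+ 3 * cos (th s)) l.
  by move=> /drhoE h; have dt := dth s; eexists; repeat der_step.
have [_ b2] := bmeas_derT d2; have [_ b3] := bmeas_derT d3.
rewrite -!IntZ // -IntD; [|apply: bmeasM => //; exact: bmeas_cst..].
apply: Int_exact.
- move=> s hs; have h := drhoE hs; have e := P hs.
  rewrite /Ew /X /Y /rad_x /rad_y /rad_u1 /rad_u2.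
  have dt := dth s; move: (th) e dt => ph e dt.
  by der; rewrite /=; field: e.
- move=> s hs; have h1 := rad_x_der hs; have h2 := rad_y_der hs.
  have [[l1 k1] [l2 k2]] := rad_u_der hs.
  by eexists; repeat der_step.
- by move=> s hs; have h := drhoE hs; have dt := dth s; eexists; repeat der_step.
Qed.

Lemma rad_speed s : rad_u1 s ^+ 2 + rad_u2 s ^+ 2 = drho s ^+ 2 / c ^+ 2 + rho s ^+ 2.
Proof.
by rewrite /rad_u1 /rad_u2; have e := cs1 (th s); field: e.
Qed.
End Radial.

(** * Cube roots and the expansion of the length density *)

Section CubeRoot.
Variable R : realType.

(** Through exp and ln the derivative and the positivity are immediate; it is the cube root for u >
    0 only. *)
Definition cbrt (u : R) := expR (ln u / 3).

Lemma cbrt_gt0 u : 0 < cbrt u. Proof. exact: expR_gt0. Qed.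

Lemma cbrtK u : 0 < u -> cbrt u ^+ 3 = u.
Proof.
move=> u0; rewrite /cbrt -expRM_natl -[RHS]lnK //; congr expR.
by rewrite -mulr_natr; field.
Qed.

Lemma cbrt1 : cbrt 1 = 1. Proof. by rewrite /cbrt ln1 mul0r expR0. Qed.

Lemma cbrt_der (f : R -> R) (x l : R) : 0 < f x -> is_derive x 1 f l ->
  is_derive x 1 (fun y => cbrt (f y)) (l / (3 * cbrt (f x) ^+ 2)).
Proof.
move=> fx df.
have h1 : is_derive x 1 (fun y => ln (f y)) ((f x)^-1 * l).
  by apply: der_comp df; apply: is_derive1_ln.
have h2 : is_derive x 1 (fun y => ln (f y) / 3) ((f x)^-1 * l / 3).
  by der; rewrite /=; ring.
apply: (der_eq (der_comp (is_derive_expR _) h2)).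
rewrite -/(cbrt (f x)); have := cbrtK fx; have := cbrt_gt0 (f x).
move: (cbrt (f x)) => r r0 rE; rewrite -rE.
have : r != 0 by exact: lt0r_neq0.
by move=> ?; field.
Qed.

(* rho = r with r^3 = 1 + z; the last bound is the length density expanded to
   second order, whose first-order part is the constrained area r^2 - 1. *)
Lemma cube_pointwise (r z dz nu : R) : 0 < r -> r ^+ 3 = 1 + z -> `|z| <= nu ->
  `|dz| <= nu -> nu <= 1 / 10 ->
  [/\ `|r - 1| <= nu, r ^+ 2 - 1 <= 2 / 3 * z, 2 / 3 * z - 2 * nu ^+ 2 <= r ^+ 2 - 1 &
   Num.sqrt ((dz / (3 * r ^+ 2)) ^+ 2 + r ^+ 2) <=
     1 + (r ^+ 2 - 1) / 2 + (dz ^+ 2 - z ^+ 2) / 18 + 3 * nu ^+ 3].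
Proof.
move=> r0 rz zn dzn n10.
have zE : z = (r - 1) * (r ^+ 2 + r + 1) by lra.
have q1 : 1 <= r ^+ 2 + r + 1 by have := sqr_ge0 r; lra.
have d1 : `|r - 1| <= nu.
  apply: le_trans zn; rewrite zE normrM ler_peMr // ger0_norm //; lra.
have nu0 : 0 <= nu by exact: le_trans d1.
have /andP[dl du] : - nu <= r - 1 <= nu by rewrite -ler_norml.
have d2 : (r - 1) ^+ 2 <= nu ^+ 2.
  by rewrite -real_normK ?num_real // lerXn2r ?nnegrE.
have z2 : z ^+ 2 <= nu ^+ 2 by rewrite -real_normK ?num_real // lerXn2r ?nnegrE.
have dz2 : dz ^+ 2 <= nu ^+ 2 by rewrite -real_normK ?num_real // lerXn2r ?nnegrE.
have e1 : r ^+ 2 - 1 = 2 / 3 * z - (r - 1) ^+ 2 * (2 * r + 1) / 3 by rewrite zE; field.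
have p0 : 0 <= (r - 1) ^+ 2 * (2 * r + 1) by rewrite mulr_ge0 ?sqr_ge0 //; lra.
split => //; first by rewrite e1; lra.
  have : (r - 1) ^+ 2 * (2 * r + 1) <= nu ^+ 2 * 6.
    by apply: ler_pM; rewrite ?sqr_ge0 //; lra.
  by rewrite e1; lra.
have r2 : 1 - 2 * nu <= r ^+ 2 by nra.
have r4 : 1 - 4 * nu <= r ^+ 2 * r ^+ 2.
  apply: (@le_trans _ _ ((1 - 2 * nu) * (1 - 2 * nu))); first by nra.
  by apply: ler_pM; lra.
have r5 : 1 - 5 * nu <= r ^+ 5.
  apply: (@le_trans _ _ ((1 - 4 * nu) * (1 - nu))); first by nra.
  have -> : r ^+ 5 = r ^+ 2 * r ^+ 2 * r by ring.
  by apply: ler_pM; lra.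
have r50 : 0 < r ^+ 5 by rewrite exprn_gt0.
have r5i : (r ^+ 5)^-1 <= 1 + 10 * nu.
  rewrite -[X in X <= _]mul1r ler_pdivrMr //.
  apply: (@le_trans _ _ ((1 + 10 * nu) * (1 - 5 * nu))); first by nra.
  by apply: ler_wpM2l; lra.
(* The tangent bound sqrt (r^2 + d) <= r + d / (2 r) with d = dz^2 / (9 r^4). *)
have s1 : Num.sqrt ((dz / (3 * r ^+ 2)) ^+ 2 + r ^+ 2) <= r + dz ^+ 2 / 18 * (r ^+ 5)^-1.
  have P : 0 <= r + dz ^+ 2 / 18 * (r ^+ 5)^-1.
    apply: addr_ge0; first exact: ltW.
    by apply: mulr_ge0; rewrite ?divr_ge0 ?sqr_ge0 // invr_ge0 ltW.
  rewrite -[X in _ <= X](@ger0_norm _ _ P) -sqrtr_sqr; apply: ler_wsqrtr.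
  have -> : (r + dz ^+ 2 / 18 * (r ^+ 5)^-1) ^+ 2 = (dz / (3 * r ^+ 2)) ^+ 2 + r ^+ 2 +
     (dz ^+ 2 / 18 * (r ^+ 5)^-1) ^+ 2 by field; exact: lt0r_neq0.
  by rewrite lerDl sqr_ge0.
apply: (le_trans s1).
have s2 : dz ^+ 2 * (r ^+ 5)^-1 <= dz ^+ 2 + 10 * nu ^+ 3.
  apply: (@le_trans _ _ (dz ^+ 2 * (1 + 10 * nu))).
    by apply: ler_wpM2l; rewrite ?sqr_ge0.
  have : dz ^+ 2 * nu <= nu ^+ 2 * nu by apply: ler_wpM2r.
  have -> : nu ^+ 3 = nu ^+ 2 * nu by ring.
  lra.
(* To first order z = 3 (r - 1), so the term - (r - 1)^2 / 2 in [rE] becomes - z^2 / 18 up to a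
   cubic error. *)
have s3 : z ^+ 2 - 9 * (r - 1) ^+ 2 <= 20 * nu ^+ 3.
  have -> : z ^+ 2 - 9 * (r - 1) ^+ 2 = (r - 1) ^+ 2 *
    ((r ^+ 2 + r - 2) * (r ^+ 2 + r + 4)) by rewrite zE; ring.
  have -> : 20 * nu ^+ 3 = nu ^+ 2 * (20 * nu) by ring.
  have k1 : r ^+ 2 + r - 2 <= 31 / 10 * nu.
    have -> : r ^+ 2 + r - 2 = 3 * (r - 1) + (r - 1) ^+ 2 by ring.
    have : nu ^+ 2 <= 1 / 10 * nu by rewrite expr2; apply: ler_wpM2r.
    lra.
  have k2 : r ^+ 2 + r + 4 <= 32 / 5.
    have -> : r ^+ 2 + r + 4 = 6 + 3 * (r - 1) + (r - 1) ^+ 2 by ring.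
    have : nu ^+ 2 <= 1 / 10 * nu by rewrite expr2; apply: ler_wpM2r.
    lra.
  have k3 : (r ^+ 2 + r - 2) * (r ^+ 2 + r + 4) <= 20 * nu.
    apply: (@le_trans _ _ (31 / 10 * nu * (r ^+ 2 + r + 4))).
      by apply: ler_wpM2r; have := sqr_ge0 r; lra.
    apply: (@le_trans _ _ (31 / 10 * nu * (32 / 5))); last by lra.
    by apply: ler_wpM2l; lra.
  apply: (@le_trans _ _ ((r - 1) ^+ 2 * (20 * nu))).
    by apply: ler_wpM2l; rewrite ?sqr_ge0.
  by apply: ler_wpM2r; lra.
have n3 : 0 <= nu ^+ 3 by rewrite exprn_ge0.
have rE : r = 1 + (r ^+ 2 - 1) / 2 - (r - 1) ^+ 2 / 2 by field.
lra.
Qed.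

(** Passes from rho^3, which is affine in the coefficient of the area correction, to rho^2; this
    makes the area a Lipschitz function of that coefficient. *)
Lemma sqr_cube_lip (r1 r2 : R) : 1 / 2 <= r1 -> 1 / 2 <= r2 ->
  `|r1 ^+ 2 - r2 ^+ 2| <= 2 * `|r1 ^+ 3 - r2 ^+ 3|.
Proof.
move=> h1 h2.
have -> : r1 ^+ 2 - r2 ^+ 2 = (r1 - r2) * (r1 + r2) by ring.
have -> : r1 ^+ 3 - r2 ^+ 3 = (r1 - r2) * (r1 ^+ 2 + r1 * r2 + r2 ^+ 2) by ring.
have q0 : 0 <= r1 * r2 by rewrite mulr_ge0 //; lra.
rewrite !normrM mulrCA; apply: ler_wpM2l => //.
rewrite !ger0_norm; first by nra.
- by rewrite !addr_ge0 ?sqr_ge0.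
- by lra.
Qed.

End CubeRoot.

(** The substitution s = k r - t carries the time interval [0, 2 t / k] onto the centred angles
    [- t, t]. *)
Lemma gap_int (R : realType) (k t q : R) (f : R -> R) : 0 < k -> 0 < t ->
  primitive_gap t f q -> (forall s : R, exists l : R, is_derive s 1 f l) ->
  Int 0 (2 * t / k) (fun r => f (k * r - t)) = q / k.
Proof.
move=> k0 t0 [F dF qE] df.
have T0 : 0 <= 2 * t / k by rewrite divr_ge0 // ltW // mulr_gt0.
have aff (r : R) : is_derive r 1 (fun r => k * r - t) k by der; rewrite /=; ring.
have E (s : R) : 0 <= s <= 2 * t / k ->
    is_derive s 1 (fun r => k^-1 * F (k * r - t)) (f (k * s - t)).
  move=> _; have h := der_comp (f := fun r => k * r - t) (x := s) (dF _) (aff s).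
  by der; rewrite /=; field; exact: lt0r_neq0.
rewrite (Int_FTC T0 E).
  have -> : k * (2 * t / k) - t = t by field; exact: lt0r_neq0.
  by rewrite mulr0 sub0r -mulrBr qE mulrC.
apply: continuous_in_subspaceT => s _; have [l h] := df (k * s - t).
exact: der_cont (der_comp (f := fun r => k * r - t) (x := s) h (aff s)).
Qed.

(** * A shorter radial competitor *)

Section RadialCompetitor.
Variable R : realType.

Lemma quad_perturb (e ka M a b a' b' : R) : 0 <= e -> 0 <= ka ->
  `|a| <= M -> `|b| <= M -> `|a'| <= M -> `|b'| <= M ->
  (e * a' + ka * b') ^+ 2 - (e * a + ka * b) ^+ 2 <=
  e ^+ 2 * (a' ^+ 2 - a ^+ 2) + (4 * e * ka * M ^+ 2 + 2 * ka ^+ 2 * M ^+ 2).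
Proof.
move=> e0 ka0 n1 n2 n3 n4.
have PM (x y : R) : `|x| <= M -> `|y| <= M -> - M ^+ 2 <= x * y <= M ^+ 2.
  by move=> ? ?; rewrite -ler_norml normrM expr2; apply: ler_pM.
have u1 := PM _ _ n3 n4; have u2 := PM _ _ n1 n2.
have u3 := PM _ _ n4 n4; have u4 := PM _ _ n2 n2.
have ek : 0 <= e * ka by exact: mulr_ge0.
have v1 : 2 * (e * ka) * (a' * b' - a * b) <= 2 * (e * ka) * (2 * M ^+ 2).
  by apply: ler_wpM2l; lra.
have v2 : ka ^+ 2 * (b' * b' - b * b) <= ka ^+ 2 * (2 * M ^+ 2).
  by apply: ler_wpM2l; [exact: sqr_ge0|lra].
lra.
Qed.

(** Since ka is at most K e^2, the cross term e ka, the square ka^2 and the cubic remainder of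
    [cube_pointwise] are all O(e^3), negligible against the gain of order e^2. *)
Lemma cubic_small (e ka K M T : R) : 0 <= T -> 0 <= e -> e <= 1 -> 0 <= K ->
  0 <= ka -> ka <= K * e ^+ 2 ->
  ((4 * e * ka * M ^+ 2 + 2 * ka ^+ 2 * M ^+ 2) / 18 + 3 * (2 * M * e) ^+ 3) * T <=
  T * ((4 * K * M ^+ 2 + 2 * K ^+ 2 * M ^+ 2) / 18 + 24 * M ^+ 3) * e * e ^+ 2.
Proof.
move=> T0 e0 e1 K0 ka0 kae; have M2 := sqr_ge0 M.
have w1 : e * ka * M ^+ 2 <= e * (K * e ^+ 2) * M ^+ 2.
  by apply: ler_wpM2r => //; apply: ler_wpM2l.
have w2 : ka ^+ 2 * M ^+ 2 <= K ^+ 2 * e ^+ 3 * M ^+ 2.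
  apply: ler_wpM2r => //; apply: (@le_trans _ _ ((K * e ^+ 2) ^+ 2)).
    by rewrite lerXn2r ?nnegrE //; apply: le_trans kae.
  have -> : (K * e ^+ 2) ^+ 2 = K ^+ 2 * e ^+ 3 * e by ring.
  by rewrite ler_piMr // mulr_ge0 ?exprn_ge0.
have -> : T * ((4 * K * M ^+ 2 + 2 * K ^+ 2 * M ^+ 2) / 18 + 24 * M ^+ 3) * e * e ^+ 2 =
  ((4 * (e * (K * e ^+ 2) * M ^+ 2) + 2 * (K ^+ 2 * e ^+ 3 * M ^+ 2)) / 18 +
   3 * (2 * M * e) ^+ 3) * T by field.
apply: ler_wpM2r => //; lra.
Qed.

Lemma near1 (r nu : R) : `|r - 1| <= nu -> nu <= 1 / 10 ->
  1 / 2 <= r /\ 1 <= 3 * r ^+ 2.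
Proof.
rewrite ler_norml => h1 h2; have h3 : 9 / 10 <= r by lra.
by split; [lra|nra].
Qed.

Lemma ivt_lipschitz (A : R -> R) (b v L : R) : 0 < b -> 0 <= L -> A 0 <= v -> v <= A b ->
  (forall x y, 0 <= x <= b -> 0 <= y <= b -> `|A x - A y| <= L * `|x - y|) ->
  exists2 x, 0 <= x <= b & A x = v.
Proof.
move=> b0 L0 A0 Ab hA.
have ct : {within `[0, b], continuous A}.
  rewrite -segE; apply: lip_within => a ha; exists 1 => //; exists L => //.
  by move=> x hx _; apply: hA.
have [|x] := IVT (ltW b0) ct (v := v).
  by apply/andP; split; [rewrite ge_min A0|rewrite le_max Ab orbT].
by rewrite in_itv /= => h1 h2; exists x.
Qed.

(** The angle th0 + c r is a rotation by th0 + sg t of the centred angle |c| r - t, reflected if c <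
    0, so its moments are combinations of the centred ones. *)
Lemma angle_moments (c th0 t : R) (f : R -> R) : c != 0 -> 0 < t ->
  (forall s : R, exists l : R, is_derive s 1 f l) ->
  primitive_gap t (fun s => f s * sin s) 0 -> primitive_gap t (fun s => f s * cos s) 0 ->
  Int 0 (2 * t / `|c|) (fun r => f (`|c| * r - t) * sin (th0 + c * r)) = 0 /\
  Int 0 (2 * t / `|c|) (fun r => f (`|c| * r - t) * cos (th0 + c * r)) = 0.
Proof.
move=> c0 t0 df gs gc; have k0 : 0 < `|c| by rewrite normr_gt0.
set T := 2 * t / `|c|; pose sg := Num.sg c; pose a0 := th0 + sg * t.
have thE r : th0 + c * r = a0 + sg * (`|c| * r - t).
  by rewrite [in LHS](numEsg c) /a0 /sg; ring.
have dfs (s : R) : exists l : R, is_derive s 1 (fun s => f s * sin s) l.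
  by have [l h] := df s; eexists; repeat der_step.
have dfc (s : R) : exists l : R, is_derive s 1 (fun s => f s * cos s) l.
  by have [l h] := df s; eexists; repeat der_step.
have aff (r : R) : is_derive r 1 (fun r => `|c| * r - t) `|c|.
  by der; rewrite /=; ring.
have bph (g : R -> R) : (forall s : R, exists l : R, is_derive s 1 g l) ->
    bmeas 0 T (fun r => g (`|c| * r - t)).
  move=> dg; apply: bmeas_der => r _; have [l h] := dg (`|c| * r - t).
  by eexists; apply: (der_comp (f := fun r => `|c| * r - t) (x := r) h (aff r)).
have bs := bph _ dfs; have bc := bph _ dfc.
have is0 := gap_int k0 t0 gs dfs; have ic0 := gap_int k0 t0 gc dfc.
rewrite -/T mul0r in is0 ic0.
have comb (x y : R) : Int 0 T (fun r => x * (f (`|c| * r - t) * cos (`|c| * r - t)) +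
    y * (f (`|c| * r - t) * sin (`|c| * r - t))) = 0.
  rewrite IntD; [|apply: bmeasM => //; exact: bmeas_cst..].
  by rewrite !IntZ // is0 ic0; ring.
split.
  rewrite -[RHS](comb (sin a0) (cos a0 * sg)); apply: Int_eq => r _.
  by rewrite thE sinD cos_sg // sin_sg -/sg; ring.
rewrite -[RHS](comb (cos a0) (- (sin a0 * sg))); apply: Int_eq => r _.
by rewrite thE cosD cos_sg // sin_sg -/sg; ring.
Qed.

(** With rho^3 = 1 + e eta + ka th the constraint on rho^2 is solved for ka by the intermediate
    value theorem on [0, K e^2]. The length then changes by at most e^2 q / (18 k) plus O(e^3),
    where k = |c| and q < 0. *)
Lemma radial_competitor (c th0 t eps : R) : c != 0 -> pi < t < 3 / 2 * pi ->
  oddD t < 0 -> 0 < eps ->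
  let T := 2 * t / `|c| in let th s := th0 + c * s in
  exists rho drho : R -> R,
  [/\ (forall s : R, 0 <= s <= T -> is_derive s 1 rho (drho s)) /\
      (forall s : R, 0 <= s <= T -> exists l : R, is_derive s 1 drho l),
      rho 0 = 1 /\ rho T = 1,
      forall s : R, 0 <= s <= T -> `|rho s - 1| <= eps /\ `|drho s| <= eps,
      [/\ Int 0 T (fun s => rho s ^+ 2) = T,
          Int 0 T (fun s => rho s ^+ 3 * sin (th s)) = Int 0 T (fun s => sin (th s)) &
          Int 0 T (fun s => rho s ^+ 3 * cos (th s)) = Int 0 T (fun s => cos (th s))] &
      Int 0 T (fun s => Num.sqrt (drho s ^+ 2 / c ^+ 2 + rho s ^+ 2)) < T].
Proof.
move=> c0 tp W0 eps0 T th.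
have [eta [deta [ta [dta [q [p [deE dtE [ddeE ddtE] [et etN tt ttN]
  [[g1 g2 g3] [g4 q0 g5 p0 [g6 g7]]]]]]]]]] := variation tp W0.
set k := `|c|; have k0 : 0 < k by rewrite normr_gt0.
have t0 : 0 < t by have := @pi_ge2 R; lra.
have T0 : 0 < T by rewrite divr_gt0 // mulr_gt0.
pose ph r := k * r - t.
have kT : k * T = 2 * t by rewrite /T -/k; field; exact: lt0r_neq0.
have phin r : 0 <= r <= T -> - t <= ph r <= t.
  move=> /andP[r0 rT].
  have a1 : 0 <= k * r by rewrite mulr_ge0 // ltW.
  have a2 : k * r <= k * T by apply: ler_wpM2l => //; exact: ltW.
  by rewrite /ph; lra.
have aff (r : R) : is_derive r 1 ph k by rewrite /ph; der; rewrite /=; ring.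
have tt0 : - t <= t by lra.
have bnd (f : R -> R) : (forall s : R, exists l : R, is_derive s 1 f l) ->
    exists B, forall s, - t <= s <= t -> `|f s| <= B.
  by move=> D; apply: der_bounded.
have [B1 b1] := bnd eta (fun s => ex_intro _ _ (deE s)).
have [B2 b2] := bnd ta (fun s => ex_intro _ _ (dtE s)).
have [B3 b3] := bnd deta ddeE. have [B4 b4] := bnd dta ddtE.
have [M [M1 Mb]] : exists M, 1 <= M /\ forall s, - t <= s <= t ->
    [/\ `|eta s| <= M, `|ta s| <= M, `|deta s| <= M & `|dta s| <= M].
  exists (1 + `|B1| + `|B2| + `|B3| + `|B4|); split.
    by rewrite -!addrA lerDl !addr_ge0.
  move=> s hs; have := b1 s hs; have := b2 s hs; have := b3 s hs; have := b4 s hs.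
  have := ler_norm B1; have := ler_norm B2; have := ler_norm B3; have := ler_norm B4.
  have := normr_ge0 B1; have := normr_ge0 B2; have := normr_ge0 B3; have := normr_ge0 B4.
  by clear; move=> *; split; lra.
have M0 : 0 < M by lra.
(* At ka = K e^2 the linear area gain 2/3 ka p / k equals the quadratic loss 2 nu^2 T for nu = 2 M
   e. *)
pose K := 12 * M ^+ 2 * T * k / p.
have K0 : 0 < K.
  by apply: divr_gt0 => //; do 2 (apply: mulr_gt0 => //); apply: mulr_gt0; rewrite ?exprn_gt0.
pose D := T * ((4 * K * M ^+ 2 + 2 * K ^+ 2 * M ^+ 2) / 18 + 24 * M ^+ 3).
have D0 : 0 < D.
  have m2 := exprn_gt0 2 M0; have m3 := exprn_gt0 3 M0; have k2 := exprn_gt0 2 K0.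
  have km := mulr_gt0 K0 m2; have kkm := mulr_gt0 k2 m2.
  by apply: mulr_gt0 => //; lra.
(* K e <= 1 gives ka <= e, which keeps the perturbation below 2 M e; 2 M e <= 1/10 is the range of
   [cube_pointwise]; the bounds by eps give closeness; the last one lets the gain exceed the cubic
   error D e^3. *)
have [e [e0 e1 [Ke Me] [ee eke] De]] : exists e, [/\ 0 < e, e <= 1,
    K * e <= 1 /\ 2 * M * e <= 1 / 10, 2 * M * e <= eps /\ k * (2 * M * e) <= eps &
    D * e < - q / (18 * k)].
  pose b := - q / (18 * k) / 2.
  have b0 : 0 < b by rewrite !divr_gt0 ?mulr_gt0 // oppr_gt0.
  exists (Num.min (Num.min 1 (Num.min (1 / K) (1 / 10 / (2 * M))))
     (Num.min (Num.min (eps / (2 * M)) (eps / (k * (2 * M)))) (b / D))).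
  set e := Num.min _ _.
  have [h1 h2 h3] : [/\ e <= 1, e <= 1 / K & e <= 1 / 10 / (2 * M)].
    by rewrite /e !ge_min !lexx !orbT.
  have [h4 h5 h6] : [/\ e <= eps / (2 * M), e <= eps / (k * (2 * M)) & e <= b / D].
    by rewrite /e !ge_min !lexx !orbT.
  have M2 : 0 < 2 * M by rewrite mulr_gt0.
  split => //.
  - have kM : 0 < k * (2 * M) by apply: mulr_gt0.
    by rewrite /e !lt_min ltr01 /=; do ?(apply/andP; split); apply: divr_gt0 => //; lra.
  - split; first by rewrite mulrC -ler_pdivlMr.
    by rewrite mulrC -ler_pdivlMr.
  - split; first by rewrite mulrC -ler_pdivlMr.
    by rewrite mulrA mulrC -ler_pdivlMr // mulr_gt0.
  - apply: (@le_lt_trans _ _ b); first by rewrite mulrC -ler_pdivlMr.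
    by rewrite /b ltr_pdivrMr //; have := b0; rewrite /b; lra.
pose nu := 2 * M * e.
have nu0 : 0 < nu by rewrite !mulr_gt0.
pose ka1 := K * e ^+ 2.
have ka10 : 0 < ka1 by rewrite mulr_gt0 // exprn_gt0.
have ka1e : ka1 <= e by rewrite /ka1 expr2 mulrA -[X in _ <= X]mul1r; apply: ler_wpM2r => //; exact: ltW.
pose Z ka s := e * eta s + ka * ta s.
pose dZ ka s := e * deta s + ka * dta s.
have Zb ka s : 0 <= ka <= ka1 -> - t <= s <= t -> `|Z ka s| <= nu /\ `|dZ ka s| <= nu.
  move=> hka /Mb[m1 m2 m3 m4].
  have N (f g : R) : `|f| <= M -> `|g| <= M -> `|e * f + ka * g| <= nu.
    move=> hf hg; apply: (le_trans (ler_normD _ _)); rewrite !normrM.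
    have -> : nu = e * M + e * M by rewrite /nu; ring.
    apply: lerD; first by rewrite gtr0_norm //; apply: ler_wpM2l => //; exact: ltW.
    have /andP[ka0 kal] := hka; apply: ler_pM => //.
    by rewrite ger0_norm //; apply: le_trans ka1e.
  by split; apply: N.
have dZE ka (s : R) : is_derive s 1 (Z ka) (dZ ka s).
  by have h1 := deE s; have h2 := dtE s; rewrite /Z /dZ; der; rewrite /=; ring.
have ddZE ka (s : R) : exists l : R, is_derive s 1 (dZ ka) l.
  have [l1 h1] := ddeE s; have [l2 h2] := ddtE s; eexists; rewrite /dZ; repeat der_step.
pose rho ka r := cbrt (1 + Z ka (ph r)).
pose drho ka r := k * dZ ka (ph r) / (3 * rho ka r ^+ 2).
have Z1 ka r : 0 <= ka <= ka1 -> 0 <= r <= T -> 0 < 1 + Z ka (ph r).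
  move=> hka /phin hr; have [h _] := Zb ka (ph r) hka hr.
  move: h; rewrite ler_norml => /andP[h _]; rewrite -ltrBlDl sub0r.
  by apply: lt_le_trans h; rewrite ltrN2; apply: le_lt_trans Me _; clear; lra.
have rhoK ka r : 0 <= ka <= ka1 -> 0 <= r <= T -> rho ka r ^+ 3 = 1 + Z ka (ph r).
  by move=> hka hr; apply: cbrtK; apply: Z1.
have rho0 ka r : 0 < rho ka r by apply: cbrt_gt0.
have dZph ka (r : R) : is_derive r 1 (fun r => Z ka (ph r)) (dZ ka (ph r) * k).
  exact: (der_comp (f := ph) (x := r) (dZE ka _) (aff r)).
have drhoE ka (r : R) : 0 <= ka <= ka1 -> 0 <= r <= T -> is_derive r 1 (rho ka) (drho ka r).
  move=> hka hr; have h := dZph ka r.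
  have h1 : is_derive r 1 (fun r => 1 + Z ka (ph r)) (dZ ka (ph r) * k).
    by der; rewrite /=; ring.
  apply: (der_eq (cbrt_der (f := fun r => 1 + Z ka (ph r)) (x := r) (Z1 ka r hka hr) h1)).
  by rewrite /drho /rho [k * _]mulrC.
have ddrhoE ka (r : R) : 0 <= ka <= ka1 -> 0 <= r <= T -> exists l : R, is_derive r 1 (drho ka) l.
  move=> hka hr; have h := drhoE ka r hka hr; have [l hl] := ddZE ka (ph r).
  have h1 := der_comp (f := ph) (x := r) hl (aff r).
  have h2 : is_derive r 1 (fun r => 3 * rho ka r ^+ 2) (3 * (2 * rho ka r * drho ka r)).
    by der; rewrite /=; ring.
  have n0 : 3 * rho ka r ^+ 2 != 0.
    by apply: lt0r_neq0; rewrite mulr_gt0 // exprn_gt0.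
  have h3 := derV (f := fun r => 3 * rho ka r ^+ 2) n0 h2.
  by eexists; rewrite /drho; repeat der_step.
have pt ka r : 0 <= ka <= ka1 -> 0 <= r <= T ->
  [/\ `|rho ka r - 1| <= nu, rho ka r ^+ 2 - 1 <= 2 / 3 * Z ka (ph r),
      2 / 3 * Z ka (ph r) - 2 * nu ^+ 2 <= rho ka r ^+ 2 - 1 &
      Num.sqrt ((dZ ka (ph r) / (3 * rho ka r ^+ 2)) ^+ 2 + rho ka r ^+ 2) <=
      1 + (rho ka r ^+ 2 - 1) / 2 + (dZ ka (ph r) ^+ 2 - Z ka (ph r) ^+ 2) / 18 + 3 * nu ^+ 3].
  move=> hka hr; have [h1 h2] := Zb ka (ph r) hka (phin r hr).
  by apply: cube_pointwise => //; exact: rhoK.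
have bD (f : R -> R) : (forall s : R, 0 <= s <= T -> exists l : R, is_derive s 1 f l) -> bmeas 0 T f.
  by move=> h; case: (bmeas_derT h).
have brho2 ka : 0 <= ka <= ka1 -> bmeas 0 T (fun r => rho ka r ^+ 2).
  by move=> hka; apply: bD => r hr; have h := drhoE ka r hka hr; eexists; repeat der_step.
have bZ ka : bmeas 0 T (fun r => Z ka (ph r)).
  by apply: bD => r _; eexists; apply: dZph.
have dphi (f : R -> R) : (forall s : R, exists l : R, is_derive s 1 f l) ->
    forall r : R, exists l : R, is_derive r 1 (fun r => f (ph r)) l.
  move=> D0' r; have [l h] := D0' (ph r).
  by eexists; apply: (der_comp (f := ph) (x := r) h (aff r)).
have bph (f : R -> R) : (forall s : R, exists l : R, is_derive s 1 f l) ->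
    bmeas 0 T (fun r => f (ph r)).
  by move=> D0'; apply: bD => r _; apply: dphi.
have deta' (s : R) : exists l : R, is_derive s 1 eta l by eexists; apply: deE.
have dta' (s : R) : exists l : R, is_derive s 1 ta l by eexists; apply: dtE.
have gi f v : primitive_gap t f v -> (forall s : R, exists l : R, is_derive s 1 f l) ->
    Int 0 T (fun r => f (ph r)) = v / k.
  by move=> h1 h2; apply: (gap_int k0 t0 h1 h2).
have bZc ka : bmeas 0 T (fun r => ka * ta (ph r)).
  by apply: bmeasM; [exact: bmeas_cst|exact: bph].
have bZe : bmeas 0 T (fun r => e * eta (ph r)).
  by apply: bmeasM; [exact: bmeas_cst|exact: bph].
have IZ ka : Int 0 T (fun r => Z ka (ph r)) = ka * (p / k).
  rewrite /Z IntD // !IntZ; [|exact: bph..].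
  by rewrite (gi _ _ g1) // (gi _ _ g5) // mul0r mulr0 add0r.
pose A ka := Int 0 T (fun r => rho ka r ^+ 2).
have k00 : (0 : R) <= (0 : R) <= ka1 by rewrite lexx ltW.
have k01 : 0 <= ka1 <= ka1 by rewrite lexx ltW.
(* r^2 is concave in r^3, so r^2 - 1 <= 2/3 z, and the integral of e eta is zero. *)
have A0 : A 0 <= T.
  have -> : T = Int 0 T (fun r => 1 + 2 / 3 * Z 0 (ph r)).
    rewrite IntD; [|exact: bmeas_cst|by apply: bmeasM; [exact: bmeas_cst|]].
    by rewrite Int_cst ?ltW // IntZ // IZ; ring.
  apply: Int_le; first exact: brho2.
    by apply: bmeasD; [exact: bmeas_cst|by apply: bmeasM; [exact: bmeas_cst|]].
  by move=> r hr; have [_ h _ _] := pt 0 r k00 hr; move: h; clear; lra.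
have A1 : T <= A ka1.
  have E : Int 0 T (fun r => (1 - 2 * nu ^+ 2) + 2 / 3 * Z ka1 (ph r)) = T.
    rewrite IntD; [|exact: bmeas_cst|by apply: bmeasM; [exact: bmeas_cst|]].
    rewrite Int_cst ?ltW // IntZ // IZ /ka1 /K /nu; field.
    by apply/andP; split; exact: lt0r_neq0.
  rewrite -[X in X <= _]E; apply: Int_le; last 1 first.
  - by move=> r hr; have [_ _ h _] := pt ka1 r k01 hr; move: h; clear; lra.
  - by apply: bmeasD; [exact: bmeas_cst|by apply: bmeasM; [exact: bmeas_cst|]].
  - exact: brho2.
have A_lip a b : 0 <= a <= ka1 -> 0 <= b <= ka1 -> `|A a - A b| <= 2 * M * T * `|a - b|.
  move=> ha hb; have -> : A a - A b = Int 0 T (fun r => rho a r ^+ 2 + -1 * rho b r ^+ 2).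
    rewrite IntD ?IntZ; [|exact: brho2..|by apply: bmeasM; [exact: bmeas_cst|exact: brho2]].
    by rewrite mulN1r.
  have -> : 2 * M * T * `|a - b| = 2 * M * `|a - b| * (T - 0) by ring.
  apply: Int_norm; first exact: ltW.
    by apply: bmeasD; [exact: brho2|apply: bmeasM; [exact: bmeas_cst|exact: brho2]].
  move=> r hr; rewrite mulN1r.
  have [h1 _ _ _] := pt a r ha hr; have [h2 _ _ _] := pt b r hb hr.
  have [h3 _] := near1 h1 Me; have [h4 _] := near1 h2 Me.
  apply: (le_trans (sqr_cube_lip h3 h4)).
  rewrite !rhoK //; have -> : 1 + Z a (ph r) - (1 + Z b (ph r)) = (a - b) * ta (ph r).
    by rewrite /Z; ring.
  rewrite normrM -mulrA; apply: ler_wpM2l => //; rewrite mulrC.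
  by apply: ler_wpM2r => //; case: (Mb _ (phin r hr)).
have [ka hka Aka] : exists2 ka, 0 <= ka <= ka1 & A ka = T.
  apply: (ivt_lipschitz ka10 _ A0 A1 A_lip).
  by rewrite !mulr_ge0 // ltW.
exists (rho ka), (drho ka).
have phT : ph T = t by rewrite /ph kT; ring.
have ph0 : ph 0 = - t by rewrite /ph mulr0 sub0r.
have c2 : c ^+ 2 = k ^+ 2 by rewrite real_normK ?num_real.
split.
- by split=> r hr; [apply: drhoE|apply: ddrhoE].
- by rewrite /rho phT ph0 /Z et etN tt ttN !mulr0 !addr0 cbrt1.
- move=> r hr; have [h1 _ _ _] := pt ka r hka hr; split; first exact: le_trans h1 ee.
  have [_ h2] := Zb ka (ph r) hka (phin r hr).
  have [_ r1] := near1 h1 Me.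
  have r10 : 0 < 3 * rho ka r ^+ 2 := lt_le_trans ltr01 r1.
  rewrite /drho normrM normfV [`|3 * _|]gtr0_norm //.
  apply: le_trans eke; rewrite ler_pdivrMr //.
  apply: (@le_trans _ _ (k * nu)).
    by rewrite normrM gtr0_norm //; apply: ler_wpM2l => //; exact: ltW.
  by rewrite ler_peMr // mulr_ge0 // ltW.
- split; first exact: Aka.
  all: have dth' (r : R) : is_derive r 1 th c by rewrite /th; der; rewrite /=; ring.
  all: have [m1 m2] := angle_moments th0 c0 t0 deta' g2 g3.
  all: have [m3 m4] := angle_moments th0 c0 t0 dta' g6 g7.
  all: rewrite -/k -/T in m1 m2 m3 m4.
  + have bsin : bmeas 0 T (fun r => sin (th r)).
      by apply: bD => r _; have h := dth' r; eexists; repeat der_step.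
    have b1' : bmeas 0 T (fun r => eta (ph r) * sin (th r)) by apply: bmeasM => //; exact: bph.
    have b2' : bmeas 0 T (fun r => ta (ph r) * sin (th r)) by apply: bmeasM => //; exact: bph.
    have bc x f : bmeas 0 T f -> bmeas 0 T (fun r => x * f r).
      by move=> bf; apply: bmeasM => //; exact: bmeas_cst.
    rewrite (@Int_eq _ _ _ _ (fun r => sin (th r) + (e * (eta (ph r) * sin (th r)) +
      ka * (ta (ph r) * sin (th r))))); last first.
      by move=> r hr; rewrite rhoK // /Z; ring.
    rewrite IntD //; last by apply: bmeasD; apply: bc.
    rewrite IntD; [|exact: bc..].
    by rewrite !IntZ // m1 m3 !mulr0 !addr0.
  + have bcos : bmeas 0 T (fun r => cos (th r)).
      by apply: bD => r _; have h := dth' r; eexists; repeat der_step.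
    have b1' : bmeas 0 T (fun r => eta (ph r) * cos (th r)) by apply: bmeasM => //; exact: bph.
    have b2' : bmeas 0 T (fun r => ta (ph r) * cos (th r)) by apply: bmeasM => //; exact: bph.
    have bc x f : bmeas 0 T f -> bmeas 0 T (fun r => x * f r).
      by move=> bf; apply: bmeasM => //; exact: bmeas_cst.
    rewrite (@Int_eq _ _ _ _ (fun r => cos (th r) + (e * (eta (ph r) * cos (th r)) +
      ka * (ta (ph r) * cos (th r))))); last first.
      by move=> r hr; rewrite rhoK // /Z; ring.
    rewrite IntD //; last by apply: bmeasD; apply: bc.
    rewrite IntD; [|exact: bc..].
    by rewrite !IntZ // m2 m4 !mulr0 !addr0.
(* The part 1/2 + rho^2 / 2 of the upper bound integrates to exactly T because the integral of rho^2
   is T; only the second variation and the error C1 T remain. *)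
- pose C1 := (4 * e * ka * M ^+ 2 + 2 * ka ^+ 2 * M ^+ 2) / 18 + 3 * nu ^+ 3.
  pose V r := deta (ph r) ^+ 2 - eta (ph r) ^+ 2.
  have dV (s : R) : exists l : R, is_derive s 1 (fun s => deta s ^+ 2 - eta s ^+ 2) l.
    by have [l1 h1] := ddeE s; have h2 := deE s; eexists; repeat der_step.
  have bV : bmeas 0 T V := bph _ dV.
  have IV : Int 0 T V = q / k := gi _ _ g4 dV.
  have bc x f : bmeas 0 T f -> bmeas 0 T (fun r => x * f r).
    by move=> bf; apply: bmeasM => //; exact: bmeas_cst.
  have bup : bmeas 0 T (fun r => (2^-1 + C1) + (2^-1 * rho ka r ^+ 2 + e ^+ 2 / 18 * V r)).
    by apply: bmeasD; [exact: bmeas_cst|apply: bmeasD; apply: bc => //; exact: brho2].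
  apply: (@le_lt_trans _ _ (Int 0 T
     (fun r => (2^-1 + C1) + (2^-1 * rho ka r ^+ 2 + e ^+ 2 / 18 * V r)))).
    apply: Int_le => //.
      apply: bmeas_sqrt; last by move=> r _; rewrite addr_ge0 ?divr_ge0 ?sqr_ge0.
      apply: bD => r hr; have h1 := drhoE ka r hka hr; have [l h2] := ddrhoE ka r hka hr.
      by eexists; repeat der_step.
    move=> r hr; have [_ _ _ h] := pt ka r hka hr.
    have -> : drho ka r ^+ 2 / c ^+ 2 = (dZ ka (ph r) / (3 * rho ka r ^+ 2)) ^+ 2.
      rewrite c2 /drho; field; rewrite !lt0r_neq0 //.
    apply: (le_trans h).
    have [n1 n2 n3 n4] := Mb _ (phin r hr).
    have ka_ge0 : 0 <= ka by case/andP: hka.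
    have := quad_perturb (ltW e0) ka_ge0 n1 n2 n3 n4.
    rewrite /C1 /V /Z /dZ; clear; move: (rho ka r) (_ - _) (_ + 2 * ka ^+ 2 * _) => x y z.
    move: (_ ^+ 2 - _ ^+ 2) => w hh; lra.
  rewrite IntD; [|exact: bmeas_cst|by apply: bmeasD; apply: bc => //; exact: brho2].
  rewrite Int_cst ?(ltW T0) // IntD; [|by apply: bc; exact: brho2|exact: bc].
  rewrite !IntZ //; last exact: brho2.
  rewrite -/(A ka) Aka IV subr0.
  have C1D : C1 * T <= D * e * e ^+ 2.
    case/andP: hka => ka_ge0 ka_le.
    by apply: cubic_small => //; exact: ltW.
  have fin : D * e * e ^+ 2 < - q / (18 * k) * e ^+ 2 by rewrite ltr_pM2r // exprn_gt0.
  have -> : e ^+ 2 / 18 * (q / k) = - (- q / (18 * k) * e ^+ 2) by field; exact: lt0r_neq0.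
  have h := le_lt_trans C1D fin; rewrite mulrDl.
  by move: h; move: (C1 * T) (- q / (18 * k) * e ^+ 2) => x1 x2; clear; lra.
Qed.
End RadialCompetitor.

(** * Closeness of the vertical coordinates *)

Section Close.
Variable R : realType.

(** The integrands of z, v and w depend on the controls as well, so closeness of rho alone is not
    enough: [radial_competitor] also bounds the derivative of rho. Here k stands for 1 / |c|. *)
Lemma integrands_close (B k : R) : 0 <= B -> 0 < k -> exists2 C, 0 <= C &
  forall n x y u1 u2 x' y' u1' u2' : R, 0 <= n -> n <= 1 ->
  `|x| <= B -> `|y| <= B -> `|u1| <= 1 -> `|u2| <= 1 ->
  `|x' - x| <= k * n -> `|y' - y| <= k * n ->
  `|u1' - u1| <= (1 + k) * n -> `|u2' - u2| <= (1 + k) * n ->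
  [/\ `|(- (y' / 2) * u1' + x' / 2 * u2') - (- (y / 2) * u1 + x / 2 * u2)| <= C * n,
      `|(x' ^+ 2 + y' ^+ 2) / 2 * u2' - (x ^+ 2 + y ^+ 2) / 2 * u2| <= C * n &
      `|- ((x' ^+ 2 + y' ^+ 2) / 2) * u1' - (- ((x ^+ 2 + y ^+ 2) / 2) * u1)| <= C * n].
Proof.
move=> B0 k0.
suff [K1 [K2 [K3 hK]]] : exists K1 K2 K3, forall n x y u1 u2 x' y' u1' u2' : R, 0 <= n -> n <= 1 ->
  `|x| <= B -> `|y| <= B -> `|u1| <= 1 -> `|u2| <= 1 ->
  `|x' - x| <= k * n -> `|y' - y| <= k * n ->
  `|u1' - u1| <= (1 + k) * n -> `|u2' - u2| <= (1 + k) * n ->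
  [/\ bigO n 1 K1 ((- (y' / 2) * u1' + x' / 2 * u2') - (- (y / 2) * u1 + x / 2 * u2)),
      bigO n 1 K2 ((x' ^+ 2 + y' ^+ 2) / 2 * u2' - (x ^+ 2 + y ^+ 2) / 2 * u2) &
      bigO n 1 K3 (- ((x' ^+ 2 + y' ^+ 2) / 2) * u1' - (- ((x ^+ 2 + y ^+ 2) / 2) * u1))].
  exists (`|K1| + `|K2| + `|K3|); first by rewrite !addr_ge0.
  move=> n x y u1 u2 x' y' u1' u2' n0 n1 h1 h2 h3 h4 h5 h6 h7 h8.
  have [b1 b2 b3] := hK n x y u1 u2 x' y' u1' u2' n0 n1 h1 h2 h3 h4 h5 h6 h7 h8.
  have up (K a : R) : bigO n 1 K a -> `|a| <= `|K| * n.
    by move=> [_ h]; apply: (le_trans h); rewrite expr1 ler_wpM2r // ler_norm.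
  have p1 : 0 <= `|K1| * n by rewrite mulr_ge0.
  have p2 : 0 <= `|K2| * n by rewrite mulr_ge0.
  have p3 : 0 <= `|K3| * n by rewrite mulr_ge0.
  have -> : (`|K1| + `|K2| + `|K3|) * n = `|K1| * n + `|K2| * n + `|K3| * n by ring.
  have q1 := up _ _ b1; have q2 := up _ _ b2; have q3 := up _ _ b3.
  split.
  - by apply: (le_trans q1); rewrite -addrA lerDl addr_ge0.
  - by apply: (le_trans q2); rewrite addrAC lerDr addr_ge0.
  - by apply: (le_trans q3); rewrite lerDr addr_ge0.
do 3 eexists; move=> n x y u1 u2 x' y' u1' u2' n0 n1 h1 h2 h3 h4 h5 h6 h7 h8.
have k1 : 0 <= 1 + k by lra.
have Ox : bigO n 0 B x by split=> //; rewrite expr0 mulr1.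
have Oy : bigO n 0 B y by split=> //; rewrite expr0 mulr1.
have Ou1 : bigO n 0 1 u1 by split=> //; rewrite expr0 mulr1.
have Ou2 : bigO n 0 1 u2 by split=> //; rewrite expr0 mulr1.
have Dx : bigO n 1 k (x' - x) by split; [exact: ltW|rewrite expr1].
have Dy : bigO n 1 k (y' - y) by split; [exact: ltW|rewrite expr1].
have Du1 : bigO n 1 (1 + k) (u1' - u1) by split; rewrite ?expr1.
have Du2 : bigO n 1 (1 + k) (u2' - u2) by split; rewrite ?expr1.
have half : bigO n 0 2^-1 (2^-1 : R).
  by split; rewrite ?expr0 ?mulr1 ?ger0_norm //; lra.
have Ox' := bigOD Ox (bigO_up n0 n1 (isT : (0 <= 1)%N) Dx).
have Oy' := bigOD Oy (bigO_up n0 n1 (isT : (0 <= 1)%N) Dy).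
have Ou1' := bigOD Ou1 (bigO_up n0 n1 (isT : (0 <= 1)%N) Du1).
have Ou2' := bigOD Ou2 (bigO_up n0 n1 (isT : (0 <= 1)%N) Du2).
have z1 := bigOM half (bigOD (bigON (bigOD (bigOM Dy Ou1') (bigOM Oy Du1)))
  (bigOD (bigOM Dx Ou2') (bigOM Ox Du2))).
have Or := bigOD (bigOM Ox Ox) (bigOM Oy Oy).
have Dr := bigOD (bigOD (bigOM Dx Ox') (bigOM Ox Dx)) (bigOD (bigOM Dy Oy') (bigOM Oy Dy)).
have v1 := bigOM half (bigOD (bigOM Dr Ou2') (bigOM Or Du2)).
have w1 := bigON (bigOM half (bigOD (bigOM Dr Ou1') (bigOM Or Du1))).
split.
- move: z1; set F := (X in bigO _ _ _ X).
  have -> : F = (- (y' / 2) * u1' + x' / 2 * u2') - (- (y / 2) * u1 + x / 2 * u2) by rewrite /F; field.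
  exact.
- move: v1; set F := (X in bigO _ _ _ X).
  have -> : F = (x' ^+ 2 + y' ^+ 2) / 2 * u2' - (x ^+ 2 + y ^+ 2) / 2 * u2 by rewrite /F; field.
  exact.
- move: w1; set F := (X in bigO _ _ _ X).
  have -> : F = - ((x' ^+ 2 + y' ^+ 2) / 2) * u1' - (- ((x ^+ 2 + y ^+ 2) / 2) * u1) by rewrite /F; field.
  exact.
Qed.

End Close.

(** * Failure of local optimality, and the conjugate time *)

Section NotOptimal.
Variables (R : realType) (th0 c beta : R) (thf cf : R -> R) (g : curve R).
Hypotheses (c0 : c != 0) (ext : extremal th0 c 0 beta thf cf g).
Let u1 r := cos (thf r). Let u2 r := sin (thf r).

Lemma not_local_min (t : R) : pi < t < 3 / 2 * pi -> oddD t < 0 ->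
  ~ locally_optimal (2 * t / `|c|) g u1 u2.
Proof.
move=> tp W0 [adm [eps [eps0 opt]]].
have t0 : 0 < t by have := @pi_ge2 R; lra.
have k0 : 0 < `|c| by rewrite normr_gt0.
pose T := 2 * t / `|c|.
have T0 : 0 < T by rewrite divr_gt0 // mulr_gt0.
have T0' := ltW T0.
have ki0 : 0 < `|c|^-1 by rewrite invr_gt0.
have [B B0 hB] := ref_bounded ext T0'.
have [C C0 hC] := integrands_close B0 ki0.
pose n := Num.min 1 (eps / 2 / (1 + (C * T + `|c|^-1))).
have CT0 : 0 <= C * T by exact: mulr_ge0.
have N0 : 0 <= C * T + `|c|^-1 by rewrite addr_ge0 // ltW.
have n0 : 0 < n by rewrite lt_min ltr01 /= !divr_gt0 // ltr_wpDr.
have n1 : n <= 1 by rewrite ge_min lexx.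
have nle : (C * T + `|c|^-1) * n <= eps / 2.
  apply: (@le_trans _ _ ((C * T + `|c|^-1) * (eps / 2 / (1 + (C * T + `|c|^-1))))).
    by apply: ler_wpM2l => //; rewrite /n ge_min lexx orbT.
  by apply: mul_div1p_le => //; rewrite divr_ge0 // ltW.
have CTn : C * T * n <= eps / 2.
  by apply: le_trans nle; apply: ler_wpM2r; [exact: ltW|rewrite lerDl ltW].
have kn : `|c|^-1 * n <= eps / 2.
  by apply: le_trans nle; apply: ler_wpM2r; [exact: ltW|rewrite lerDr].
have e2 : eps / 2 < eps by rewrite ltr_pdivrMr //; lra.
have [rho [drho [[dr ddr] [r0 rT] hr [i1 i2 i3] len]]] := radial_competitor th0 c0 tp W0 n0.
rewrite -/T in dr ddr rT hr i1 i2 i3 len.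
pose X := rad_x c th0 rho; pose Y := rad_y c th0 rho.
pose v1 := rad_u1 c th0 rho drho; pose v2 := rad_u2 c th0 rho drho.
pose fz (x y a b : R -> R) r := - (y r / 2) * a r + x r / 2 * b r.
pose fv (x y b : R -> R) r := (x r ^+ 2 + y r ^+ 2) / 2 * b r.
pose fw (x y a : R -> R) r := - ((x r ^+ 2 + y r ^+ 2) / 2) * a r.
(* Defining z, v and w by the integrals of the horizontality equations makes the curve admissible;
   the work lies in matching the end point. *)
pose g' := Curve X Y (fun s => Int 0 s (fz X Y v1 v2)) (fun s => Int 0 s (fv X Y v2))
  (fun s => Int 0 s (fw X Y v1)).
have dX s : 0 <= s <= T -> is_derive s 1 X (v1 s) by apply: rad_x_der.
have dY s : 0 <= s <= T -> is_derive s 1 Y (v2 s) by apply: rad_y_der.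
have dv s : 0 <= s <= T -> (exists l : R, is_derive s 1 v1 l) /\
    (exists l : R, is_derive s 1 v2 l) by apply: rad_u_der.
have bD (f : R -> R) : (forall s : R, 0 <= s <= T -> exists l : R, is_derive s 1 f l) ->
    bmeas 0 T f by apply: bmeas_der.
have bv1 : bmeas 0 T v1 by apply: bD => s /dv[].
have bv2 : bmeas 0 T v2 by apply: bD => s /dv[].
have bz : bmeas 0 T (fz X Y v1 v2).
  apply: bD => s hs; have h1 := dX s hs; have h2 := dY s hs; have [[l1 h3] [l2 h4]] := dv s hs.
  by eexists; rewrite /fz; repeat der_step.
have bv : bmeas 0 T (fv X Y v2).
  apply: bD => s hs; have h1 := dX s hs; have h2 := dY s hs; have [[l1 h3] [l2 h4]] := dv s hs.
  by eexists; rewrite /fv; repeat der_step.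
have bw : bmeas 0 T (fw X Y v1).
  apply: bD => s hs; have h1 := dX s hs; have h2 := dY s hs; have [[l1 h3] [l2 h4]] := dv s hs.
  by eexists; rewrite /fw; repeat der_step.
have cW (f : R -> R) (s : R) : s <= T -> (forall s : R, 0 <= s <= T -> exists l : R, is_derive s 1 f l) ->
    {within seg 0 s, continuous f}.
  move=> sT D; apply: continuous_in_subspaceT => r; rewrite inE /seg /= => /andP[rge rs].
  by have [|l] := D r; [rewrite rge (le_trans rs)|exact: der_cont].
have adm' : admissible T g' v1 v2.
  split; first by case: bv1.
  split; first by case: bv2.
  split.
    have [M1 m1] := bv1.2; have [M2 m2] := bv2.2; exists (`|M1| + `|M2|) => s hs; split.
      by apply: (le_trans (m1 s hs)); apply: (le_trans (ler_norm _)); rewrite lerDl.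
    by apply: (le_trans (m2 s hs)); apply: (le_trans (ler_norm _)); rewrite lerDr.
  move=> s hs; split => /=; rewrite ?Int0 ?add0r //.
  - have e : Int 0 s v1 = X s - X 0.
      apply: Int_FTC; first by case/andP: hs.
        by move=> r /andP[rge rs]; apply: dX; rewrite rge (le_trans rs) //; case/andP: hs.
      by apply: cW => [|r /dv[]//]; case/andP: hs.
    transitivity (X 0 + Int 0 s v1) => //; rewrite e; ring.
  - have e : Int 0 s v2 = Y s - Y 0.
      apply: Int_FTC; first by case/andP: hs.
        by move=> r /andP[rge rs]; apply: dY; rewrite rge (le_trans rs) //; case/andP: hs.
      by apply: cW => [|r /dv[]//]; case/andP: hs.
    transitivity (Y 0 + Int 0 s v2) => //; rewrite e; ring.
have [x0 y0 z0 v0 w0] := ref_init ext.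
have [bz0 bv0 bw0] := adm_integrands T0' adm.
have hT : 0 <= T <= T by rewrite T0' lexx.
have thE r : thf r = th0 + c * r := ref_theta ext r.
have [_ [_ [_ hadm]]] := adm.
(* The reference is the radial curve with rho = 1, so one application of [rad_z], [rad_v], [rad_w]
   to each curve compares the end points. *)
pose one : R -> R := fun=> 1; pose zero : R -> R := fun=> 0.
have dr1 s : 0 <= s <= T -> is_derive s 1 one (zero s) by move=> _; apply: der_cst.
have ddr1 s : 0 <= s <= T -> exists l : R, is_derive s 1 zero l.
  by move=> _; exists 0; apply: der_cst.
have xE r : cx g r = rad_x c th0 one r by rewrite (ref_x c0 ext) /rad_x /one; field.
have yE r : cy g r = rad_y c th0 one r by rewrite (ref_y c0 ext) /rad_y /one; field.
have u1E r : u1 r = rad_u1 c th0 one zero r by rewrite /u1 thE /rad_u1 /one /zero; ring.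
have u2E r : u2 r = rad_u2 c th0 one zero r by rewrite /u2 thE /rad_u2 /one /zero; ring.
have j1 : Int 0 T (fun s => one s ^+ 2) = T.
  rewrite (@Int_eq _ _ _ _ (fun=> 1)); last by move=> s _; rewrite expr1n.
  by rewrite Int_cst //; ring.
have j2 : Int 0 T (fun s => one s ^+ 3 * sin (th0 + c * s)) = Int 0 T (fun s => sin (th0 + c * s)).
  by apply: Int_eq => s _; rewrite expr1n mul1r.
have j3 : Int 0 T (fun s => one s ^+ 3 * cos (th0 + c * s)) = Int 0 T (fun s => cos (th0 + c * s)).
  by apply: Int_eq => s _; rewrite expr1n mul1r.
have start : same_point g' g 0 0.
  split => /=; rewrite ?Int0 ?x0 ?y0 ?z0 ?v0 ?w0 //.
  - by rewrite /X /rad_x r0 mulr0 addr0; field.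
  - by rewrite /Y /rad_y r0 mulr0 addr0; field.
have finish : same_point g' g T T.
  split => /=.
  - by rewrite xE /X /rad_x rT.
  - by rewrite yE /Y /rad_y rT.
  - have [_ _ -> _ _] := hadm T hT; rewrite z0 add0r.
    rewrite [RHS](@Int_eq _ _ _ _ (fz (rad_x c th0 one) (rad_y c th0 one)
      (rad_u1 c th0 one zero) (rad_u2 c th0 one zero))).
      rewrite /fz (rad_z th0 c0 T0' dr ddr) (rad_z th0 c0 T0' dr1 ddr1) i1 j1 r0 rT.
      by rewrite /one.
    by move=> r _; rewrite /fz -xE -yE -u1E -u2E.
  - have [_ _ _ -> _] := hadm T hT; rewrite v0 add0r.
    rewrite [RHS](@Int_eq _ _ _ _ (fv (rad_x c th0 one) (rad_y c th0 one)
      (rad_u2 c th0 one zero))).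
      rewrite /fv (rad_v th0 c0 T0' dr ddr) (rad_v th0 c0 T0' dr1 ddr1) i1 j1 i2 j2 r0 rT.
      by rewrite /one.
    by move=> r _; rewrite /fv -xE -yE -u2E.
  - have [_ _ _ _ ->] := hadm T hT; rewrite w0 add0r.
    rewrite [RHS](@Int_eq _ _ _ _ (fw (rad_x c th0 one) (rad_y c th0 one)
      (rad_u1 c th0 one zero))).
      rewrite /fw (rad_w th0 c0 T0' dr ddr) (rad_w th0 c0 T0' dr1 ddr1) i1 j1 i3 j3 r0 rT.
      by rewrite /one.
    by move=> r _; rewrite /fw -xE -yE -u1E.
have small (a b : R) : `|a| <= n -> `|b| <= 1 -> `|a * b / c| <= `|c|^-1 * n.
  move=> ha hb; rewrite !normrM normfV mulrC; apply: ler_wpM2l; first exact: ltW.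
  by rewrite -[X in _ <= X]mulr1; apply: ler_pM.
have small1 (a b : R) : `|a| <= n -> `|b| <= 1 -> `|a * b| <= n.
  by move=> ha hb; rewrite normrM -[X in _ <= X]mulr1; apply: ler_pM.
have cX s : 0 <= s <= T -> `|X s - cx g s| <= `|c|^-1 * n.
  move=> hs; rewrite xE /X /rad_x /one.
  have -> : - sin th0 / c + rho s * sin (th0 + c * s) / c - (- sin th0 / c + 1 * sin (th0 + c * s) / c)
    = (rho s - 1) * sin (th0 + c * s) / c by field.
  by apply: small; [case: (hr s hs)|exact: sin_max].
have cY s : 0 <= s <= T -> `|Y s - cy g s| <= `|c|^-1 * n.
  move=> hs; rewrite yE /Y /rad_y /one -normrN.
  have -> : - (cos th0 / c - rho s * cos (th0 + c * s) / c - (cos th0 / c - 1 * cos (th0 + c * s) / c))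
    = (rho s - 1) * cos (th0 + c * s) / c by field.
  by apply: small; [case: (hr s hs)|exact: cos_max].
have cv1 s : 0 <= s <= T -> `|v1 s - u1 s| <= (1 + `|c|^-1) * n.
  move=> hs; rewrite u1E /v1 /rad_u1 /one /zero.
  have -> : drho s * sin (th0 + c * s) / c + rho s * cos (th0 + c * s) -
      (0 * sin (th0 + c * s) / c + 1 * cos (th0 + c * s)) =
     (rho s - 1) * cos (th0 + c * s) + drho s * sin (th0 + c * s) / c by ring.
  have [h1 h2] := hr s hs.
  have -> : (1 + `|c|^-1) * n = n + `|c|^-1 * n by ring.
  apply: (le_trans (ler_normD _ _)); apply: lerD.
    by apply: small1 => //; exact: cos_max.
  by apply: small => //; exact: sin_max.
have cv2 s : 0 <= s <= T -> `|v2 s - u2 s| <= (1 + `|c|^-1) * n.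
  move=> hs; rewrite u2E /v2 /rad_u2 /one /zero.
  have -> : - (drho s * cos (th0 + c * s) / c) + rho s * sin (th0 + c * s) -
      (- (0 * cos (th0 + c * s) / c) + 1 * sin (th0 + c * s)) =
     (rho s - 1) * sin (th0 + c * s) - drho s * cos (th0 + c * s) / c by ring.
  have [h1 h2] := hr s hs.
  have -> : (1 + `|c|^-1) * n = n + `|c|^-1 * n by ring.
  apply: (le_trans (ler_normB _ _)); apply: lerD.
    by apply: small1 => //; exact: sin_max.
  by apply: small => //; exact: cos_max.
have close s : 0 <= s <= T ->
  [/\ `|fz X Y v1 v2 s - fz (cx g) (cy g) u1 u2 s| <= C * n,
      `|fv X Y v2 s - fv (cx g) (cy g) u2 s| <= C * n &
      `|fw X Y v1 s - fw (cx g) (cy g) u1 s| <= C * n].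
  move=> hs; have [h1 h2 _ _ _] := hB s hs.
  by apply: hC => //; [exact: ltW|exact: cos_max|exact: sin_max|exact: cX|exact: cY
    |exact: cv1|exact: cv2].
have intclose (f f0 : R -> R) s : 0 <= s <= T -> bmeas 0 T f -> bmeas 0 T f0 ->
    (forall r, 0 <= r <= T -> `|f r - f0 r| <= C * n) -> `|Int 0 s f0 - Int 0 s f| < eps.
  move=> /andP[s0 sT] bf bf0 h.
  have bfs : bmeas 0 s f by apply: bmeasS bf.
  have bfs0 : bmeas 0 s f0 by apply: bmeasS bf0.
  have -> : Int 0 s f0 - Int 0 s f = Int 0 s (fun r => f0 r + -1 * f r).
    by rewrite IntD // ?IntZ ?mulN1r //; apply: bmeasM => //; exact: bmeas_cst.
  apply: le_lt_trans e2; apply: le_trans CTn.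
  apply: (@le_trans _ _ (C * n * (s - 0))).
    apply: Int_norm => //.
      by apply: bmeasD => //; apply: bmeasM => //; exact: bmeas_cst.
    by move=> r /andP[h1 h2]; rewrite mulN1r distrC; apply: h; rewrite h1 (le_trans h2).
  by rewrite subr0 mulrAC; apply: ler_wpM2r; [exact: ltW|apply: ler_wpM2l].
have uc : unif_close T eps g g'.
  move=> s hs; have [ez ev ew] := let: And5 _ _ a b d := hadm s hs in And3 a b d.
  split => /=.
  - by rewrite distrC; apply: le_lt_trans e2; apply: le_trans kn; exact: cX.
  - by rewrite distrC; apply: le_lt_trans e2; apply: le_trans kn; exact: cY.
  - rewrite ez z0 add0r -[X in `|X - _|]/(Int 0 s (fz (cx g) (cy g) u1 u2)).
    by apply: intclose => // r hr'; case: (close r hr').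
  - rewrite ev v0 add0r -[X in `|X - _|]/(Int 0 s (fv (cx g) (cy g) u2)).
    by apply: intclose => // r hr'; case: (close r hr').
  - rewrite ew w0 add0r -[X in `|X - _|]/(Int 0 s (fw (cx g) (cy g) u1)).
    by apply: intclose => // r hr'; case: (close r hr').
have e : sr_length T v1 v2 = Int 0 T (fun s => Num.sqrt (drho s ^+ 2 / c ^+ 2 + rho s ^+ 2)).
  by apply: Int_eq => s _; rewrite /v1 /v2 rad_speed.
have := opt g' v1 v2 adm' start finish uc.
by rewrite -/T ref_length // e leNgt len.
Qed.
End NotOptimal.

Theorem theorem6p3 (R : realType) (th0 c alpha beta : R)
    (thf cf : R -> R) (g : curve R) :
  alpha = 0 -> c != 0 ->
  extremal th0 c alpha beta thf cf g ->
  t1conj thf g = ((4 / `|c|) * p1V0 R)%:E.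
Proof.
move=> -> c0 ext; have k0 : 0 < `|c| by rewrite normr_gt0.
have [/andP[p1 p2] _ _ neg] := p1V0_spec R.
have pi0 := @pi_ge R.
have p0 : 0 < p1V0 R by lra.
set Tm := 4 / `|c| * p1V0 R.
have Tm0 : 0 < Tm by rewrite mulr_gt0 // divr_gt0.
apply/eqP; rewrite eq_le; apply/andP; split.
  apply: ge_ereal_sup => _ [t [t0 opt] <-]; rewrite lee_fin leNgt; apply/negP => tT.
  (* A half-angle strictly between the critical one and both 3 pi / 2 and |c| t / 2: it falls under
     [not_local_min], and its time 2 tau / |c| does not exceed t. *)
  pose tau := (2 * p1V0 R + Num.min (3 / 2 * pi) (`|c| * t / 2)) / 2.
  have ht : 2 * p1V0 R < `|c| * t / 2.
    move: tT; rewrite /Tm mulrAC ltr_pdivrMr // => h.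
    by rewrite ltr_pdivlMr //; lra.
  have hm : 2 * p1V0 R < Num.min (3 / 2 * pi) (`|c| * t / 2) by rewrite lt_min p2.
  have hm1 : Num.min (3 / 2 * pi) (`|c| * t / 2) <= 3 / 2 * pi by rewrite ge_min lexx.
  have hm2 : Num.min (3 / 2 * pi) (`|c| * t / 2) <= `|c| * t / 2 by rewrite ge_min lexx orbT.
  have t1 : 2 * p1V0 R < tau < 3 / 2 * pi by rewrite /tau; lra.
  have t2 : 2 * tau / `|c| <= t by rewrite ler_pdivrMr // /tau; lra.
  have tau0 : 0 < tau by lra.
  apply: (@not_local_min _ th0 c beta thf cf g c0 ext tau); first by lra.
    by apply: neg; lra.
  apply: (locally_optimal_restrict _ t2 opt).
  by rewrite divr_ge0 // ltW // mulr_gt0.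
apply/lee_addgt0Pr => e e0.
(* A time within e below Tm; the maximum with Tm / 2 keeps it positive when e is large. *)
pose r := Num.max (Tm / 2) (Tm - e).
have r0 : 0 < r by rewrite lt_max divr_gt0.
have rT : r < Tm by rewrite gt_max; lra.
apply: (@le_trans _ _ (r + e)%:E).
  have : Tm - e <= r by rewrite le_max lexx orbT.
  by rewrite lee_fin; lra.
rewrite EFinD leeD2r //; apply: ereal_sup_ubound; exists r => //.
by split => //; apply: (local_min c0 ext).
Qed.
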